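(* A connected Lagrangian surface in $\mathbb{H}^2\times\mathbb{H}^2$ has parallel second fundamental form if and only if it is one of the following: (a) a product of curves of constant geodesic curvature in $\mathbb{H}^2$; (b) a surface which is, up to a holomorphic or anti-holomorphic isometry of $\mathbb{H}^2\times\mathbb{H}^2$, equal to an open part of the diagonal surface.
   Context: All manifolds, maps and curves are smooth. $\mathbb{R}^3_1$ is $\mathbb{R}^3$ with the metric $\langle a,b\rangle=-a_1b_1+a_2b_2+a_3b_3$, and $a\boxtimes b=(a_3b_2-a_2b_3,\ a_3b_1-a_1b_3,\ a_1b_2-a_2b_1)$ is the Lorentzian cross product. For $c<0$, $\mathbb{H}^2(c)=\{x\in\mathbb{R}^3_1\mid\langle x,x\rangle=1/c,\ x_1>0\}$ with the induced Riemannian metric (of constant Gaussian curvature $c$) and complex structure $(J_{\mathbb{H}^2(c)})_xv=\sqrt{-c}\,x\boxtimes v$. Write $\mathbb{H}^2=\mathbb{H}^2(-1)$. The product $\mathbb{H}^2\times\mathbb{H}^2\subset\mathbb{R}^3_1\times\mathbb{R}^3_1$ carries the Riemannian product metric and the complex structure $J=(J_{\mathbb{H}^2},-J_{\mathbb{H}^2})$. A holomorphic (respectively, anti-holomorphic) isometry is an isometry whose differential preserves $J$ (respectively, takes $J$ to $-J$). A Lagrangian surface is a surface $\Sigma$ with an immersion $\Phi:\Sigma\to\mathbb{H}^2\times\mathbb{H}^2$ such that $J$ maps each tangent plane of the surface to its orthogonal complement. $\Sigma$ carries the induced metric with Levi-Civita connection $\nabla$; $h$ is the second fundamental form and $\nabla^\perp$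 the normal connection. The surface has parallel second fundamental form if $\overline\nabla h=0$, where $(\overline{\nabla}h)(X,Y,Z)=\nabla^{\perp}_Xh(Y,Z)-h(\nabla_XY,Z)-h(Y,\nabla_XZ)$ for all tangent vector fields $X,Y,Z$. A product of curves is the surface given by an immersion $I_1\times I_2\subseteq\mathbb{R}^2\to\mathbb{H}^2\times\mathbb{H}^2:(s_1,s_2)\mapsto(\beta_1(s_1),\beta_2(s_2))$, where $I_1,I_2\subseteq\mathbb{R}$ are open intervals and $\beta_1:I_1\to\mathbb{H}^2$, $\beta_2:I_2\to\mathbb{H}^2$ are curves parametrized by arc length; in (a) both $\beta_1$ and $\beta_2$ have constant geodesic curvature. The diagonal surface is the image of the immersion $\mathbb{H}^2(-1/2)\to\mathbb{H}^2\times\mathbb{H}^2:x\mapsto\tfrac{1}{\sqrt2}(x,x)$.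
   Formalization: In (a) the surface is only required to have as image an open part of a product of curves of constant geodesic curvature: read literally, (a) fails for a product of two geodesics restricted to an open disc, which is connected, Lagrangian and parallel but not a product over I1×I2. *)

(* Defs.v *)
From HB Require Import structures.
From mathcomp Require Import all_boot all_order all_algebra.
From mathcomp Require Import all_classical all_reals all_analysis.

Set Implicit Arguments.
Unset Strict Implicit.
Unset Printing Implicit Defensive.

Import Order.TTheory GRing.Theory Num.Theory.
Import numFieldNormedType.Exports.

Local Open Scope classical_set_scope.
Local Open Scope ring_scope.

(** * Smooth maps *)

Section Smooth.
Context {R : realType}.

(* C^k on [U], meaningful for [U] open.  On finite-dimensional spaces, [f] is
   C^(k+1) iff it is differentiable and all its directional derivatives
   are C^k. *)
Fixpoint Ck_on (V W : normedModType R) (k : nat) (U : set V) (f : V -> W)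
    {struct k} : Prop :=
  match k with
  | 0%N => forall x, U x -> {for x, continuous f}
  | k'.+1 => (forall x, U x -> differentiable f x) /\
             (forall v, Ck_on k' U ('D_v f))
  end.

Definition smooth_on (V W : normedModType R) (U : set V) (f : V -> W) : Prop :=
  forall k, Ck_on k U f.

End Smooth.

(** * Abstract smooth surfaces *)

(* [chart_map] matters only on [chart_dom], and [chart_inv] only on
   [chart_im]. *)
Record chart (R : realType) (M : topologicalType) := Chart {
  chart_dom : set M;
  chart_map : M -> 'rV[R]_2;
  chart_inv : 'rV[R]_2 -> M }.

Section Charts.
Context {R : realType} {M : topologicalType}.
Implicit Types c d : chart R M.

Definition chart_im c : set 'rV[R]_2 := chart_map c @` chart_dom c.

Definition is_chart c : Prop :=
  [/\ open (chart_dom c), open (chart_im c),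
      {within chart_dom c, continuous (chart_map c)},
      {within chart_im c, continuous (chart_inv c)} &
      forall p, chart_dom c p -> chart_inv c (chart_map c p) = p].

Definition chart_compatible c d : Prop :=
  smooth_on (chart_map c @` (chart_dom c `&` chart_dom d))
            (chart_map d \o chart_inv c).

End Charts.

Record smooth_surface (R : realType) := SmoothSurface {
  surf_space :> topologicalType;
  surf_atlas : set (chart R surf_space);
  surf_hausdorff : hausdorff_space surf_space;
  surf_second_countable : @second_countable surf_space;
  surf_chart : forall c, surf_atlas c -> is_chart c;
  surf_cover : forall p, exists2 c, surf_atlas c & chart_dom c p;
  surf_compatible : forall c d,
    surf_atlas c -> surf_atlas d -> chart_compatible c d }.

(** * The hyperbolic plane and the product of two hyperbolic planes *)

Section Hyperbolic.
Context {R : realType}.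
Local Notation R31 := 'rV[R]_3.
Local Notation E := (R31 * R31)%type.

Definition lorentz (a b : R31) : R :=
  - (a 0 0 * b 0 0) + a 0 1 * b 0 1 + a 0 2 * b 0 2.

Definition lcross (a b : R31) : R31 :=
  \row_(i < 3) nth 0 [:: a 0 2 * b 0 1 - a 0 1 * b 0 2;
                         a 0 2 * b 0 0 - a 0 0 * b 0 2;
                         a 0 0 * b 0 1 - a 0 1 * b 0 0] i.

Definition hyp (c : R) : set R31 :=
  [set x | lorentz x x = c^-1 /\ 0 < x 0 0].

Definition J_hyp (c : R) (x v : R31) : R31 :=
  Num.sqrt (- c) *: lcross x v.

(* Orthogonal projection of R^3_1 onto the tangent plane {v | <v, x> = 0} of
   H^2(-1) at x; recall that <x, x> = -1. *)
Definition hyp_proj (x w : R31) : R31 := w + lorentz w x *: x.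

Definition HH : set E := hyp (-1) `*` hyp (-1).

Definition gE (a b : E) : R := lorentz a.1 b.1 + lorentz a.2 b.2.

Definition HH_tangent (x : E) : set E :=
  [set v | lorentz v.1 x.1 = 0 /\ lorentz v.2 x.2 = 0].

Definition HH_proj (x w : E) : E := (hyp_proj x.1 w.1, hyp_proj x.2 w.2).

Definition J_HH (x v : E) : E :=
  (J_hyp (-1) x.1 v.1, - J_hyp (-1) x.2 v.2).

(* A smooth self-map of the closed submanifold HH is represented by a map of
   the ambient space that is smooth on some neighbourhood of HH; only its
   values on HH and its derivatives in directions tangent to HH are used. *)
Definition smooth_HH_map (f : E -> E) : Prop :=
  (exists O : set E, [/\ open O, HH `<=` O & smooth_on O f]) /\
  (forall x, HH x -> HH (f x)).

Definition HH_isometry (f : E -> E) : Prop :=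
  [/\ smooth_HH_map f,
      exists g : E -> E, [/\ smooth_HH_map g,
        forall x, HH x -> g (f x) = x & forall x, HH x -> f (g x) = x] &
      forall x v w, HH x -> HH_tangent x v -> HH_tangent x w ->
        gE ('D_v f x) ('D_w f x) = gE v w].

Definition holomorphic_isometry (f : E -> E) : Prop :=
  HH_isometry f /\
  forall x v, HH x -> HH_tangent x v ->
    'D_(J_HH x v) f x = J_HH (f x) ('D_v f x).

Definition antiholomorphic_isometry (f : E -> E) : Prop :=
  HH_isometry f /\
  forall x v, HH x -> HH_tangent x v ->
    'D_(J_HH x v) f x = - J_HH (f x) ('D_v f x).

(** ** Model surfaces *)

Definition open_interval (I : set R) : Prop :=
  [/\ open I, is_interval I & I !=set0].

Definition arclength_curve (I : set R) (beta : R -> R31) : Prop :=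
  [/\ smooth_on I beta, forall s, I s -> hyp (-1) (beta s) &
      forall s, I s -> lorentz (derive1 beta s) (derive1 beta s) = 1].

(* <nabla_T T, J T> with T = beta' *)
Definition geodesic_curvature (beta : R -> R31) (s : R) : R :=
  lorentz (hyp_proj (beta s) (derive1 (derive1 beta) s)) (J_hyp (-1) (beta s) (derive1 beta s)).

Definition constant_curvature (I : set R) (beta : R -> R31) : Prop :=
  exists k : R, forall s, I s -> geodesic_curvature beta s = k.

Definition product_of_curves (I1 I2 : set R) (beta1 beta2 : R -> R31) : set E :=
  [set (beta1 s.1, beta2 s.2) | s in I1 `*` I2].

Definition diagonal_surface : set E :=
  [set ((Num.sqrt 2)^-1 *: x, (Num.sqrt 2)^-1 *: x) | x in hyp (- 2^-1)].

Definition open_part (A B : set E) : Prop :=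
  exists2 O : set E, open O & A = B `&` O.

End Hyperbolic.

(** * Local geometry of an immersion [F] of an open subset of R^2 into HH *)

Section LocalGeometry.
Context {R : realType}.
Local Notation R31 := 'rV[R]_3.
Local Notation E := (R31 * R31)%type.
Local Notation plane := 'rV[R]_2.
Variable F : plane -> E.
Implicit Types (X Y Z : plane -> plane) (W xi : plane -> E) (u : plane).

Definition coord_vec (i : 'I_2) : plane := delta_mx 0 i.

Definition gram u : 'M[R]_2 :=
  \matrix_(i, j) gE ('D_(coord_vec i) F u) ('D_(coord_vec j) F u).

Definition christoffel (k i j : 'I_2) u : R :=
  2^-1 * \sum_(l < 2) invmx (gram u) k l *
    ('D_(coord_vec i) (fun u' => gram u' j l) u
     + 'D_(coord_vec j) (fun u' => gram u' i l) u
     - 'D_(coord_vec l) (fun u' => gram u' i j) u).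

(* Levi-Civita connection of the induced metric *)
Definition nabla X Y : plane -> plane := fun u =>
  'D_(X u) Y u
  + \row_(k < 2) \sum_(i < 2) \sum_(j < 2)
      christoffel k i j u * X u 0 i * Y u 0 j.

(* Levi-Civita connection of HH, for vector fields along [F] *)
Definition nabla_HH X W : plane -> E := fun u =>
  HH_proj (F u) ('D_(X u) W u).

(* Component orthogonal to the surface *)
Definition normal_part W : plane -> E := fun u =>
  W u - \sum_(i < 2) \sum_(j < 2)
    (invmx (gram u) i j * gE (W u) ('D_(coord_vec i) F u))
      *: 'D_(coord_vec j) F u.

Definition pushforward Y : plane -> E := fun u => 'D_(Y u) F u.

Definition second_ff X Y : plane -> E :=
  normal_part (nabla_HH X (pushforward Y)).

Definition nabla_perp X xi : plane -> E := normal_part (nabla_HH X xi).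

Definition nabla_second_ff X Y Z : plane -> E := fun u =>
  nabla_perp X (second_ff Y Z) u
  - second_ff (nabla X Y) Z u - second_ff Y (nabla X Z) u.

End LocalGeometry.

(** * Lagrangian surfaces *)

Section Surfaces.
Context {R : realType} (S : smooth_surface R).
Local Notation E := ('rV[R]_3 * 'rV[R]_3)%type.
Implicit Type Phi : S -> E.

Definition local_rep Phi (c : chart R S) : 'rV[R]_2 -> E := Phi \o chart_inv c.

Definition immersion_into_HH Phi : Prop :=
  (forall p, HH (Phi p)) /\
  forall c, surf_atlas c ->
    smooth_on (chart_im c) (local_rep Phi c) /\
    forall u v, chart_im c u -> 'D_v (local_rep Phi c) u = 0 -> v = 0.

Definition lagrangian_surface Phi : Prop :=
  immersion_into_HH Phi /\
  forall c, surf_atlas c -> forall u v w, chart_im c u ->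
    gE (J_HH (local_rep Phi c u) ('D_v (local_rep Phi c) u))
       ('D_w (local_rep Phi c) u) = 0.

(* Vector fields are taken on chart domains and read in coordinates. *)
Definition parallel_second_ff Phi : Prop :=
  forall c, surf_atlas c -> forall X Y Z : 'rV[R]_2 -> 'rV[R]_2,
    smooth_on (chart_im c) X -> smooth_on (chart_im c) Y ->
    smooth_on (chart_im c) Z ->
    forall u, chart_im c u -> nabla_second_ff (local_rep Phi c) X Y Z u = 0.

(* Equality of surfaces is equality of images. *)
Definition is_product_of_constant_curvature_curves Phi : Prop :=
  exists (I1 I2 : set R) (beta1 beta2 : R -> 'rV[R]_3),
    [/\ open_interval I1 /\ open_interval I2,
        arclength_curve I1 beta1 /\ arclength_curve I2 beta2,
        constant_curvature I1 beta1 /\ constant_curvature I2 beta2 &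
        open_part (range Phi) (product_of_curves I1 I2 beta1 beta2)].

Definition is_congruent_to_diagonal_part Phi : Prop :=
  exists2 f : E -> E,
    holomorphic_isometry f \/ antiholomorphic_isometry f &
    open_part (f @` range Phi) diagonal_surface.

End Surfaces.

(* Main.v *)
Require Import Defs.
From HB Require Import structures.
From mathcomp Require Import all_boot all_order all_algebra.
From mathcomp Require Import all_classical all_reals all_analysis.
From mathcomp Require Import ring lra.

Set Implicit Arguments.
Unset Strict Implicit.
Unset Printing Implicit Defensive.

Import Order.TTheory GRing.Theory Num.Theory.
Import numFieldNormedType.Exports.

Local Open Scope classical_set_scope.
Local Open Scope ring_scope.

(** The idea is to read the geometry of the surface off the two component maps
   [F = (F.1, F.2)] of its chart representatives, each of which takes values in
   a hyperbolic plane.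

   _Reduction to components._  The covariant derivative of the second
   fundamental form is tensorial, so parallelism says that its components
   [nabla_hff F k i j] vanish in every chart ([parallel_nabla_hff]).

   _Parallel surfaces, locally._  The Lagrangian condition says that the two
   components have the same oriented area [A] ([area_eq]).  The third
   derivatives of [F] commute, so the alternation of [nabla_hff] is the normal
   part of the curvature; parallelism makes it vanish, and tested against the
   normal fields [J F1] it reads [A * (g1 - g2) = 0], where [g1] and [g2] are
   the metrics pulled back by the two components ([lagrangian_codazzi]).  Where
   [A] is nonzero, [g1 = g2], and the two components differ by an orientation
   preserving isometry [B] of the hyperbolic plane, because their frames satisfy
   the same linear structure equations ([conformal_isometry]).  If [A] vanishes
   at a point, it vanishes nearby: the points with [A] nonzero satisfy [g1 = g2]
   and hence [det gram = 4 A^2], where [det gram] is bounded away from zero and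
   [A] is close to zero ([parallel_local]).  There the tangent planes split, each
   component traces a curve, and parallelism says that the curvature of this
   curve is constant, so that the curve lies in an affine plane
   ([product_local]).

   _Parallel surfaces, globally._  Each point of the surface thus has a
   neighbourhood mapped into the graph of some [B], or into a product of two
   plane sections.  An open piece determines which one ([model_unique]), and
   connectedness leaves a single one ([parallel_model]).  The graph of [B] is
   carried to the diagonal by the holomorphic isometry [(x, y) |-> (x B, y)]
   ([graph_is_diagonal]); a plane section is a complete curve of constant
   curvature ([plane_section_curve]), and the image is open in the product of
   the two curves ([sections_are_product]).  Openness needs only the surjectivity
   half of the inverse function theorem ([local_surjectivity]).

   _Converse._  A curve of constant curvature lies in an affine plane
   ([constant_curvature_plane]); its unit normal [n] in the hyperbolic plane
   satisfies [dn = - k dx] with [k] constant, and this says that the component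
   of [nabla_hff] along [n] vanishes ([sections_parallel]).  The diagonal is
   totally geodesic: in the image of an isometry, second derivatives tested
   against tangent vectors depend only on the metric
   ([isometry_second_derivative]), the second derivatives of a map into the
   diagonal are diagonal, and the normal vectors of the diagonal are
   antidiagonal ([diagonal_hff]). *)

(** * Directional derivatives *)

Section Directional.
Context {R : realType} {V : normedModType R}.

Lemma is_derive_linear (W W' : normedModType R) (L : {linear W -> W'})
    (f : V -> W) x v df : continuous L ->
  is_derive x v f df -> is_derive x v (fun u => L (f u)) (L df).
Proof.
move=> cL [dfx fE].
have H : (fun h : R => h^-1 *: (L (f (h *: v + x)) - L (f x))) @ 0^' --> L df.
  rewrite (_ : (fun h : R => _) =
    L \o (fun h : R => h^-1 *: (f (h *: v + x) - f x))); last first.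
    by apply/funext => h; rewrite [RHS]linearZ [in RHS]linearB.
  apply: continuous_cvg; first exact: cL.
  by rewrite -fE; exact: dfx.
by split; [apply/cvg_ex; exists (L df)|exact: cvg_lim H].
Qed.

Lemma is_derive_line (W : normedModType R) (f : V -> W) x v (t : R) df :
  is_derive (x + t *: v) v f df ->
  is_derive t 1 (fun s : R => f (x + s *: v)) df.
Proof.
move=> [dfx fE].
have E : (fun h : R => h^-1 *: (f (x + (h *: (1 : R) + t) *: v) - f (x + t *: v))) =
         (fun h : R => h^-1 *: (f (h *: v + (x + t *: v)) - f (x + t *: v))).
  apply/funext => h; congr (_ *: (f _ - _)).
  by rewrite [_%:A]mulr1 scalerDl addrCA.
by split; [rewrite /derivable /= E|rewrite /derive /= E].
Qed.

Lemma diff_is_derive (W : normedModType R) (f : V -> W) x v :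
  differentiable f x -> is_derive x v f ('D_v f x).
Proof. by move=> fx; apply: derivableP; exact: diff_derivable. Qed.

Lemma derive_linr (W : normedModType R) (f : V -> W) x : differentiable f x ->
  forall a v w, 'D_(a *: v + w) f x = a *: 'D_v f x + 'D_w f x.
Proof. by move=> fx a v w; rewrite !deriveE // linearP. Qed.

Lemma diff_remainder (W : normedModType R) (f : V -> W) x e :
  differentiable f x -> 0 < e ->
  \forall h \near (0 : V), `|f (x + h) - f x - 'D_h f x| <= e * `|h|.
Proof.
move=> fx e0.
have /eqaddoP/(_ _ e0) := @diff_locally _ _ _ x f fx.
apply: filterS => h /=.
by rewrite deriveE // !fctE /= [h + x]addrC /cst opprD addrA.
Qed.

(** Both iterated derivatives equal the limit of the second difference
   quotient of [f] along [v] and [w]: the mean value theorem turns the second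
   difference into a first difference of one derivative. *)
Lemma second_difference (f : V -> R) x v w e : 0 < e ->
  (\forall y \near x, differentiable f y) -> differentiable ('D_v f) x ->
  \forall t \near (0 : R)^'+,
  `|f (x + t *: v + t *: w) - f (x + t *: v) - f (x + t *: w) + f x
    - t ^+ 2 * 'D_w ('D_v f) x| <= e * t ^+ 2.
Proof.
move=> e0 /nbhs_ballP[r /= r0 fr] dvf.
pose c := 2 * `|v| + `|w| + 1.
have c0 : 0 < c by rewrite /c; have := normr_ge0 v; have := normr_ge0 w; lra.
have /nbhs_ballP[d /= d0 Hd] := diff_remainder dvf (divr_gt0 e0 c0).
(* For small [t], the parallelogram spanned by [t v] and [t w] lies in the ball
   of radius [m]. *)
have sm a b t m : 0 < m -> t < m / c -> 0 <= a <= t -> 0 <= b <= t ->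
    `|a *: v + b *: w| < m /\ `|a *: v + b *: w| <= a * `|v| + b * `|w|.
  move=> m0 tm /andP[a0 at_] /andP[b0 bt].
  have le : `|a *: v + b *: w| <= a * `|v| + b * `|w|.
    by rewrite (le_trans (ler_normD _ _))// !normrZ !ger0_norm.
  split=> //; apply: (le_lt_trans le).
  have : a * `|v| <= t * `|v| by rewrite ler_wpM2r.
  have : b * `|w| <= t * `|w| by rewrite ler_wpM2r.
  move: tm; rewrite ltr_pdivlMr// /c => tm.
  have t0 : 0 <= t by exact: le_trans at_.
  have := mulr_ge0 t0 (normr_ge0 v).
  move: tm; set V1 := `|v|; set W1 := `|w|; nra.
near=> t.
have t0 : 0 < t by [].
have tr : t < r / c by near: t; apply: nbhs_right_lt; exact: divr_gt0.
have td : t < d / c by near: t; apply: nbhs_right_lt; exact: divr_gt0.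
pose g s := f (x + t *: w + s *: v) - f (x + s *: v).
pose dg s := 'D_v f (x + t *: w + s *: v) - 'D_v f (x + s *: v).
have inb a b : 0 <= a <= t -> 0 <= b <= t -> ball x r (x + (a *: v + b *: w)).
  move=> a0 b0; rewrite -ball_normE /= opprD addrA subrr add0r normrN.
  by have [] := sm a b t r r0 tr a0 b0.
have dg' s : 0 <= s <= t -> is_derive s 1 g (dg s).
  move=> s0.
  have d1 : is_derive s 1 (fun s => f (x + t *: w + s *: v))
      ('D_v f (x + t *: w + s *: v)).
    apply: is_derive_line; apply: diff_is_derive; apply: fr.
    by rewrite -addrA [t *: w + _]addrC; apply: inb; rewrite // lexx ltW.
  have d2 : is_derive s 1 (fun s => f (x + s *: v)) ('D_v f (x + s *: v)).
    apply: is_derive_line; apply: diff_is_derive; apply: fr.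
    by have := inb s 0 s0; rewrite scale0r addr0 lexx ltW//; apply.
  exact: is_deriveB.
have gd s : s \in `]0, t[ -> is_derive s 1 g (dg s).
  by rewrite in_itv /= => /andP[s1 s2]; apply: dg'; rewrite !ltW.
have gc : {within `[0, t], continuous g}.
  apply: derivable_within_continuous => s; rewrite in_itv /= => sI.
  by have [] := dg' _ sI.
have [s] := MVT t0 gd gc.
rewrite in_itv /= => /andP[s1 s2].
have sI : 0 <= s <= t by rewrite !ltW.
have tI : 0 <= t <= t by rewrite lexx ltW.
have zI : 0 <= (0 : R) <= t by rewrite lexx ltW.
rewrite /g /dg scale0r !addr0 subr0 => E.
have L1 := sm s t t d d0 td sI tI; have L2 := sm s 0 t d d0 td sI zI.
have /Hd H1 : ball 0 d (s *: v + t *: w).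
  by rewrite -ball_normE /= sub0r normrN; case: L1.
have /Hd H2 : ball 0 d (s *: v + 0 *: w).
  by rewrite -ball_normE /= sub0r normrN; case: L2.
case: L1 => _ L1; case: L2 => _; rewrite scale0r addr0 mul0r addr0 => L2.
rewrite scale0r addr0 in H2.
have lin : 'D_(s *: v + t *: w) ('D_v f) x - 'D_(s *: v) ('D_v f) x =
   t * 'D_w ('D_v f) x.
  have := derive_linr dvf t w (s *: v); rewrite addrC => ->.
  by rewrite addrK.
have -> : f (x + t *: v + t *: w) - f (x + t *: v) - f (x + t *: w) + f x
    - t ^+ 2 * 'D_w ('D_v f) x =
  t * (('D_v f (x + (s *: v + t *: w)) - 'D_v f x - 'D_(s *: v + t *: w) ('D_v f) x)
     - ('D_v f (x + s *: v) - 'D_v f x - 'D_(s *: v) ('D_v f) x)).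
  rewrite [x + (s *: v + _)]addrA [x + s *: v + _]addrAC [x + t *: v + _]addrAC.
  set dd := 'D_w ('D_v f) x in lin *.
  have -> : 'D_(s *: v + t *: w) ('D_v f) x = t * dd + 'D_(s *: v) ('D_v f) x.
    by rewrite -lin subrK.
  have alg (p q r' z y1 y2 d1 a : R) : p - q - (r' - z) = (y1 - y2) * t ->
    p - q - r' + z - t ^+ 2 * dd = t * (y1 - d1 - (t * dd + a) - (y2 - d1 - a)).
    move=> E1; rewrite (_ : p - q - r' + z = p - q - (r' - z)); last by ring.
    by rewrite E1; ring.
  exact: alg E.
rewrite normrM gtr0_norm // expr2 mulrCA ler_pM2l //.
apply: (le_trans (ler_normB _ _)); apply: (le_trans (lerD H1 H2)).
rewrite -mulrDr -mulrA ler_pM2l // ler_pdivrMl //.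
have alg (X Y V1 W1 : R) : 0 <= V1 -> X <= s * V1 + t * W1 -> Y <= s * V1 ->
    X + Y <= (2 * V1 + W1 + 1) * t.
  clear -s2 t0 s1 => V10 XL YL.
  by have : s * V1 <= t * V1 by [rewrite ler_wpM2r // ltW]; lra.
exact: alg L1 L2.
Unshelve. all: by end_near. Qed.

(** Young's theorem: the second difference along [v] and [w] is symmetric in
   [v] and [w]. *)
Lemma derive_comm (f : V -> R) x v w :
  (\forall y \near x, differentiable f y) ->
  differentiable ('D_v f) x -> differentiable ('D_w f) x ->
  'D_w ('D_v f) x = 'D_v ('D_w f) x.
Proof.
move=> fx dv dw; apply/eqP; rewrite -subr_eq0 -normr_le0.
apply/ler_addgt0Pr => e e0; rewrite add0r.
have e2 : 0 < e / 2 by rewrite divr_gt0.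
have S1 := @second_difference f x v w _ e2 fx dv.
have S2 := @second_difference f x w v _ e2 fx dw.
have [t [t0 [H1 H2]]] := filter_ex (filterI (nbhs_right_gt (0 : R)) (filterI S1 S2)).
have t20 : 0 < t ^+ 2 by exact: exprn_gt0.
rewrite -(@ler_pM2l _ _ t20 `|_| e) -{1}(gtr0_norm t20).
rewrite -normrM.
have := lerD H1 H2; rewrite -mulrDl -splitr [e * _]mulrC; apply: le_trans.
rewrite [x + t *: w + _]addrAC.
have alg (p q r z y1 y2 a : R) : `|a * (y1 - y2)| <=
    `|p - q - r + z - a * y1| + `|p - r - q + z - a * y2|.
  rewrite -normrN; apply: le_trans (ler_normB _ _).
  by rewrite le_eqVlt; apply/orP; left; apply/eqP; congr `|_|; ring.
exact: alg.
Qed.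

End Directional.

Section Differentiable.
Context {R : realType} {V : normedModType R}.

Section Generic.
Context {W : normedModType R}.
Implicit Types f g : V -> W.

Lemma differentiable_add f g x : differentiable f x -> differentiable g x ->
  differentiable (fun u => f u + g u) x.
Proof. exact: differentiableD. Qed.

Lemma differentiable_sub f g x : differentiable f x -> differentiable g x ->
  differentiable (fun u => f u - g u) x.
Proof. exact: differentiableB. Qed.

Lemma differentiable_opp f x : differentiable f x ->
  differentiable (fun u => - f u) x.
Proof. exact: differentiableN. Qed.

Lemma differentiable_linear (W' : normedModType R) (L : {linear W -> W'}) f x :
  continuous L -> differentiable f x -> differentiable (fun u => L (f u)) x.
Proof.
by move=> cL df; apply: differentiable_comp => //; exact: linear_differentiable.
Qed.

Lemma differentiable_eq_near f g x : (\near x, f x = g x) ->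
  differentiable f x -> differentiable g x.
Proof.
move=> fg df; have fgx := nbhs_singleton fg.
have fg0 : \forall h \near (0 : V), f (h + x) = g (h + x).
  by move: fg; rewrite (near_shift 0 x) /= subr0.
have H : g \o shift x = cst (g x) + 'd f x +o_ 0 id.
  apply/eqaddoP => e e0; have /eqaddoP/(_ _ e0) := diff_locally df.
  move: fg0; apply: filterS2 => h /= E; rewrite !fctE /= /cst.
  by rewrite E fgx.
have cd := diff_continuous df; apply/diff_locallyP.
by rewrite (diff_unique cd H).
Qed.

End Generic.

Lemma scale_is_bilinear (W : normedModType R) :
  bilinear_for
    (GRing.Scale.Law.clone _ _ *:%R _) (GRing.Scale.Law.clone _ _ *:%R _)
    (@GRing.scale R W).
Proof.
split=> [u'|u] a x y /=; first by rewrite scalerDl scalerA.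
by rewrite scalerDr !scalerA mulrC.
Qed.

HB.instance Definition _ (W : normedModType R) :=
  bilinear_isBilinear.Build R R W W _ _ (@GRing.scale R W)
  (scale_is_bilinear W).

Section Scale.
Context {W : normedModType R} (k : V -> R) (f : V -> W) (x : V).
Hypotheses (dk : differentiable k x) (df : differentiable f x).

Lemma differentiable_scale : differentiable (fun u => k u *: f u) x.
Proof.
apply: (@differentiable_comp _ _ _ _ (fun u => (k u, f u))
  (fun p : R * W => p.1 *: p.2)); first exact: differentiable_pair.
apply: (@differentiable_bilin _ _ _ _ (@GRing.scale R W)).
exact: scale_continuous.
Qed.

Lemma derive_scale v :
  'D_v (fun u => k u *: f u) x = 'D_v k x *: f x + k x *: 'D_v f x.
Proof.
have dp := differentiable_pair dk df.
have sc : continuous (fun p : R * W => p.1 *: p.2) by exact: scale_continuous.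
rewrite deriveE; last exact: differentiable_scale.
rewrite (@diff_comp _ _ _ _ (fun u => (k u, f u)) (fun p : R * W => p.1 *: p.2)) //;
  last exact: (@differentiable_bilin _ _ _ _ (@GRing.scale R W)).
rewrite /= (@diff_bilin _ _ _ _ (@GRing.scale R W)) // diff_pair // !deriveE //=.
exact: addrC.
Qed.

End Scale.

Lemma differentiable_mul (f g : V -> R) x : differentiable f x ->
  differentiable g x -> differentiable (fun u => f u * g u) x.
Proof. exact: differentiableM. Qed.

Lemma differentiable_inv (f : V -> R) x : f x != 0 -> differentiable f x ->
  differentiable (fun u => (f u)^-1) x.
Proof. by move=> fx df; exact: differentiableV. Qed.

Lemma derive_mul (f g : V -> R) x v : differentiable f x ->
  differentiable g x ->
  'D_v (fun u => f u * g u) x = 'D_v f x * g x + f x * 'D_v g x.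
Proof. by move=> df dg; rewrite (derive_scale df dg). Qed.

Lemma derive_add (W : normedModType R) (f g : V -> W) x v :
  differentiable f x -> differentiable g x ->
  'D_v (fun u => f u + g u) x = 'D_v f x + 'D_v g x.
Proof. by move=> df dg; apply: deriveD; exact: diff_derivable. Qed.

Lemma derive_sub (W : normedModType R) (f g : V -> W) x v :
  differentiable f x -> differentiable g x ->
  'D_v (fun u => f u - g u) x = 'D_v f x - 'D_v g x.
Proof. by move=> df dg; apply: deriveB; exact: diff_derivable. Qed.

Lemma derive_opp (W : normedModType R) (f : V -> W) x v :
  differentiable f x -> 'D_v (fun u => - f u) x = - 'D_v f x.
Proof. by move=> df; apply: deriveN; exact: diff_derivable. Qed.

Lemma derive_linear (W W' : normedModType R) (L : {linear W -> W'})
    (f : V -> W) x v : continuous L -> differentiable f x ->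
  'D_v (fun u => L (f u)) x = L ('D_v f x).
Proof.
by move=> cL df; have [_] := is_derive_linear cL (diff_is_derive v df).
Qed.

Section Coordinates.
Context {n : nat}.

Lemma differentiable_row (f : V -> 'rV[R]_n) x :
  (forall i, differentiable (fun u => f u 0 i) x) -> differentiable f x.
Proof.
move=> df; rewrite (_ : f = fun u => \sum_(i < n) f u 0 i *: delta_mx 0 i).
  rewrite -fct_sumE; apply: differentiable_sum => i.
  apply: differentiable_scale; [exact: df|exact: differentiable_cst].
by apply/funext => u; exact: row_sum_delta.
Qed.

Lemma differentiable_entry (f : V -> 'rV[R]_n) x i : differentiable f x ->
  differentiable (fun u => f u 0 i) x.
Proof.
move=> df; apply: (@differentiable_comp _ _ _ _ f (fun M : 'rV[R]_n => M 0 i)) => //.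
exact: differentiable_coord.
Qed.

Lemma derive_entry (f : V -> 'rV[R]_n) x v i : differentiable f x ->
  ('D_v f x) 0 i = 'D_v (fun u => f u 0 i) x.
Proof.
by move=> df; rewrite derive_mx ?mxE //; exact: diff_derivable.
Qed.

End Coordinates.

Section Pairs.
Context {W1 W2 : normedModType R}.
Implicit Type f : V -> W1 * W2.

Lemma differentiable_fst f x : differentiable f x ->
  differentiable (fun u => (f u).1) x.
Proof. apply: (@differentiable_linear _ _ fst); by move=> p; exact: cvg_fst. Qed.

Lemma differentiable_snd f x : differentiable f x ->
  differentiable (fun u => (f u).2) x.
Proof. apply: (@differentiable_linear _ _ snd); by move=> p; exact: cvg_snd. Qed.

Lemma derive_fst f x v : differentiable f x ->
  'D_v (fun u => (f u).1) x = ('D_v f x).1.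
Proof. apply: (@derive_linear _ _ fst); by move=> p; exact: cvg_fst. Qed.

Lemma derive_snd f x v : differentiable f x ->
  'D_v (fun u => (f u).2) x = ('D_v f x).2.
Proof. apply: (@derive_linear _ _ snd); by move=> p; exact: cvg_snd. Qed.

Lemma derive_pair (f : V -> W1) (g : V -> W2) x v :
  differentiable f x -> differentiable g x ->
  'D_v (fun u => (f u, g u)) x = ('D_v f x, 'D_v g x).
Proof.
by move=> df dg; rewrite !deriveE ?diff_pair //; exact: differentiable_pair.
Qed.

End Pairs.

Lemma derive_comp (W W' : normedModType R) (f : V -> W) (g : W -> W') x v :
  differentiable f x -> differentiable g (f x) ->
  'D_v (fun u => g (f u)) x = 'D_('D_v f x) g (f x).
Proof.
move=> df dg; rewrite !deriveE // ?(diff_comp df dg) //.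
exact: differentiable_comp.
Qed.

Lemma differentiable_sqrt (f : V -> R) x : 0 < f x -> differentiable f x ->
  differentiable (fun u => Num.sqrt (f u)) x.
Proof.
move=> fx df; apply: (@differentiable_comp _ _ _ _ f Num.sqrt) => //.
apply/derivable1_diffP; by have [] := @is_derive1_sqrt _ _ fx.
Qed.

End Differentiable.

Section Smooth.
Context {R : realType} {V W : normedModType R}.
Implicit Types (f : V -> W) (U : set V).

Lemma smooth_differentiable U f x : smooth_on U f -> U x -> differentiable f x.
Proof. by move=> sf; case: (sf 1%N) => df _; exact: df. Qed.

Lemma smooth_derive U f v : smooth_on U f -> smooth_on U ('D_v f).
Proof. by move=> sf k; case: (sf k.+1) => _; apply. Qed.

Lemma smooth_cst U (c : W) : smooth_on U (fun _ => c).
Proof.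
move=> k; elim: k c => [|k IH] c /=; first by move=> x _; exact: cst_continuous.
split=> [x _|v]; first exact: differentiable_cst.
by rewrite (_ : 'D_v _ = fun _ => 0) //; apply/funext => x; exact: derive_cst.
Qed.

Lemma smooth_linear U (L : {linear V -> W}) : continuous L -> smooth_on U L.
Proof.
move=> cL [|k] /=; first by move=> x _; exact: cL.
split=> [x _|v]; first exact: linear_differentiable.
rewrite (_ : 'D_v _ = fun _ => L v); first exact: smooth_cst.
by apply/funext => x; rewrite deriveE ?diff_lin //; exact: linear_differentiable.
Qed.

End Smooth.

Section ZeroDerivative.
Context {R : realType} {V : normedModType R}.

Lemma derive0_ball_cst (f : V -> R) x r :
  (forall y, ball x r y -> differentiable f y) ->
  (forall y v, ball x r y -> 'D_v f y = 0) ->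
  forall y, ball x r y -> f y = f x.
Proof.
move=> df f0 y xy.
pose g t := f (x + t *: (y - x)).
have inb t : 0 <= t <= 1 -> ball x r (x + t *: (y - x)).
  move=> /andP[t0 t1]; move: xy; rewrite -!ball_normE /=.
  rewrite opprD addrA subrr add0r normrN normrZ ger0_norm // distrC.
  by apply: le_lt_trans; rewrite ler_piMl.
have dg (t : R) : 0 <= t <= 1 -> is_derive t 1 g 0.
  move=> /inb tI; rewrite -(f0 _ (y - x) tI); apply: is_derive_line.
  by apply: diff_is_derive; exact: df.
have gd (t : R) : t \in `]0, 1[ -> is_derive t 1 g 0.
  by rewrite in_itv /= => /andP[? ?]; apply: dg; rewrite !ltW.
have gc : {within `[0, 1], continuous g}.
  apply: derivable_within_continuous => t; rewrite in_itv /= => tI.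
  by have [] := dg _ tI.
have [t _] := @MVT _ g (fun=> 0) 0 1 ltr01 gd gc.
rewrite mul0r /g scale1r scale0r addr0 [x + _]addrC subrK => /eqP.
by rewrite subr_eq0 => /eqP.
Qed.

End ZeroDerivative.

(** * Maps of the plane *)

Section Plane.
Context {R : realType}.
Local Notation plane := 'rV[R]_2.

Lemma ord2P (i : 'I_2) : i = 0 \/ i = 1.
Proof. by case: i => [[|[|//]] H]; [left|right]; exact: val_inj. Qed.

Lemma sum_ord2 (W : nmodType) (f : 'I_2 -> W) : \sum_(i < 2) f i = f 0 + f 1.
Proof.
rewrite big_ord_recl big_ord1; congr (_ + f _); exact: val_inj.
Qed.

Lemma plane_coord (v : plane) :
  v = v 0 0 *: coord_vec 0 + v 0 1 *: coord_vec 1.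
Proof.
by apply/rowP => i; rewrite !mxE; case: (ord2P i) => -> /=; rewrite ?mulr1 ?mulr0
  ?addr0 ?add0r.
Qed.

Lemma derive_plane (W : normedModType R) (F : plane -> W) u v :
  differentiable F u ->
  'D_v F u = v 0 0 *: 'D_(coord_vec 0) F u + v 0 1 *: 'D_(coord_vec 1) F u.
Proof.
move=> dF; rewrite {1}(plane_coord v) derive_linr //; congr (_ + _).
by rewrite -[_ *: coord_vec 1]addr0 derive_linr // derive0 addr0.
Qed.

(** If the determinant vanishes, one of the vectors read off from the adjugate
   matrix is a nonzero element of the kernel, unless the map is zero. *)
Lemma plane_kernel_det (a b : plane -> R) :
  (forall v, a v = v 0 0 * a (coord_vec 0) + v 0 1 * a (coord_vec 1)) ->
  (forall v, b v = v 0 0 * b (coord_vec 0) + v 0 1 * b (coord_vec 1)) ->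
  (forall v, a v = 0 -> b v = 0 -> v = 0) ->
  a (coord_vec 0) * b (coord_vec 1) - a (coord_vec 1) * b (coord_vec 0) != 0.
Proof.
move=> aE bE inj; apply/eqP => D0.
set e0 := coord_vec 0 in aE bE D0; set e1 := coord_vec 1 in aE bE D0.
have vE (p q : R) : (p *: e0 + q *: e1) 0 0 = p /\ (p *: e0 + q *: e1) 0 1 = q.
  by rewrite !mxE /= ?mulr1 ?mulr0 ?addr0 ?add0r.
have za : a e1 = 0 /\ a e0 = 0.
  have := inj (a e1 *: e0 + - a e0 *: e1).
  rewrite [a (_ + _)]aE [b (_ + _)]bE; have [-> ->] := vE (a e1) (- a e0) => H.
  have /H{}H : a e1 * a e0 + - a e0 * a e1 = 0 by ring.
  have /H{}H : a e1 * b e0 + - a e0 * b e1 = 0 by move: D0; set x := a e1 * b e0; lra.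
  have [] := vE (a e1) (- a e0); rewrite H !mxE => <- /esym/eqP.
  by rewrite oppr_eq0 => /eqP.
have zb : b e1 = 0 /\ b e0 = 0.
  have := inj (b e1 *: e0 + - b e0 *: e1).
  rewrite [a (_ + _)]aE [b (_ + _)]bE; have [-> ->] := vE (b e1) (- b e0) => H.
  have /H{}H : b e1 * a e0 + - b e0 * a e1 = 0 by case: za => -> ->; ring.
  have /H{}H : b e1 * b e0 + - b e0 * b e1 = 0 by ring.
  have [] := vE (b e1) (- b e0); rewrite H !mxE => <- /esym/eqP.
  by rewrite oppr_eq0 => /eqP.
have := inj e0; rewrite (proj2 za) (proj2 zb) => /(_ erefl erefl) /rowP/(_ 0).
by rewrite !mxE /= => /eqP; rewrite oner_eq0.
Qed.

Lemma plane_solve (a b : plane -> R) (p q : R) :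
  (forall v, a v = v 0 0 * a (coord_vec 0) + v 0 1 * a (coord_vec 1)) ->
  (forall v, b v = v 0 0 * b (coord_vec 0) + v 0 1 * b (coord_vec 1)) ->
  a (coord_vec 0) * b (coord_vec 1) - a (coord_vec 1) * b (coord_vec 0) != 0 ->
  exists v, a v = p /\ b v = q.
Proof.
move=> aE bE D0.
set e0 := coord_vec 0 in aE bE D0; set e1 := coord_vec 1 in aE bE D0.
set D := _ - _ in D0.
pose v := ((b e1 * p - a e1 * q) / D) *: e0 + ((a e0 * q - b e0 * p) / D) *: e1.
have v0 : v 0 0 = (b e1 * p - a e1 * q) / D by rewrite !mxE /= mulr1 mulr0 addr0.
have v1 : v 0 1 = (a e0 * q - b e0 * p) / D by rewrite !mxE /= mulr1 mulr0 add0r.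
exists v; rewrite (aE v) (bE v) v0 v1.
by move: D0; rewrite /D => D0; split; field.
Qed.

Lemma norm_plane (v : plane) : `|v| = Num.max `|v 0 0| `|v 0 1|.
Proof.
rewrite [LHS]/Num.Def.normr /= mx_normrE.
apply/eqP; rewrite eq_le; apply/andP; split.
  apply: bigmax_le => [|[i j] _]; first by rewrite le_max normr_ge0.
  by rewrite le_max /= (ord1 i); case: (ord2P j) => ->; rewrite lexx ?orbT.
by rewrite ge_max; apply/andP; split;
  [exact: (le_bigmax _ _ (0, 0))|exact: (le_bigmax _ _ (0, 1))].
Qed.

Lemma plane_det_lower_bound (a0 a1 b0 b1 : R) : a0 * b1 - a1 * b0 != 0 ->
  exists2 c, 0 < c & forall h : plane, c * `|h| <=
    `|h 0 0 * a0 + h 0 1 * a1| + `|h 0 0 * b0 + h 0 1 * b1|.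
Proof.
move=> D0.
pose m := `|a0| + `|a1| + `|b0| + `|b1|.
have na0 := normr_ge0 a0; have na1 := normr_ge0 a1.
have nb0 := normr_ge0 b0; have nb1 := normr_ge0 b1.
have m0 : 0 < m.
  rewrite lt_def !addr_ge0 // andbT; apply: contra D0 => /eqP m0.
  have /normr0_eq0 -> : `|a0| = 0 by move: m0; rewrite /m; lra.
  have /normr0_eq0 -> : `|a1| = 0 by move: m0; rewrite /m; lra.
  by rewrite !mul0r subrr.
exists (`|a0 * b1 - a1 * b0| / m); first by rewrite divr_gt0 ?normr_gt0.
move=> h; rewrite mulrAC ler_pdivrMr //.
set p := _ * a0 + _; set q := _ * b0 + _.
have b (x y : R) : `|x * p + y * q| <= `|x| * `|p| + `|y| * `|q|.
  by rewrite -!normrM ler_normD.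
have step (x y : R) : `|x| <= m -> `|y| <= m ->
    `|x * p + y * q| <= (`|p| + `|q|) * m.
  move=> xm ym; apply: (le_trans (b x y)); rewrite mulrDl.
  by rewrite lerD // mulrC ler_wpM2l.
have [->|->] : `|h| = `|h 0 0| \/ `|h| = `|h 0 1|.
- rewrite norm_plane; case: (leP `|h 0 0| `|h 0 1|) => H; first by right.
  by left.
- rewrite -normrM (_ : _ * h 0 0 = b1 * p + - a1 * q); last first.
    by rewrite /p /q; ring.
  by apply: step; rewrite ?normrN /m; clear -na0 na1 nb0 nb1; lra.
- rewrite -normrM (_ : _ * h 0 1 = - b0 * p + a0 * q); last first.
    by rewrite /p /q; ring.
  by apply: step; rewrite ?normrN /m; clear -na0 na1 nb0 nb1; lra.
Qed.

Lemma sum_sqr_le_sum_norm (e a b p q : R) : 0 < e -> `|p| < e -> `|q| < e ->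
  a ^+ 2 + b ^+ 2 <= p ^+ 2 + q ^+ 2 -> `|a - p| + `|b - q| < 8 * e.
Proof.
move=> e0; rewrite !ltr_norml => /andP[p1 p2] /andP[q1 q2] le.
have pe : p ^+ 2 <= e ^+ 2 by nra.
have qe : q ^+ 2 <= e ^+ 2 by nra.
have se : 0 < e ^+ 2 by exact: exprn_gt0.
have e22 : (2 * e) ^+ 2 = 4 * e ^+ 2 by ring.
have sm : a ^+ 2 + b ^+ 2 < (2 * e) ^+ 2 by rewrite e22; lra.
have [a1 a2] : - (2 * e) < a /\ a < 2 * e by split; nra.
have [b1 b2] : - (2 * e) < b /\ b < 2 * e by split; nra.
have : `|a - p| < 3 * e by rewrite ltr_norml; apply/andP; split; lra.
have : `|b - q| < 3 * e by rewrite ltr_norml; apply/andP; split; lra.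
lra.
Qed.

(** Local surjectivity half of the inverse function theorem in the plane: on a
   small closed ball, the squared distance from [(g1, g2)] to the target has a
   minimum, attained in the interior because [(g1, g2)] separates the centre
   from the sphere; there the gradient vanishes, so the distance is zero. *)
Lemma local_surjectivity (g1 g2 : plane -> R) u0 (N : set plane) :
  nbhs u0 N ->
  (forall u, N u -> differentiable g1 u /\ differentiable g2 u) ->
  (forall u v, N u -> 'D_v g1 u = 0 -> 'D_v g2 u = 0 -> v = 0) ->
  exists2 e, 0 < e & forall y1 y2, `|y1 - g1 u0| < e -> `|y2 - g2 u0| < e ->
    exists2 u, N u & g1 u = y1 /\ g2 u = y2.
Proof.
move=> nN dN iN.
have Nu0 := nbhs_singleton nN.
have lin u : N u -> forall v, 'D_v g1 u = v 0 0 * 'D_(coord_vec 0) g1 u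
    + v 0 1 * 'D_(coord_vec 1) g1 u /\ 'D_v g2 u = v 0 0 * 'D_(coord_vec 0) g2 u
    + v 0 1 * 'D_(coord_vec 1) g2 u.
  by move=> Nu v; have [d1 d2] := dN u Nu; rewrite -!derive_plane.
have det u : N u -> 'D_(coord_vec 0) g1 u * 'D_(coord_vec 1) g2 u
    - 'D_(coord_vec 1) g1 u * 'D_(coord_vec 0) g2 u != 0.
  move=> Nu.
  apply: (@plane_kernel_det (fun v => 'D_v g1 u) (fun v => 'D_v g2 u)).
  - by move=> v; case: (lin u Nu v).
  - by move=> v; case: (lin u Nu v).
  - by move=> v; exact: iN.
have [d1 d2] := dN _ Nu0.
(* [g] stays within [c / 2] of its differential, which expands by at least [c]. *)
have [c c0 lowc] : exists2 c, 0 < c &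
    forall h, c * `|h| <= `|'D_h g1 u0| + `|'D_h g2 u0|.
  have [c c0 H] := plane_det_lower_bound (det _ Nu0).
  by exists c => // h; have [-> ->] := lin _ Nu0 h; exact: H.
have c4 : 0 < c / 4 by rewrite divr_gt0.
have [r2 /= r20 Hr2] : nbhs_ball (0 : plane) [set h |
    `|g1 (u0 + h) - g1 u0 - 'D_h g1 u0| <= c / 4 * `|h| /\
    `|g2 (u0 + h) - g2 u0 - 'D_h g2 u0| <= c / 4 * `|h|].
  apply/nbhs_ballP; apply: filterI; first exact: diff_remainder d1 c4.
  exact: diff_remainder d2 c4.
have /nbhs_ballP[r1 /= r10 Hr1] := nN.
pose r := Num.min r1 r2 / 2.
have r0 : 0 < r by rewrite divr_gt0 // lt_min r10 r20.
have rr1 : r < r1.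
  by rewrite /r; have : Num.min r1 r2 <= r1 by [rewrite ge_min lexx]; lra.
have rr2 : r < r2.
  by rewrite /r; have : Num.min r1 r2 <= r2 by [rewrite ge_min lexx orbT]; lra.
have inN h : `|h| <= r -> N (u0 + h).
  move=> hr; apply: Hr1; rewrite -ball_normE /= opprD addrA subrr add0r normrN.
  exact: le_lt_trans rr1.
have sphere h : `|h| = r ->
    c / 2 * r <= `|g1 (u0 + h) - g1 u0| + `|g2 (u0 + h) - g2 u0|.
  move=> hr; have [|H1 H2] := Hr2 h.
    by rewrite -ball_normE /= sub0r normrN hr.
  have := lowc h; rewrite hr in H1 H2 *.
  have t (x y z : R) : `|x - y| <= z -> `|y| <= `|x| + z.
    move=> H; have := ler_normD x (y - x); rewrite [x + _]addrC subrK => /le_trans.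
    by apply; rewrite lerD2l distrC.
  move: (t _ _ _ H1) (t _ _ _ H2).
  set x1 := `|_|; set x2 := `|_|; set x3 := `|_|; set x4 := `|_|.
  by clear; lra.
pose K : set plane := [set u | `|u - u0| <= r].
have KN u : K u -> N u by move=> /inN; rewrite addrC subrK.
have cK : compact K.
  apply: bounded_closed_compact.
    exists (r + `|u0|); split; first exact: num_real.
    move=> M rM u uK; apply: le_trans (ltW rM).
    by rewrite -[u](subrK u0) (le_trans (ler_normD _ _)) // lerD2r.
  rewrite (_ : K = closed_ball u0 r); first exact: closed_ball_closed.
  by rewrite closed_ballE //; apply/seteqP; split=> u; rewrite /K /= distrC.
have e0 : 0 < c * r / 16 by rewrite divr_gt0 // mulr_gt0.
exists (c * r / 16) => // y1 y2 Hy1 Hy2.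
pose f u := (g1 u - y1) ^+ 2 + (g2 u - y2) ^+ 2.
have df u v : N u -> is_derive u v f
    (2 * ((g1 u - y1) * 'D_v g1 u + (g2 u - y2) * 'D_v g2 u)).
  move=> Nu; have [du1 du2] := dN u Nu.
  have i1 := diff_is_derive v du1; have i2 := diff_is_derive v du2.
  have j1 : is_derive u v (fun u => g1 u - y1) ('D_v g1 u).
    by rewrite -[X in is_derive _ _ _ X]subr0; apply: is_deriveB.
  have j2 : is_derive u v (fun u => g2 u - y2) ('D_v g2 u).
    by rewrite -[X in is_derive _ _ _ X]subr0; apply: is_deriveB.
  have k1 := is_deriveM j1 j1; have k2 := is_deriveM j2 j2.
  have := is_deriveD k1 k2.
  rewrite (_ : _ + _ = f); last by apply/funext => z; rewrite /f !expr2.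
  by move=> H; apply: is_derive_eq H _; rewrite /GRing.scale /=; ring.
have dfu u : N u -> differentiable f u.
  move=> Nu; have [du1 du2] := dN u Nu.
  have d (g : plane -> R) (y : R) : differentiable g u ->
      differentiable (fun z => (g z - y) ^+ 2) u.
    move=> dg; have dgy : differentiable (fun z => g z - y) u.
      by apply: differentiable_sub => //; exact: differentiable_cst.
    exact: (differentiable_mul dgy dgy).
  by apply: differentiable_add; exact: d.
have Ku0 : K u0 by rewrite /K /= subrr normr0 ltW.
have [c1 c1K minc] : exists2 c, c \in K & forall t, t \in K -> f c <= f t.
  apply: EVT_min_rV; [by exists u0|exact: cK|].
  apply: continuous_in_subspaceT => z; rewrite inE => /KN/dfu.
  exact: differentiable_continuous.
have {}c1K : K c1 by rewrite inE in c1K.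
have c1int : `|c1 - u0| < r.
  rewrite lt_neqAle; apply/andP; split=> //; apply/eqP => /sphere.
  rewrite [u0 + _]addrC subrK => sph.
  have : f c1 <= f u0 by apply: minc; rewrite inE.
  move: sph Hy1 Hy2 e0; rewrite /f ![`|y1 - _|]distrC ![`|y2 - _|]distrC.
  move=> sph p q e0 le.
  have := sum_sqr_le_sum_norm e0 p q le.
  rewrite !opprB ![_ + (y1 - _)]addrA ![_ + (y2 - _)]addrA !subrK.
  by apply/negP; rewrite -leNgt (le_trans _ sph) //; lra.
have D0 v : 'D_v f c1 = 0.
  pose g t := f (c1 + t *: v).
  pose d := (r - `|c1 - u0|) / (`|v| + 1).
  have v1 : 0 < `|v| + 1 by rewrite ltr_wpDl.
  have d0 : 0 < d by rewrite divr_gt0 // subr_gt0.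
  have inK t : t \in `]- d, d[ -> K (c1 + t *: v).
    rewrite in_itv /= -ltr_norml => td; rewrite /K /= addrAC.
    apply: (le_trans (ler_normD _ _)); rewrite normrZ -lerBrDl.
    rewrite -[leRHS](@divfK _ (`|v| + 1)) ?gt_eqF // -/d.
    by apply: ler_pM => //; [exact: ltW|rewrite lerDl].
  have g0 : is_derive (0 : R) 1 g 0.
    apply: (@derive1_at_min _ _ (- d) d).
    - by rewrite ge0_cp // ltW.
    - move=> t /inK/KN Nt.
      by have [] := is_derive_line (df _ v Nt).
    - by rewrite in_itv /= oppr_lt0 d0.
    - by move=> t /inK Kt; rewrite /g scale0r addr0; apply: minc; rewrite inE.
  have : is_derive (0 : R) 1 g ('D_v f c1).
    apply: is_derive_line; rewrite scale0r addr0.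
    exact: diff_is_derive (dfu _ (KN _ c1K)).
  by move=> [_ <-]; case: g0.
exists c1; first exact: KN.
have Nc1 := KN _ c1K.
have [v [v1 v2]] := @plane_solve (fun v => 'D_v g1 c1) (fun v => 'D_v g2 c1)
  (g1 c1 - y1) (g2 c1 - y2) (fun v => proj1 (lin _ Nc1 v))
  (fun v => proj2 (lin _ Nc1 v)) (det _ Nc1).
have := D0 v; have [_ ->] := df c1 v Nc1; rewrite v1 v2 => /eqP.
rewrite mulf_eq0 pnatr_eq0 /= -!expr2 paddr_eq0 ?sqr_ge0 // !sqrf_eq0 !subr_eq0.
by move=> /andP[/eqP -> /eqP ->].
Qed.

End Plane.

(** * Lorentzian algebra *)

Section Lorentz.
Context {R : realType}.
Local Notation R31 := 'rV[R]_3.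
Local Notation E := (R31 * R31)%type.
Implicit Types (a b c d v w x y : R31) (k : R).

Lemma row3P a b : a 0 0 = b 0 0 -> a 0 1 = b 0 1 -> a 0 2 = b 0 2 -> a = b.
Proof.
move=> h0 h1 h2; apply/rowP => -[[|[|[|//]]] H].
- by rewrite (_ : Ordinal H = 0) //; exact: val_inj.
- by rewrite (_ : Ordinal H = 1) //; exact: val_inj.
- by rewrite (_ : Ordinal H = 2) //; exact: val_inj.
Qed.

Lemma lorentzC a b : lorentz a b = lorentz b a.
Proof. by rewrite /lorentz; ring. Qed.

Lemma lorentzDl a b c : lorentz (a + b) c = lorentz a c + lorentz b c.
Proof. by rewrite /lorentz !mxE; ring. Qed.

Lemma lorentzDr a b c : lorentz c (a + b) = lorentz c a + lorentz c b.
Proof. by rewrite /lorentz !mxE; ring. Qed.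

Lemma lorentzZl k a b : lorentz (k *: a) b = k * lorentz a b.
Proof. by rewrite /lorentz !mxE; ring. Qed.

Lemma lorentzZr k a b : lorentz a (k *: b) = k * lorentz a b.
Proof. by rewrite /lorentz !mxE; ring. Qed.

Lemma lorentzNl a b : lorentz (- a) b = - lorentz a b.
Proof. by rewrite /lorentz !mxE; ring. Qed.

Lemma lorentzNr a b : lorentz a (- b) = - lorentz a b.
Proof. by rewrite /lorentz !mxE; ring. Qed.

Lemma lorentz0l a : lorentz 0 a = 0.
Proof. by rewrite /lorentz !mxE; ring. Qed.

Lemma lorentz0r a : lorentz a 0 = 0.
Proof. by rewrite /lorentz !mxE; ring. Qed.

Definition lorentzE := (lorentzDl, lorentzDr, lorentzNl, lorentzNr,
  lorentzZl, lorentzZr, lorentz0l, lorentz0r).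

Lemma lcross0 a b : (lcross a b) 0 0 = a 0 2 * b 0 1 - a 0 1 * b 0 2.
Proof. by rewrite mxE. Qed.
Lemma lcross1 a b : (lcross a b) 0 1 = a 0 2 * b 0 0 - a 0 0 * b 0 2.
Proof. by rewrite mxE. Qed.
Lemma lcross2 a b : (lcross a b) 0 2 = a 0 0 * b 0 1 - a 0 1 * b 0 0.
Proof. by rewrite mxE. Qed.
Definition lcrossE := (lcross0, lcross1, lcross2).

Lemma lcrossDr a b c : lcross c (a + b) = lcross c a + lcross c b.
Proof. by apply: row3P; rewrite [RHS]mxE !lcrossE !mxE; ring. Qed.

Lemma lcrossZr k a b : lcross a (k *: b) = k *: lcross a b.
Proof. by apply: row3P; rewrite [RHS]mxE !lcrossE !mxE; ring. Qed.

Lemma lcross_lcross a b c :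
  lcross a (lcross b c) = lorentz a b *: c - lorentz a c *: b.
Proof.
by apply: row3P; rewrite [RHS]mxE /lorentz !lcrossE !mxE /=; ring.
Qed.

Lemma lorentz_lcross a b c d : lorentz (lcross a b) (lcross c d) =
  lorentz a d * lorentz b c - lorentz a c * lorentz b d.
Proof. by rewrite /lorentz !lcrossE; ring. Qed.

Lemma lcross_orthl a b : lorentz (lcross a b) a = 0.
Proof. by rewrite /lorentz !lcrossE; ring. Qed.

Lemma lcross_orthr a b : lorentz (lcross a b) b = 0.
Proof. by rewrite /lorentz !lcrossE; ring. Qed.

(** The triple product, which is the determinant up to sign. *)
Definition det3 a b c : R := lorentz (lcross a b) c.

Lemma det3_swap a b c : det3 a c b = - det3 a b c.
Proof. by rewrite /det3 /lorentz !lcrossE; ring. Qed.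

Lemma det3_sqr a b c : det3 a b c ^+ 2 = - (
  lorentz a a * (lorentz b b * lorentz c c - lorentz b c ^+ 2)
  - lorentz a b * (lorentz a b * lorentz c c - lorentz b c * lorentz a c)
  + lorentz a c * (lorentz a b * lorentz b c - lorentz b b * lorentz a c)).
Proof. by rewrite /det3 /lorentz !lcrossE; ring. Qed.

(** By Cramer's rule, [det3 a b c *: w] is a combination of the three products. *)
Lemma lorentz_nondegenerate a b c w : det3 a b c != 0 ->
  lorentz w a = 0 -> lorentz w b = 0 -> lorentz w c = 0 -> w = 0.
Proof.
move=> D0 wa wb wc.
have e (z : R) : det3 a b c * z = 0 -> z = 0.
  by move=> /eqP; rewrite mulf_eq0 (negbTE D0) => /eqP.
apply: row3P; rewrite mxE; apply: e.
- transitivity (lorentz w a * (a 0 0 * 0 - (b 0 1 * c 0 2 - b 0 2 * c 0 1))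
     - lorentz w b * (c 0 1 * a 0 2 - c 0 2 * a 0 1)
     - lorentz w c * (a 0 1 * b 0 2 - a 0 2 * b 0 1)).
    by rewrite /det3 /lorentz !lcrossE; ring.
  by rewrite wa wb wc; ring.
- transitivity (- lorentz w a * (b 0 0 * c 0 2 - b 0 2 * c 0 0)
     - lorentz w b * (c 0 0 * a 0 2 - c 0 2 * a 0 0)
     - lorentz w c * (a 0 0 * b 0 2 - a 0 2 * b 0 0)).
    by rewrite /det3 /lorentz !lcrossE; ring.
  by rewrite wa wb wc; ring.
- transitivity (lorentz w a * (b 0 0 * c 0 1 - b 0 1 * c 0 0)
     + lorentz w b * (c 0 0 * a 0 1 - c 0 1 * a 0 0)
     + lorentz w c * (a 0 0 * b 0 1 - a 0 1 * b 0 0)).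
    by rewrite /det3 /lorentz !lcrossE; ring.
  by rewrite wa wb wc; ring.
Qed.

Lemma hypm1P x : hyp (-1) x -> lorentz x x = -1 /\ 0 < x 0 0.
Proof. by move=> [xx x0]; split=> //; rewrite xx invrN invr1. Qed.

Lemma J_hypE x v : J_hyp (-1) x v = lcross x v.
Proof. by rewrite /J_hyp opprK sqrtr1 scale1r. Qed.

(** The tangent planes of the hyperboloid are spacelike. *)
Lemma tangent_sqr x v : hyp (-1) x -> lorentz v x = 0 -> x 0 0 ^+ 2 * lorentz v v =
  v 0 1 ^+ 2 + v 0 2 ^+ 2 + (x 0 1 * v 0 2 - x 0 2 * v 0 1) ^+ 2.
Proof.
move=> /hypm1P[xx x0]; move: xx; rewrite /lorentz => xx vx.
transitivity ((x 0 0 * x 0 0) * (v 0 1 ^+ 2 + v 0 2 ^+ 2) - (v 0 0 * x 0 0) ^+ 2).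
  by ring.
have -> : x 0 0 * x 0 0 = 1 + x 0 1 * x 0 1 + x 0 2 * x 0 2 by lra.
have -> : v 0 0 * x 0 0 = v 0 1 * x 0 1 + v 0 2 * x 0 2 by lra.
by ring.
Qed.

Lemma tangent_ge0 x v : hyp (-1) x -> lorentz v x = 0 -> 0 <= lorentz v v.
Proof.
move=> xH vx; have [_ x0] := hypm1P xH.
rewrite -(pmulr_rge0 _ (exprn_gt0 2 x0)) (tangent_sqr xH vx).
by rewrite !addr_ge0 // sqr_ge0.
Qed.

Lemma tangent_eq0 x v : hyp (-1) x -> lorentz v x = 0 -> lorentz v v = 0 -> v = 0.
Proof.
move=> xH vx vv; have [_ x0] := hypm1P xH.
have := tangent_sqr xH vx; rewrite vv mulr0 => E.
have := sqr_ge0 (v 0 1); have := sqr_ge0 (v 0 2).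
have := sqr_ge0 (x 0 1 * v 0 2 - x 0 2 * v 0 1) => h1 h2 h3.
have /eqP : v 0 1 ^+ 2 = 0 by lra.
have /eqP : v 0 2 ^+ 2 = 0 by lra.
rewrite !sqrf_eq0 => /eqP v2 /eqP v1.
apply: row3P; rewrite mxE //.
move: vx; rewrite /lorentz v1 v2 !mul0r !addr0 => /eqP.
by rewrite oppr_eq0 mulf_eq0 (gt_eqF x0) orbF => /eqP.
Qed.

(** The Cauchy-Schwarz inequality for the vectors [(1, x1, x2)]. *)
Lemma hyp_lorentz_le x y : hyp (-1) x -> hyp (-1) y -> lorentz x y <= -1.
Proof.
move=> /hypm1P[xx x0] /hypm1P[yy y0].
move: xx yy; rewrite /lorentz => xx yy.
have p0 : 0 < x 0 0 * y 0 0 by rewrite mulr_gt0.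
suff : 1 + x 0 1 * y 0 1 + x 0 2 * y 0 2 <= x 0 0 * y 0 0 by lra.
apply: le_trans (ler_norm _) _.
rewrite -(@ler_pXn2r _ 2) ?nnegrE // ?(ltW p0) // real_normK ?num_real //.
have -> : (x 0 0 * y 0 0) ^+ 2 =
    (1 + x 0 1 * x 0 1 + x 0 2 * x 0 2) * (1 + y 0 1 * y 0 1 + y 0 2 * y 0 2).
  have <- : x 0 0 * x 0 0 = 1 + x 0 1 * x 0 1 + x 0 2 * x 0 2 by lra.
  have <- : y 0 0 * y 0 0 = 1 + y 0 1 * y 0 1 + y 0 2 * y 0 2 by lra.
  by ring.
rewrite -subr_ge0.
have -> : (1 + x 0 1 * x 0 1 + x 0 2 * x 0 2) * (1 + y 0 1 * y 0 1 + y 0 2 * y 0 2)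
   - (1 + x 0 1 * y 0 1 + x 0 2 * y 0 2) ^+ 2 =
   (x 0 1 - y 0 1) ^+ 2 + (x 0 2 - y 0 2) ^+ 2 +
   (x 0 1 * y 0 2 - x 0 2 * y 0 1) ^+ 2 by ring.
by rewrite !addr_ge0 // sqr_ge0.
Qed.

Lemma det3_tangent x v w : hyp (-1) x -> lorentz v x = 0 -> lorentz w x = 0 ->
  det3 x v w ^+ 2 = lorentz v v * lorentz w w - lorentz v w ^+ 2.
Proof.
move=> /hypm1P[xx x0] vx wx.
by rewrite det3_sqr xx ![lorentz x _]lorentzC vx wx; ring.
Qed.

(** The sign comes from [lorentz x x = -1]. *)
Lemma frame_decomposition x t n w : hyp (-1) x ->
  lorentz t x = 0 -> lorentz n x = 0 -> lorentz t n = 0 ->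
  lorentz t t = 1 -> lorentz n n = 1 ->
  w = - lorentz w x *: x + lorentz w t *: t + lorentz w n *: n.
Proof.
move=> xH tx nx tn tt nn; have [xx x0] := hypm1P xH.
have nt : lorentz n t = 0 by rewrite lorentzC.
have D : det3 x t n != 0.
  have := det3_tangent xH tx nx; rewrite tt nn tn => D; apply/eqP => D0.
  by move: D; rewrite D0; lra.
apply/eqP; rewrite -subr_eq0; apply/eqP.
apply: (lorentz_nondegenerate D); rewrite !lorentzE ?xx ?tx ?nx ?tt ?nn ?tn ?nt.
- by ring.
- by rewrite [lorentz x t]lorentzC tx; ring.
- by rewrite [lorentz x n]lorentzC nx; ring.
Qed.

End Lorentz.

Section ProductMetric.
Context {R : realType}.
Local Notation R31 := 'rV[R]_3.
Local Notation E := (R31 * R31)%type.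
Implicit Types (p q r x v w : E) (k : R).

Lemma gEC p q : gE p q = gE q p.
Proof. by rewrite /gE !(lorentzC p.1) !(lorentzC p.2). Qed.

Lemma gEDl p q r : gE (p + q) r = gE p r + gE q r.
Proof. by rewrite /gE !lorentzE; ring. Qed.

Lemma gEDr p q r : gE r (p + q) = gE r p + gE r q.
Proof. by rewrite /gE !lorentzE; ring. Qed.

Lemma gEZl k p q : gE (k *: p) q = k * gE p q.
Proof. by rewrite /gE !lorentzE; ring. Qed.

Lemma gEZr k p q : gE p (k *: q) = k * gE p q.
Proof. by rewrite /gE !lorentzE; ring. Qed.

Lemma gENl p q : gE (- p) q = - gE p q.
Proof. by rewrite /gE !lorentzE; ring. Qed.

Lemma gENr p q : gE p (- q) = - gE p q.
Proof. by rewrite /gE !lorentzE; ring. Qed.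

Lemma gE0l p : gE 0 p = 0.
Proof. by rewrite /gE !lorentz0l addr0. Qed.

Lemma gE0r p : gE p 0 = 0.
Proof. by rewrite /gE !lorentz0r addr0. Qed.

Definition gEE := (gEDl, gEDr, gENl, gENr, gEZl, gEZr, gE0l, gE0r).

Lemma gE_eq0 x v : HH x -> HH_tangent x v -> gE v v = 0 -> v = 0.
Proof.
move=> [x1 x2] [v1 v2]; rewrite /gE => vv.
have p1 := tangent_ge0 x1 v1; have p2 := tangent_ge0 x2 v2.
have e1 : lorentz v.1 v.1 = 0 by lra.
have e2 : lorentz v.2 v.2 = 0 by lra.
move: (tangent_eq0 x1 v1 e1) (tangent_eq0 x2 v2 e2).
by case: v {v1 v2 vv p1 p2 e1 e2} => a b /= -> ->.
Qed.

Lemma gE_hyp_proj x w q : HH_tangent x q -> gE (HH_proj x w) q = gE w q.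
Proof.
move=> [q1 q2]; rewrite /gE /= /hyp_proj !lorentzE.
by rewrite ![lorentz x.1 q.1]lorentzC ![lorentz x.2 q.2]lorentzC q1 q2; ring.
Qed.

Lemma HH_proj_tangent x w : HH x -> HH_tangent x (HH_proj x w).
Proof.
move=> [/hypm1P[h1 _] /hypm1P[h2 _]]; split; rewrite /= /hyp_proj !lorentzE.
  by rewrite h1; ring.
by rewrite h2; ring.
Qed.

Lemma HH_tangentD x v w : HH_tangent x v -> HH_tangent x w -> HH_tangent x (v + w).
Proof. by move=> [v1 v2] [w1 w2]; split; rewrite /= lorentzDl ?v1 ?v2 ?w1 ?w2 addr0. Qed.

Lemma HH_tangentZ x k v : HH_tangent x v -> HH_tangent x (k *: v).
Proof. by move=> [v1 v2]; split; rewrite /= lorentzZl ?v1 ?v2 mulr0. Qed.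

Lemma HH_tangentN x v : HH_tangent x v -> HH_tangent x (- v).
Proof. by move=> [v1 v2]; split; rewrite /= lorentzNl ?v1 ?v2 oppr0. Qed.

End ProductMetric.

Section LorentzCalculus.
Context {R : realType} {V : normedModType R}.
Local Notation R31 := 'rV[R]_3.
Local Notation E := (R31 * R31)%type.
Implicit Types (f g : V -> R31) (x v : V).

Lemma differentiable_lorentz f g x : differentiable f x ->
  differentiable g x -> differentiable (fun u => lorentz (f u) (g u)) x.
Proof.
move=> df dg; rewrite /lorentz.
by do ![apply: differentiable_add|apply: differentiable_opp|
  apply: differentiable_mul|apply: differentiable_entry].
Qed.

Lemma derive_lorentz f g x v : differentiable f x -> differentiable g x ->
  'D_v (fun u => lorentz (f u) (g u)) x =
  lorentz ('D_v f x) (g x) + lorentz (f x) ('D_v g x).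
Proof.
move=> df dg; rewrite /lorentz.
have dm i : differentiable (fun u => f u 0 i * g u 0 i) x.
  by apply: differentiable_mul; exact: differentiable_entry.
rewrite derive_add; [|apply: differentiable_add => //|by []]; last first.
  by apply: differentiable_opp.
rewrite derive_add //; last by apply: differentiable_opp.
rewrite derive_opp // !derive_mul; try exact: differentiable_entry.
rewrite -!derive_entry //; ring.
Qed.

Lemma differentiable_lcross f g x : differentiable f x ->
  differentiable g x -> differentiable (fun u => lcross (f u) (g u)) x.
Proof.
move=> df dg; apply: differentiable_row => i.
have d j k : differentiable (fun u => f u 0 j * g u 0 k) x.
  by apply: differentiable_mul; exact: differentiable_entry.
case: i => [[|[|[|//]]] H].
- rewrite (_ : (fun u => _) = fun u => f u 0 2 * g u 0 1 - f u 0 1 * g u 0 2).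
    exact: differentiable_sub.
  by apply/funext => u; rewrite mxE.
- rewrite (_ : (fun u => _) = fun u => f u 0 2 * g u 0 0 - f u 0 0 * g u 0 2).
    exact: differentiable_sub.
  by apply/funext => u; rewrite mxE.
- rewrite (_ : (fun u => _) = fun u => f u 0 0 * g u 0 1 - f u 0 1 * g u 0 0).
    exact: differentiable_sub.
  by apply/funext => u; rewrite mxE.
Qed.

Lemma derive_lcross f g x v : differentiable f x -> differentiable g x ->
  'D_v (fun u => lcross (f u) (g u)) x =
  lcross ('D_v f x) (g x) + lcross (f x) ('D_v g x).
Proof.
move=> df dg; have dl := differentiable_lcross df dg.
have d j k : differentiable (fun u => f u 0 j * g u 0 k) x.
  by apply: differentiable_mul; exact: differentiable_entry.
have H j k l m : 'D_v (fun u => f u 0 j * g u 0 k - f u 0 l * g u 0 m) x =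
  ('D_v f x) 0 j * g x 0 k + f x 0 j * ('D_v g x) 0 k
  - (('D_v f x) 0 l * g x 0 m + f x 0 l * ('D_v g x) 0 m).
  rewrite derive_sub // !derive_mul; try exact: differentiable_entry.
  by rewrite !derive_entry.
apply: row3P; rewrite derive_entry // [RHS]mxE !lcrossE.
- rewrite (_ : (fun u => _) = fun u => f u 0 2 * g u 0 1 - f u 0 1 * g u 0 2).
    by rewrite H; ring.
  by apply/funext => u; rewrite lcrossE.
- rewrite (_ : (fun u => _) = fun u => f u 0 2 * g u 0 0 - f u 0 0 * g u 0 2).
    by rewrite H; ring.
  by apply/funext => u; rewrite lcrossE.
- rewrite (_ : (fun u => _) = fun u => f u 0 0 * g u 0 1 - f u 0 1 * g u 0 0).
    by rewrite H; ring.
  by apply/funext => u; rewrite lcrossE.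
Qed.

Lemma differentiable_gE (F G : V -> E) x : differentiable F x ->
  differentiable G x -> differentiable (fun u => gE (F u) (G u)) x.
Proof.
move=> dF dG; apply: differentiable_add; apply: differentiable_lorentz;
  by [exact: differentiable_fst|exact: differentiable_snd].
Qed.

Lemma derive_gE (F G : V -> E) x v : differentiable F x -> differentiable G x ->
  'D_v (fun u => gE (F u) (G u)) x =
  gE ('D_v F x) (G x) + gE (F x) ('D_v G x).
Proof.
move=> dF dG.
have F1 := differentiable_fst dF; have F2 := differentiable_snd dF.
have G1 := differentiable_fst dG; have G2 := differentiable_snd dG.
rewrite derive_add; try exact: differentiable_lorentz.
rewrite !derive_lorentz // !derive_fst // !derive_snd // /gE.
by ring.
Qed.

End LorentzCalculus.

(** * Mixed partial derivatives and two by two matrices *)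

Section MixedPartials.
Context {R : realType} {V : normedModType R}.

(** Young's theorem for a vector valued map, tested against a linear form. *)
Lemma derive_comm_linear (W : normedModType R) (L : {linear W -> R})
    (f : V -> W) x v w : continuous L ->
  (\forall y \near x, differentiable f y) ->
  differentiable ('D_v f) x -> differentiable ('D_w f) x ->
  L ('D_w ('D_v f) x) = L ('D_v ('D_w f) x).
Proof.
move=> cL df dv dw.
have nr u : \forall y \near x, L ('D_u f y) = 'D_u (fun z => L (f z)) y.
  by apply: filterS df => y dy; exact: esym (derive_linear u cL dy).
have dLf : \forall y \near x, differentiable (fun z => L (f z)) y.
  by apply: filterS df => y; exact: differentiable_linear.
have step a b : differentiable ('D_a f) x ->
    L ('D_b ('D_a f) x) = 'D_b ('D_a (fun z => L (f z))) x.
  move=> da.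
  exact: (etrans (esym (derive_linear b cL da)) (near_eq_derive _ (nr a))).
have dd a : differentiable ('D_a f) x ->
    differentiable ('D_a (fun z => L (f z))) x.
  by move=> da; apply: (differentiable_eq_near (nr a)); exact: differentiable_linear.
apply: (etrans (step _ _ dv)); apply: (etrans _ (esym (step _ _ dw))).
exact: (derive_comm dLf (dd _ dv) (dd _ dw)).
Qed.

Lemma pair_rowP n (p q : 'rV[R]_n * 'rV[R]_n) :
  (forall i, p.1 0 i = q.1 0 i) -> (forall i, p.2 0 i = q.2 0 i) -> p = q.
Proof.
by case: p q => [p1 p2] [q1 q2] /= e1 e2; congr pair; apply/rowP.
Qed.

Lemma derive_comm_pair n (f : V -> 'rV[R]_n * 'rV[R]_n) x v w :
  (\forall y \near x, differentiable f y) ->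
  differentiable ('D_v f) x -> differentiable ('D_w f) x ->
  'D_w ('D_v f) x = 'D_v ('D_w f) x.
Proof.
move=> df dv dw.
have l1 i : linear (fun p : 'rV[R]_n * 'rV[R]_n => p.1 0 i).
  by move=> a p q; rewrite !mxE.
have l2 i : linear (fun p : 'rV[R]_n * 'rV[R]_n => p.2 0 i).
  by move=> a p q; rewrite !mxE.
pose L1 (i : 'I_n) : {linear ('rV[R]_n * 'rV[R]_n)%type -> R} := HB.pack
  (fun p : ('rV[R]_n * 'rV[R]_n)%type => p.1 0 i) (GRing.isLinear.Build _ _ _ _ _ (l1 i)).
pose L2 (i : 'I_n) : {linear ('rV[R]_n * 'rV[R]_n)%type -> R} := HB.pack
  (fun p : ('rV[R]_n * 'rV[R]_n)%type => p.2 0 i) (GRing.isLinear.Build _ _ _ _ _ (l2 i)).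
have c1 i : continuous (L1 i).
  move=> p; apply: (@continuous_comp _ _ _ fst (fun M : 'rV[R]_n => M 0 i)).
    exact: cvg_fst.
  exact: coord_continuous.
have c2 i : continuous (L2 i).
  move=> p; apply: (@continuous_comp _ _ _ snd (fun M : 'rV[R]_n => M 0 i)).
    exact: cvg_snd.
  exact: coord_continuous.
have e1 i := derive_comm_linear (c1 i) df dv dw.
have e2 i := derive_comm_linear (c2 i) df dv dw.
exact: (pair_rowP e1 e2).
Qed.

End MixedPartials.

Section TwoByTwo.
Context {R : realType}.

Lemma det2 (A : 'M[R]_2) : \det A = A 0 0 * A 1 1 - A 0 1 * A 1 0.
Proof.
have l0 : lift (0 : 'I_2) (0 : 'I_1) = 1 :> 'I_2 by exact: val_inj.
have l1 : lift (1 : 'I_2) (0 : 'I_1) = 0 :> 'I_2 by exact: val_inj.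
rewrite (expand_det_row _ 0) sum_ord2 /cofactor !det_mx11 !mxE l0 l1 /=.
by rewrite addn0 expr0 expr1; ring.
Qed.

Lemma adj2 (A : 'M[R]_2) : \adj A =
  \matrix_(i < 2, j < 2) (if i == j then A (lift i (0 : 'I_1)) (lift i (0 : 'I_1)) else - A i j).
Proof.
have l0 : lift (0 : 'I_2) (0 : 'I_1) = 1 :> 'I_2 by exact: val_inj.
have l1 : lift (1 : 'I_2) (0 : 'I_1) = 0 :> 'I_2 by exact: val_inj.
apply/matrixP => i j; rewrite !mxE /cofactor det_mx11 !mxE.
by case: (ord2P i) => ->; case: (ord2P j) => ->; rewrite ?l0 ?l1 /=
  ?addn0 ?expr0 ?expr1 ?mul1r ?mulN1r // /bump /= -signr_odd /= expr0 mul1r.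
Qed.

Lemma differentiable_invmx2 (V : normedModType R) (A : V -> 'M[R]_2) x i j :
  (forall k l, differentiable (fun u => A u k l) x) -> \det (A x) != 0 ->
  differentiable (fun u => invmx (A u) i j) x.
Proof.
move=> dA A0.
have dd : differentiable (fun u => \det (A u)) x.
  rewrite (_ : (fun u => \det (A u)) =
      fun u => A u 0 0 * A u 1 1 - A u 0 1 * A u 1 0).
    by apply: differentiable_sub; apply: differentiable_mul.
  by apply/funext => u; exact: det2.
have da : differentiable (fun u => (\adj (A u)) i j) x.
  rewrite (_ : (fun u => _) = fun u =>
      if i == j then A u (lift i (0 : 'I_1)) (lift i (0 : 'I_1)) else - A u i j); last first.
    by apply/funext => u; rewrite adj2 mxE.
  by case: (i == j); [exact: dA|apply: differentiable_opp].
have d0 : \forall u \near x, \det (A u) != 0.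
  have c := differentiable_continuous dd.
  apply: (c (fun z => z != 0)); rewrite /=.
  exact: (@open_nbhs_nbhs _ _ [set z | z != 0] (conj (@open_neq _ _) A0)).
apply: (@differentiable_eq_near _ _ _
    (fun u => (\det (A u))^-1 * (\adj (A u)) i j)).
  apply: filterS d0 => u u0; rewrite /invmx unitmxE unitfE u0.
  by rewrite [RHS]mxE.
by apply: differentiable_mul => //; exact: differentiable_inv.
Qed.

End TwoByTwo.

(** * Immersions and their induced metric *)

(** The partial derivatives, the inverse metric and the Christoffel symbols are
   locked, as unification is slow on the limits and determinants in their
   bodies. *)
HB.lock Definition pd {R : realType} {W : normedModType R} (i : 'I_2)
  (f : 'rV[R]_2 -> W) : 'rV[R]_2 -> W := 'D_(coord_vec i) f.

HB.lock Definition ginv {R : realType} (F : 'rV[R]_2 -> 'rV[R]_3 * 'rV[R]_3)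
  (i j : 'I_2) (u : 'rV[R]_2) : R := invmx (gram F u) i j.

HB.lock Definition Gam {R : realType} (F : 'rV[R]_2 -> 'rV[R]_3 * 'rV[R]_3)
  (k i j : 'I_2) (u : 'rV[R]_2) : R := christoffel F k i j u.

Lemma pdE (R : realType) (W : normedModType R) i (f : 'rV[R]_2 -> W) :
  pd i f = 'D_(coord_vec i) f.
Proof. by rewrite pd.unlock. Qed.

Lemma pd_at (R : realType) (W : normedModType R) i (f : 'rV[R]_2 -> W) u :
  pd i f u = 'D_(coord_vec i) f u.
Proof. by rewrite pdE. Qed.

Section PartialCalculus.
Context {R : realType}.
Local Notation plane := 'rV[R]_2.

Lemma pd_scale (W : normedModType R) (k : plane -> R) (f : plane -> W) i u :
  differentiable k u -> differentiable f u ->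
  pd i (fun u => k u *: f u) u = pd i k u *: f u + k u *: pd i f u.
Proof. by move=> dk df; rewrite !pdE; exact: (derive_scale dk df). Qed.

Lemma pd_mul (f g : plane -> R) i u : differentiable f u -> differentiable g u ->
  pd i (fun u => f u * g u) u = pd i f u * g u + f u * pd i g u.
Proof. by rewrite !pdE; exact: derive_mul. Qed.

Lemma pd_add (W : normedModType R) (f g : plane -> W) i u :
  differentiable f u -> differentiable g u ->
  pd i (fun u => f u + g u) u = pd i f u + pd i g u.
Proof. by rewrite !pdE; exact: derive_add. Qed.

Lemma pd_sub (W : normedModType R) (f g : plane -> W) i u :
  differentiable f u -> differentiable g u ->
  pd i (fun u => f u - g u) u = pd i f u - pd i g u.
Proof. by rewrite !pdE; exact: derive_sub. Qed.

Lemma pd_cst (W : normedModType R) (c : W) i u : pd i (fun _ : plane => c) u = 0.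
Proof. by rewrite pdE; exact: derive_cst. Qed.

Lemma pd_fst (W1 W2 : normedModType R) (f : plane -> W1 * W2) i u :
  differentiable f u -> pd i (fun u => (f u).1) u = (pd i f u).1.
Proof. by rewrite !pdE; exact: derive_fst. Qed.

Lemma pd_snd (W1 W2 : normedModType R) (f : plane -> W1 * W2) i u :
  differentiable f u -> pd i (fun u => (f u).2) u = (pd i f u).2.
Proof. by rewrite !pdE; exact: derive_snd. Qed.

Lemma pd_pair (W1 W2 : normedModType R) (f : plane -> W1) (g : plane -> W2) i u :
  differentiable f u -> differentiable g u ->
  pd i (fun u => (f u, g u)) u = (pd i f u, pd i g u).
Proof. by rewrite !pdE; exact: derive_pair. Qed.

Lemma pd_lorentz (f g : plane -> 'rV[R]_3) i u :
  differentiable f u -> differentiable g u ->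
  pd i (fun u => lorentz (f u) (g u)) u =
  lorentz (pd i f u) (g u) + lorentz (f u) (pd i g u).
Proof. by rewrite !pdE; exact: derive_lorentz. Qed.

Lemma pd_gE (F G : plane -> 'rV[R]_3 * 'rV[R]_3) i u :
  differentiable F u -> differentiable G u ->
  pd i (fun u => gE (F u) (G u)) u =
  gE (pd i F u) (G u) + gE (F u) (pd i G u).
Proof. by rewrite !pdE; exact: derive_gE. Qed.

Lemma derive_pd (W : normedModType R) (f : plane -> W) v u :
  differentiable f u -> 'D_v f u = v 0 0 *: pd 0 f u + v 0 1 *: pd 1 f u.
Proof. by rewrite !pdE; exact: derive_plane. Qed.

End PartialCalculus.

(** Differentiate [<m.1, m.1> = <m.2, m.2> = -1]. *)
Lemma derive_HH_tangent (R : realType) (V : normedModType R)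
    (m : V -> 'rV[R]_3 * 'rV[R]_3) w a :
  differentiable m w -> (\forall w \near w, HH (m w)) -> HH_tangent (m w) ('D_a m w).
Proof.
move=> dm hm; have d1 := differentiable_fst dm; have d2 := differentiable_snd dm.
have c0 (p q : 'rV[R]_3) : lorentz p q + lorentz q p = 0 -> lorentz p q = 0.
  by rewrite (lorentzC q); lra.
split; apply: c0.
- have h : 'D_a (fun w => lorentz (m w).1 (m w).1) w = 0.
    rewrite -(derive_cst (-1 : R) w a); apply: near_eq_derive.
    by apply: filterS hm => w' [/hypm1P[]].
  by rewrite -h (derive_lorentz a d1 d1) (derive_fst a dm).
- have h : 'D_a (fun w => lorentz (m w).2 (m w).2) w = 0.
    rewrite -(derive_cst (-1 : R) w a); apply: near_eq_derive.
    by apply: filterS hm => w' [_ /hypm1P[]].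
  by rewrite -h (derive_lorentz a d2 d2) (derive_snd a dm).
Qed.

Section Immersion.
Context {R : realType}.
Local Notation R31 := 'rV[R]_3.
Local Notation E := (R31 * R31)%type.
Local Notation plane := 'rV[R]_2.

Record is_immersion (U : set plane) (F : plane -> E) : Prop := IsImmersion {
  imm_open : open U;
  imm_smooth : smooth_on U F;
  imm_HH : forall u, U u -> HH (F u);
  imm_inj : forall u v, U u -> 'D_v F u = 0 -> v = 0 }.

Variables (U : set plane) (F : plane -> E).
Hypothesis immF : is_immersion U F.

Local Notation F1 i := (pd i F).
Local Notation F2 i j := (pd i (pd j F)).
Local Notation F3 k i j := (pd k (pd i (pd j F))).

Lemma near_U u : U u -> \forall u' \near u, U u'.
Proof. by move=> Uu; exact: (open_nbhs_nbhs (conj (imm_open immF) Uu)). Qed.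

Lemma near_all (P : plane -> Prop) u :
  U u -> (forall u', U u' -> P u') -> \forall u' \near u, P u'.
Proof. by move=> Uu H; apply: filterS (near_U Uu). Qed.

Lemma derive_eq_on (W : normedModType R) (f g : plane -> W) u v : U u ->
  (forall u', U u' -> f u' = g u') -> 'D_v f u = 'D_v g u.
Proof. by move=> Uu fg; apply: near_eq_derive; exact: near_all. Qed.

Lemma differentiable_eq_on (W : normedModType R) (f g : plane -> W) u : U u ->
  (forall u', U u' -> f u' = g u') -> differentiable f u -> differentiable g u.
Proof. by move=> Uu fg; apply: differentiable_eq_near; exact: near_all. Qed.

Lemma pd_eq_on (W : normedModType R) (f g : plane -> W) u i : U u ->
  (forall u', U u' -> f u' = g u') -> pd i f u = pd i g u.
Proof. by rewrite !pdE; exact: derive_eq_on. Qed.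

Lemma dF u : U u -> differentiable F u.
Proof. by move=> Uu; exact: (smooth_differentiable (imm_smooth immF) Uu). Qed.

Lemma dF1 i u : U u -> differentiable (F1 i) u.
Proof.
rewrite pdE => Uu.
exact: (smooth_differentiable (smooth_derive _ (imm_smooth immF)) Uu).
Qed.

Lemma dF2 i j u : U u -> differentiable (F2 i j) u.
Proof.
move=> Uu; have s1 := smooth_derive (coord_vec j) (imm_smooth immF).
have := smooth_differentiable (smooth_derive (coord_vec i) s1) Uu.
by rewrite !pdE.
Qed.

Lemma F2C i j u : U u -> F2 i j u = F2 j i u.
Proof.
move=> Uu; have n : \forall u' \near u, differentiable F u'.
  by apply: (near_all Uu) => u'; exact: dF.
by move: (dF1 i Uu) (dF1 j Uu); rewrite !pdE => di dj; exact: derive_comm_pair n dj di.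
Qed.

Lemma F3C k i j u : U u -> F3 k i j u = F3 i k j u.
Proof.
move=> Uu; have n : \forall u' \near u, differentiable (F1 j) u'.
  by apply: (near_all Uu) => u'; exact: dF1.
move: n (dF2 i j Uu) (dF2 k j Uu); set f := pd j F => n.
by rewrite !(@pdE _ _ k) !(@pdE _ _ i) => di dk; exact: derive_comm_pair n di dk.
Qed.

Lemma DF_sum v u : U u -> 'D_v F u = v 0 0 *: F1 0 u + v 0 1 *: F1 1 u.
Proof. by move=> Uu; rewrite -derive_pd //; exact: dF. Qed.

Lemma F_tangent v u : U u -> HH_tangent (F u) ('D_v F u).
Proof.
move=> Uu; apply: derive_HH_tangent; first exact: dF.
by apply: near_all => // u'; exact: imm_HH.
Qed.

(** ** The induced metric and its Levi-Civita connection *)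

Local Notation g i j u := (gE (F1 i u) (F1 j u)).

Lemma gramE i j u : gram F u i j = g i j u.
Proof. by rewrite !pdE mxE. Qed.

Lemma det_gram u : U u -> \det (gram F u) != 0.
Proof.
move=> Uu; apply/negP => /det0P[v v0 /rowP vg].
have := vg 0; have := vg 1; rewrite !mxE !sum_ord2 !gramE => h1 h0.
have : gE ('D_v F u) ('D_v F u) = 0.
  rewrite (DF_sum v Uu) !gEE.
  transitivity (v 0 0 * (v 0 0 * g 0 0 u + v 0 1 * g 1 0 u)
    + v 0 1 * (v 0 0 * g 0 1 u + v 0 1 * g 1 1 u)).
    by rewrite (gEC (F1 1 u) (F1 0 u)); ring.
  by rewrite h0 h1 !mulr0 addr0.
move/(gE_eq0 (imm_HH immF Uu) (F_tangent v Uu))/(imm_inj immF Uu) => vz.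
by rewrite vz eqxx in v0.
Qed.

Lemma gram_unit u : U u -> gram F u \in unitmx.
Proof. by move=> Uu; rewrite unitmxE unitfE det_gram. Qed.

Lemma differentiable_gram i j u : U u -> differentiable (fun u => g i j u) u.
Proof. by move=> Uu; apply: differentiable_gE; exact: dF1. Qed.

Lemma pd_gram k i j u : U u -> pd k (fun u => g i j u) u =
  gE (F2 k i u) (F1 j u) + gE (F1 i u) (F2 k j u).
Proof. by move=> Uu; rewrite pd_gE //; exact: dF1. Qed.

Lemma differentiable_ginv i j u : U u -> differentiable (ginv F i j) u.
Proof.
move=> Uu; rewrite ginv.unlock; apply: differentiable_invmx2; last exact: det_gram.
move=> k l; rewrite (_ : (fun u => _) = fun u => g k l u).
  exact: differentiable_gram.
by apply/funext => u'; exact: gramE.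
Qed.

Lemma ginvC i j u : ginv F i j u = ginv F j i u.
Proof.
have gT : (gram F u)^T = gram F u.
  by apply/matrixP => k l; rewrite mxE !gramE gEC.
by rewrite ginv.unlock -{1}gT -trmx_inv mxE.
Qed.

Lemma ginv_gram u j l : U u -> \sum_k ginv F j k u * g k l u = (j == l)%:R.
Proof.
move=> Uu; have := mulVmx (gram_unit Uu) => /matrixP/(_ j l).
rewrite !mxE => <-; apply: eq_bigr => k _.
by rewrite gramE ginv.unlock.
Qed.

Lemma GamE k i j u : Gam F k i j u = 2^-1 * \sum_l ginv F k l u *
  (pd i (fun u => g j l u) u + pd j (fun u => g i l u) u
   - pd l (fun u => g i j u) u).
Proof.
have gf a b : (fun u => g a b u) = (fun u => gram F u a b).
  by apply/funext => u'; rewrite gramE.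
rewrite Gam.unlock /christoffel; congr (_ * _); apply: eq_bigr => l _.
by rewrite !gf !pdE ginv.unlock.
Qed.

(** By the Koszul formula, the Christoffel symbols are the coefficients of the
   tangential part of the second derivative. *)
Lemma Gam_gram i j l u : U u ->
  \sum_k Gam F k i j u * g k l u = gE (F2 i j u) (F1 l u).
Proof.
move=> Uu; under eq_bigr => k _ do rewrite GamE.
set K := fun m => pd i (fun u => g j m u) u + pd j (fun u => g i m u) u
   - pd m (fun u => g i j u) u.
have KE m : K m = 2 * gE (F2 i j u) (F1 m u).
  rewrite /K !pd_gram // (F2C j i Uu) (F2C m i Uu) (F2C m j Uu).
  rewrite (gEC (F1 j u) (F2 i m u)) (gEC (F1 i u) (F2 j m u)).
  by ring.
transitivity (\sum_m 2^-1 * K m * \sum_k ginv F m k u * g k l u).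
  under eq_bigr => k _ do rewrite mulr_sumr mulr_suml.
  rewrite exchange_big /=; apply: eq_bigr => m _; rewrite mulr_sumr.
  apply: eq_bigr => k _; rewrite -/(K m) (ginvC k m).
  by ring.
rewrite (bigD1 l) //= ginv_gram // eqxx mulr1 big1 ?addr0; last first.
  by move=> m ml; rewrite ginv_gram // (negbTE ml) mulr0.
by rewrite KE mulrA mulVf ?mul1r // pnatr_eq0.
Qed.

Lemma GamC k i j u : Gam F k i j u = Gam F k j i u.
Proof.
rewrite !GamE; congr (_ * _); apply: eq_bigr => l _; congr (_ * _).
rewrite [X in X - _]addrC; congr (_ - _); congr (pd _ _ _).
by apply/funext => u'; exact: gEC.
Qed.

Lemma differentiable_Gam k i j u : U u -> differentiable (Gam F k i j) u.
Proof.
move=> Uu; pose c l u := ginv F k l u *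
  (gE (F2 i j u) (F1 l u) + gE (F1 j u) (F2 i l u)
  + (gE (F2 j i u) (F1 l u) + gE (F1 i u) (F2 j l u))
  - (gE (F2 l i u) (F1 j u) + gE (F1 i u) (F2 l j u))).
apply: (@differentiable_eq_on _ (fun u => 2^-1 * (c 0 u + c 1 u)) _ u Uu).
  by move=> u' Uu'; rewrite GamE sum_ord2 !pd_gram.
have dg a b d : differentiable (fun u => gE (F2 a b u) (F1 d u)
    + gE (F1 b u) (F2 a d u)) u.
  by apply: differentiable_add; apply: differentiable_gE;
    [exact: dF2|exact: dF1|exact: dF1|exact: dF2].
have dc l : differentiable (c l) u.
  apply: differentiable_mul; first exact: differentiable_ginv.
  by apply: differentiable_sub => //; exact: differentiable_add.
apply: differentiable_mul; first exact: differentiable_cst.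
exact: differentiable_add.
Qed.

End Immersion.

(** * The second fundamental form *)

(** The normal component of an ambient vector, in two steps: tangent to the
   product of hyperbolic planes, then orthogonal to the surface. *)
Definition orth_part {R : realType} (F : 'rV[R]_2 -> 'rV[R]_3 * 'rV[R]_3)
    (u : 'rV[R]_2) (w : 'rV[R]_3 * 'rV[R]_3) : 'rV[R]_3 * 'rV[R]_3 :=
  w - \sum_i \sum_j (ginv F i j u * gE w (pd i F u)) *: pd j F u.

Definition normal_proj {R : realType} (F : 'rV[R]_2 -> 'rV[R]_3 * 'rV[R]_3)
    (u : 'rV[R]_2) (w : 'rV[R]_3 * 'rV[R]_3) : 'rV[R]_3 * 'rV[R]_3 :=
  orth_part F u (HH_proj (F u) w).

(** The components of the second fundamental form. *)
HB.lock Definition hff {R : realType} (F : 'rV[R]_2 -> 'rV[R]_3 * 'rV[R]_3)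
    (i j : 'I_2) (u : 'rV[R]_2) : 'rV[R]_3 * 'rV[R]_3 :=
  normal_proj F u (pd i (pd j F) u).

Section SecondFundamentalForm.
Context {R : realType}.
Local Notation R31 := 'rV[R]_3.
Local Notation E := (R31 * R31)%type.
Local Notation plane := 'rV[R]_2.

(** Vector identities are reduced by this lemma to scalar ones. *)
Lemma gE_ext (p q : E) : (forall r, gE p r = gE q r) -> p = q.
Proof.
move=> H; have H0 r : gE (p - q) r = 0 by rewrite gEDl gENl H subrr.
apply/eqP; rewrite -subr_eq0; apply/eqP; move: H0; move: (p - q) => [a b] H0.
have z (c : R31) : (forall r, lorentz c r = 0) -> c = 0.
  move=> cz; have c0 := cz (delta_mx 0 0); have c1 := cz (delta_mx 0 1).
  have c2 := cz (delta_mx 0 2); rewrite /lorentz !mxE /= in c0 c1 c2.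
  by apply: row3P; rewrite mxE; [move: c0|move: c1|move: c2]; clear; lra.
congr pair; apply: z => r.
  by have := H0 (r, 0); rewrite /gE /= lorentz0r addr0.
by have := H0 (0, r); rewrite /gE /= lorentz0r add0r.
Qed.

(** The tensoriality of the derivative of [h]: the derivatives [y] and [z] of the
   coefficients of the vector fields [Y] and [Z], produced by the Leibniz rule,
   cancel those in [nY] and [nZ], the covariant derivatives of [Y] and [Z] with
   Christoffel symbols [G].  [p] stands for the derivatives of [h] and [P] for
   the normal projection. *)
Lemma tensor_algebra (P : E -> E) (x Y Z : 'I_2 -> R) (y z : 'I_2 -> 'I_2 -> R)
    (G : 'I_2 -> 'I_2 -> 'I_2 -> R) (h : 'I_2 -> 'I_2 -> E)
    (p : 'I_2 -> 'I_2 -> 'I_2 -> E) :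
  (forall v w, P (v + w) = P v + P w) -> (forall k w, P (k *: w) = k *: P w) ->
  (forall i j, P (h i j) = h i j) ->
  let c i j := (x 0 * y 0 i + x 1 * y 1 i) * Z j
     + Y i * (x 0 * z 0 j + x 1 * z 1 j) in
  let d i j := c i j *: h i j + (Y i * Z j) *: (x 0 *: p 0 i j + x 1 *: p 1 i j) in
  let nY i := x 0 * y 0 i + x 1 * y 1 i
    + (G i 0 0 * x 0 * Y 0 + G i 0 1 * x 0 * Y 1
    + (G i 1 0 * x 1 * Y 0 + G i 1 1 * x 1 * Y 1)) in
  let nZ i := x 0 * z 0 i + x 1 * z 1 i
    + (G i 0 0 * x 0 * Z 0 + G i 0 1 * x 0 * Z 1
    + (G i 1 0 * x 1 * Z 0 + G i 1 1 * x 1 * Z 1)) in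
  P (d 0 0 + d 0 1 + (d 1 0 + d 1 1))
  - ((nY 0 * Z 0) *: h 0 0 + (nY 0 * Z 1) *: h 0 1
     + ((nY 1 * Z 0) *: h 1 0 + (nY 1 * Z 1) *: h 1 1))
  - ((Y 0 * nZ 0) *: h 0 0 + (Y 0 * nZ 1) *: h 0 1
     + ((Y 1 * nZ 0) *: h 1 0 + (Y 1 * nZ 1) *: h 1 1)) =
  \sum_k \sum_i \sum_j (x k * Y i * Z j) *: (P (p k i j)
    - (G 0 k i *: h 0 j + G 1 k i *: h 1 j)
    - (G 0 k j *: h i 0 + G 1 k j *: h i 1)).
Proof.
move=> PD PZ Ph /=; rewrite !sum_ord2 !(PD, PZ) !Ph.
by apply: gE_ext => r; rewrite !gEE; ring.
Qed.

Variables (U : set plane) (F : plane -> E).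
Hypothesis immF : is_immersion U F.

Local Notation F1 i := (pd i F).
Local Notation F2 i j := (pd i (pd j F)).
Local Notation F3 k i j := (pd k (pd i (pd j F))).

Lemma F1_tangent i u : U u -> HH_tangent (F u) (F1 i u).
Proof. by move=> Uu; rewrite pdE; exact: (F_tangent immF). Qed.

Lemma F2_position i j u : U u ->
  lorentz (F2 i j u).1 (F u).1 = - lorentz (F1 i u).1 (F1 j u).1 /\
  lorentz (F2 i j u).2 (F u).2 = - lorentz (F1 i u).2 (F1 j u).2.
Proof.
move=> Uu; have d0 := dF immF Uu; have d1 := dF1 immF j Uu.
have h1 : pd i (fun u => lorentz (F1 j u).1 (F u).1) u = 0.
  rewrite -(pd_cst (0 : R) i u); apply: (pd_eq_on immF _ Uu) => u' Uu'.
  by case: (F1_tangent j Uu').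
have h2 : pd i (fun u => lorentz (F1 j u).2 (F u).2) u = 0.
  rewrite -(pd_cst (0 : R) i u); apply: (pd_eq_on immF _ Uu) => u' Uu'.
  by case: (F1_tangent j Uu').
rewrite (pd_lorentz i (differentiable_fst d1) (differentiable_fst d0)) in h1.
rewrite (pd_lorentz i (differentiable_snd d1) (differentiable_snd d0)) in h2.
rewrite (pd_fst i d1) (pd_fst i d0) in h1.
rewrite (pd_snd i d1) (pd_snd i d0) in h2.
split; first by rewrite (lorentzC (F1 i u).1); move: h1; lra.
by rewrite (lorentzC (F1 i u).2); move: h2; lra.
Qed.

Local Notation orth_part := (orth_part F).
Local Notation normal_proj := (normal_proj F).
Local Notation hff := (hff F).

Lemma hff_def i j u : hff i j u = normal_proj u (F2 i j u).
Proof. by rewrite hff.unlock. Qed.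

Lemma normal_partE W u : normal_part F W u = orth_part u (W u).
Proof.
rewrite /normal_part /orth_part; congr (_ - _).
by apply: eq_bigr => i _; apply: eq_bigr => j _; rewrite !pdE ginv.unlock.
Qed.

Lemma orth_partE u w : orth_part u w = w -
  ((ginv F 0 0 u * gE w (F1 0 u) + ginv F 1 0 u * gE w (F1 1 u)) *: F1 0 u +
   (ginv F 0 1 u * gE w (F1 0 u) + ginv F 1 1 u * gE w (F1 1 u)) *: F1 1 u).
Proof.
rewrite /orth_part; congr (_ - _); rewrite !sum_ord2 !scalerDl.
by rewrite addrACA.
Qed.

Lemma orth_partD u v w : orth_part u (v + w) = orth_part u v + orth_part u w.
Proof. by rewrite !orth_partE; apply: gE_ext => r; rewrite !gEE; ring. Qed.

Lemma orth_partZ u k w : orth_part u (k *: w) = k *: orth_part u w.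
Proof. by rewrite !orth_partE; apply: gE_ext => r; rewrite !gEE; ring. Qed.

Lemma HH_projD (x v w : E) : HH_proj x (v + w) = HH_proj x v + HH_proj x w.
Proof.
rewrite /HH_proj /hyp_proj /=; congr pair; rewrite lorentzDl scalerDl; exact: addrACA.
Qed.

Lemma HH_projZ (x w : E) k : HH_proj x (k *: w) = k *: HH_proj x w.
Proof.
by rewrite /HH_proj /hyp_proj /=; congr pair; rewrite lorentzZl scalerDr scalerA.
Qed.

Lemma HH_proj_id (x w : E) : HH_tangent x w -> HH_proj x w = w.
Proof.
move=> [w1 w2]; rewrite /HH_proj /hyp_proj w1 w2 !scale0r !addr0.
by case: w w1 w2.
Qed.

Lemma normal_projD u v w :
  normal_proj u (v + w) = normal_proj u v + normal_proj u w.
Proof. by rewrite /normal_proj HH_projD orth_partD. Qed.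

Lemma normal_projZ u k w : normal_proj u (k *: w) = k *: normal_proj u w.
Proof. by rewrite /normal_proj HH_projZ orth_partZ. Qed.

Lemma ginv_gramC u j l : U u ->
  ginv F 0 j u * gE (F1 l u) (F1 0 u) + ginv F 1 j u * gE (F1 l u) (F1 1 u)
  = (j == l)%:R.
Proof.
move=> Uu; rewrite -(ginv_gram immF j l Uu) sum_ord2.
by rewrite !(gEC (F1 l u)) !(ginvC F _ j).
Qed.

Lemma orth_part_F1 u l : U u -> orth_part u (F1 l u) = 0.
Proof.
move=> Uu; rewrite orth_partE !ginv_gramC //.
by case: (ord2P l) => -> /=; rewrite ?scale1r ?scale0r ?addr0 ?add0r subrr.
Qed.

Lemma normal_proj_F1 u l : U u -> normal_proj u (F1 l u) = 0.
Proof.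
by move=> Uu; rewrite /normal_proj HH_proj_id ?orth_part_F1 //; exact: F1_tangent.
Qed.

Lemma orth_part_orth u w l : U u -> gE (orth_part u w) (F1 l u) = 0.
Proof.
move=> Uu; rewrite orth_partE !gEE.
transitivity (gE w (F1 l u)
  - gE w (F1 0 u) * (ginv F 0 0 u * gE (F1 l u) (F1 0 u)
      + ginv F 1 0 u * gE (F1 l u) (F1 1 u))
  - gE w (F1 1 u) * (ginv F 0 1 u * gE (F1 l u) (F1 0 u)
      + ginv F 1 1 u * gE (F1 l u) (F1 1 u))).
  by rewrite !(gEC (F1 l u)) (ginvC F 1 0); ring.
by rewrite !ginv_gramC //; case: (ord2P l) => -> /=; ring.
Qed.

Lemma orth_part_normal u w N : (forall l, gE N (F1 l u) = 0) ->
  gE (orth_part u w) N = gE w N.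
Proof. by move=> HN; rewrite orth_partE !gEE !(gEC (F1 _ u)) !HN; ring. Qed.

Lemma orth_part_id u w : (forall l, gE w (F1 l u) = 0) -> orth_part u w = w.
Proof. by move=> Hw; rewrite orth_partE !Hw !mulr0 !addr0 !scale0r addr0 subr0. Qed.

Lemma orth_part_tangent u w : U u -> HH_tangent (F u) w ->
  HH_tangent (F u) (orth_part u w).
Proof.
move=> Uu wt; rewrite orth_partE; apply: HH_tangentD => //; apply: HH_tangentN.
by apply: HH_tangentD; apply: HH_tangentZ; exact: F1_tangent.
Qed.

Lemma normal_proj_tangent u w : U u -> HH_tangent (F u) (normal_proj u w).
Proof.
move=> Uu; apply: orth_part_tangent => //; apply: HH_proj_tangent.
exact: imm_HH immF _ Uu.
Qed.

Lemma normal_proj_orth u w l : U u -> gE (normal_proj u w) (F1 l u) = 0.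
Proof. exact: orth_part_orth. Qed.

Lemma normal_proj_id u w : U u -> HH_tangent (F u) w ->
  (forall l, gE w (F1 l u) = 0) -> normal_proj u w = w.
Proof. by move=> Uu wt wo; rewrite /normal_proj HH_proj_id // orth_part_id. Qed.

Lemma normal_proj_normal u w N : HH_tangent (F u) N ->
  (forall l, gE N (F1 l u) = 0) -> gE (normal_proj u w) N = gE w N.
Proof. by move=> Nt HN; rewrite orth_part_normal // gE_hyp_proj. Qed.

Lemma normal_proj_hff i j u : U u -> normal_proj u (hff i j u) = hff i j u.
Proof.
move=> Uu; rewrite hff_def; apply: normal_proj_id => // [|l]; first exact: normal_proj_tangent.
exact: normal_proj_orth.
Qed.

Lemma Gam_ginv i j k u : U u ->
  ginv F 0 k u * gE (F2 i j u) (F1 0 u) + ginv F 1 k u * gE (F2 i j u) (F1 1 u)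
  = Gam F k i j u.
Proof.
move=> Uu; rewrite -!(Gam_gram immF) // !sum_ord2.
transitivity (Gam F 0 i j u * (ginv F 0 k u * gE (F1 0 u) (F1 0 u)
     + ginv F 1 k u * gE (F1 0 u) (F1 1 u))
   + Gam F 1 i j u * (ginv F 0 k u * gE (F1 1 u) (F1 0 u)
     + ginv F 1 k u * gE (F1 1 u) (F1 1 u))); first by ring.
by rewrite !ginv_gramC //; case: (ord2P k) => -> /=; ring.
Qed.

(** The Gauss formula: the component of [F2 i j] along the position comes from
   differentiating [F1 j] orthogonal to [F], the component tangent to the surface
   from the Koszul formula. *)
Lemma hffE i j u : U u -> hff i j u = F2 i j u
  - (lorentz (F1 i u).1 (F1 j u).1 *: (F u).1,
     lorentz (F1 i u).2 (F1 j u).2 *: (F u).2)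
  - (Gam F 0 i j u *: F1 0 u + Gam F 1 i j u *: F1 1 u).
Proof.
move=> Uu; rewrite hff_def /normal_proj orth_partE.
rewrite !(gE_hyp_proj _ (F1_tangent _ Uu)) !Gam_ginv //; congr (_ - _).
have [p1 p2] := F2_position i j Uu.
rewrite /HH_proj /hyp_proj p1 p2 !scaleNr.
by case: (F2 i j u).
Qed.

Lemma differentiable_hff i j u : U u -> differentiable (hff i j) u.
Proof.
move=> Uu; have d0 := dF immF Uu; have d1 k := dF1 immF k Uu.
have s1 : differentiable (fun u => lorentz (F1 i u).1 (F1 j u).1) u.
  by apply: differentiable_lorentz; exact: differentiable_fst.
have s2 : differentiable (fun u => lorentz (F1 i u).2 (F1 j u).2) u.
  by apply: differentiable_lorentz; exact: differentiable_snd.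
have dG k := differentiable_Gam immF k i j Uu.
apply: (differentiable_eq_on immF Uu (fun u' Uu' => esym (hffE i j Uu'))).
apply: differentiable_sub; [apply: differentiable_sub|].
- exact: (dF2 immF i j Uu).
- apply: differentiable_pair.
    by apply: (differentiable_scale s1); exact: differentiable_fst.
  by apply: (differentiable_scale s2); exact: differentiable_snd.
- by apply: differentiable_add; apply: differentiable_scale.
Qed.

Lemma second_ffE Y Z u : U u -> differentiable Z u ->
  second_ff F Y Z u =
    (Y u 0 0 * Z u 0 0) *: hff 0 0 u + (Y u 0 0 * Z u 0 1) *: hff 0 1 u
  + ((Y u 0 1 * Z u 0 0) *: hff 1 0 u + (Y u 0 1 * Z u 0 1) *: hff 1 1 u).
Proof.
move=> Uu dZ; rewrite /second_ff normal_partE -/(normal_proj u _).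
have -> : 'D_(Y u) (Defs.pushforward F Z) u =
    'D_(Y u) (fun u => Z u 0 0 *: F1 0 u + Z u 0 1 *: F1 1 u) u.
  apply: (derive_eq_on immF) => // u' Uu'; exact: (DF_sum immF).
have dz i : differentiable (fun u => Z u 0 i) u by exact: differentiable_entry.
have d1 k := dF1 immF k Uu.
have ds k : differentiable (fun u => Z u 0 k *: F1 k u) u.
  exact: (differentiable_scale (dz k) (d1 k)).
rewrite (derive_add _ (ds 0) (ds 1)) !(derive_scale (dz _) (d1 _)).
rewrite !(derive_pd _ (d1 _)) !(normal_projD, normal_projZ) !normal_proj_F1 //.
rewrite -!hff_def.
move: (hff 0 0 u) (hff 0 1 u) (hff 1 0 u) (hff 1 1 u) ('D_(Y u) _ u) ('D_(Y u) _ u).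
move=> h00 h01 h10 h11 a b.
by apply: gE_ext => r; rewrite !gEE; ring.
Qed.

(** Components of the covariant derivative of the second fundamental form. *)
Definition nabla_hff k i j u : E := normal_proj u (pd k (hff i j) u)
  - (Gam F 0 k i u *: hff 0 j u + Gam F 1 k i u *: hff 1 j u)
  - (Gam F 0 k j u *: hff i 0 u + Gam F 1 k j u *: hff i 1 u).

Lemma nablaE X Y u i : differentiable Y u ->
  nabla F X Y u 0 i = X u 0 0 * pd 0 (fun u => Y u 0 i) u
    + X u 0 1 * pd 1 (fun u => Y u 0 i) u
  + (Gam F i 0 0 u * X u 0 0 * Y u 0 0 + Gam F i 0 1 u * X u 0 0 * Y u 0 1
  + (Gam F i 1 0 u * X u 0 1 * Y u 0 0 + Gam F i 1 1 u * X u 0 1 * Y u 0 1)).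
Proof.
move=> dY; rewrite /nabla [LHS]mxE; congr (_ + _).
  by rewrite derive_entry // derive_pd //; exact: differentiable_entry.
by rewrite mxE !sum_ord2 Gam.unlock.
Qed.

Lemma differentiable_nabla X Y u : smooth_on U X -> smooth_on U Y -> U u ->
  differentiable (nabla F X Y) u.
Proof.
move=> sX sY Uu; apply: differentiable_row => i.
have dX k u' : U u' -> differentiable (fun u => X u 0 k) u'.
  by move=> Uu'; apply: differentiable_entry; exact: smooth_differentiable sX Uu'.
have dY k u' : U u' -> differentiable (fun u => Y u 0 k) u'.
  by move=> Uu'; apply: differentiable_entry; exact: smooth_differentiable sY Uu'.
have ddY l k : differentiable (pd l (fun u => Y u 0 k)) u.
  apply: (@differentiable_eq_on _ _ _ immF _
    (fun u => ('D_(coord_vec l) Y u) 0 k) _ u Uu).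
    move=> u' Uu'; rewrite pdE derive_entry //.
    exact: smooth_differentiable sY Uu'.
  apply: differentiable_entry.
  exact: smooth_differentiable (smooth_derive _ sY) Uu.
have dG k a b := differentiable_Gam immF k a b Uu.
apply: (differentiable_eq_on immF Uu (fun u' Uu' => esym (nablaE X i
  (smooth_differentiable sY Uu')))).
have d3 a b : differentiable (fun u => Gam F i a b u * X u 0 a * Y u 0 b) u.
  by do ![apply: differentiable_mul] => //; [exact: dX|exact: dY].
have d2 k : differentiable (fun u => X u 0 k * pd k (fun u => Y u 0 i) u) u.
  by apply: differentiable_mul => //; exact: dX.
by do ![apply: differentiable_add].
Qed.

(** The covariant derivative of the second fundamental form is tensorial. *)
Lemma nabla_second_ffE X Y Z u : smooth_on U X -> smooth_on U Y ->
  smooth_on U Z -> U u -> nabla_second_ff F X Y Z u =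
  \sum_k \sum_i \sum_j (X u 0 k * Y u 0 i * Z u 0 j) *: nabla_hff k i j u.
Proof.
move=> sX sY sZ Uu; rewrite /nabla_second_ff.
have dY u' : U u' -> differentiable Y u' by exact: smooth_differentiable.
have dZ u' : U u' -> differentiable Z u' by exact: smooth_differentiable.
have dy i : differentiable (fun u => Y u 0 i) u.
  by apply: differentiable_entry; exact: dY.
have dz i : differentiable (fun u => Z u 0 i) u.
  by apply: differentiable_entry; exact: dZ.
have dyz i j := differentiable_mul (dy i) (dz j).
have dh i j := differentiable_hff i j Uu.
have dt i j := differentiable_scale (dyz i j) (dh i j).
have tE i j : 'D_(X u) (fun u => (Y u 0 i * Z u 0 j) *: hff i j u) u =
    ((X u 0 0 * pd 0 (fun u => Y u 0 i) u + X u 0 1 * pd 1 (fun u => Y u 0 i) u)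
      * Z u 0 j
     + Y u 0 i * (X u 0 0 * pd 0 (fun u => Z u 0 j) u
      + X u 0 1 * pd 1 (fun u => Z u 0 j) u)) *: hff i j u
  + (Y u 0 i * Z u 0 j) *:
    (X u 0 0 *: pd 0 (hff i j) u + X u 0 1 *: pd 1 (hff i j) u).
  rewrite (derive_scale (dyz i j) (dh i j)) (derive_pd _ (dh i j)).
  by rewrite (derive_mul _ (dy i) (dz j)) (derive_pd _ (dy i)) (derive_pd _ (dz j)).
have DE : 'D_(X u) (second_ff F Y Z) u =
    'D_(X u) (fun u => (Y u 0 0 * Z u 0 0) *: hff 0 0 u) u
  + 'D_(X u) (fun u => (Y u 0 0 * Z u 0 1) *: hff 0 1 u) u
  + ('D_(X u) (fun u => (Y u 0 1 * Z u 0 0) *: hff 1 0 u) u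
  + 'D_(X u) (fun u => (Y u 0 1 * Z u 0 1) *: hff 1 1 u) u).
  have sE u' (Uu' : U u') := second_ffE Y Uu' (dZ u' Uu').
  apply: (etrans (derive_eq_on immF _ Uu sE)).
  apply: (etrans (derive_add _ (differentiable_add (dt 0 0) (dt 0 1))
    (differentiable_add (dt 1 0) (dt 1 1)))).
  exact: (f_equal2 +%R (derive_add _ (dt 0 0) (dt 0 1))
    (derive_add _ (dt 1 0) (dt 1 1))).
rewrite /nabla_perp normal_partE -/(normal_proj u ('D_(X u) (second_ff F Y Z) u)).
rewrite DE (tE 0 0) (tE 0 1) (tE 1 0) (tE 1 1).
rewrite (second_ffE _ Uu (dZ _ Uu)).
rewrite (second_ffE _ Uu (differentiable_nabla sX sZ Uu)).
rewrite (nablaE X 0 (dY _ Uu)) (nablaE X 1 (dY _ Uu)).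
rewrite (nablaE X 0 (dZ _ Uu)) (nablaE X 1 (dZ _ Uu)).
exact: (@tensor_algebra (normal_proj u) (X u 0) (Y u 0) (Z u 0)
  (fun k i => pd k (fun u => Y u 0 i) u) (fun k i => pd k (fun u => Z u 0 i) u)
  (fun k i j => Gam F k i j u) (fun i j => hff i j u)
  (fun k i j => pd k (hff i j) u) (normal_projD u) (normal_projZ u)
  (fun i j => normal_proj_hff i j Uu)).
Qed.

End SecondFundamentalForm.

(** * The Codazzi equation and Lagrangian immersions *)

Section Codazzi.
Context {R : realType}.
Local Notation R31 := 'rV[R]_3.
Local Notation E := (R31 * R31)%type.
Local Notation plane := 'rV[R]_2.

Variables (U : set plane) (F : plane -> E).
Hypothesis immF : is_immersion U F.

Local Notation F1 i := (pd i F).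
Local Notation F2 i j := (pd i (pd j F)).
Local Notation F3 k i j := (pd k (pd i (pd j F))).

(** As [nabla_hff] is tensorial, constant vector fields detect its components. *)
Lemma parallel_nabla_hff :
  (forall X Y Z, smooth_on U X -> smooth_on U Y -> smooth_on U Z ->
    forall u, U u -> nabla_second_ff F X Y Z u = 0) <->
  (forall k i j u, U u -> nabla_hff F k i j u = 0).
Proof.
split=> [H k i j u Uu|H X Y Z sX sY sZ u Uu].
  have s l : smooth_on U (fun _ : plane => @coord_vec R l) by exact: smooth_cst.
  have := H _ _ _ (s k) (s i) (s j) u Uu.
  rewrite (nabla_second_ffE immF (s k) (s i) (s j) Uu) !sum_ord2 !mxE /=.
  case: (ord2P k) => ->; case: (ord2P i) => ->; case: (ord2P j) => -> /=;
    by rewrite !(mulr0, mul0r, mulr1, scale0r, scale1r, addr0, add0r).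
rewrite (nabla_second_ffE immF sX sY sZ Uu) big1 // => k _; rewrite big1 // => i _.
by rewrite big1 // => j _; rewrite H // scaler0.
Qed.

Lemma gE_hff i j u N : U u -> HH_tangent (F u) N ->
  (forall l, gE N (F1 l u) = 0) -> gE (hff F i j u) N = gE (F2 i j u) N.
Proof. by move=> Uu Nt No; rewrite hff_def normal_proj_normal. Qed.

(** Differentiate the Gauss formula; the terms that are tangent to the surface or
   along the position vector do not contribute. *)
Lemma nabla_hff_pairing k i j u N : U u -> HH_tangent (F u) N ->
  (forall l, gE N (F1 l u) = 0) ->
  gE (nabla_hff F k i j u) N = gE (F3 k i j u) N
  - (lorentz (F1 i u).1 (F1 j u).1 * lorentz (F1 k u).1 N.1
   + lorentz (F1 i u).2 (F1 j u).2 * lorentz (F1 k u).2 N.2)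
  - (Gam F 0 i j u * gE (F2 k 0 u) N + Gam F 1 i j u * gE (F2 k 1 u) N)
  - (Gam F 0 k i u * gE (F2 0 j u) N + Gam F 1 k i u * gE (F2 1 j u) N)
  - (Gam F 0 k j u * gE (F2 i 0 u) N + Gam F 1 k j u * gE (F2 i 1 u) N).
Proof.
move=> Uu Nt No; have d0 := dF immF Uu; have d1 l := dF1 immF l Uu.
have [N1 N2] := Nt.
pose s1 u := lorentz (F1 i u).1 (F1 j u).1.
pose s2 u := lorentz (F1 i u).2 (F1 j u).2.
have ds1 : differentiable s1 u.
  by apply: differentiable_lorentz; exact: differentiable_fst.
have ds2 : differentiable s2 u.
  by apply: differentiable_lorentz; exact: differentiable_snd.
have dG l := differentiable_Gam immF l i j Uu.
have dp1 := differentiable_scale ds1 (differentiable_fst d0).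
have dp2 := differentiable_scale ds2 (differentiable_snd d0).
have dp := differentiable_pair dp1 dp2.
have dg l := differentiable_scale (dG l) (d1 l).
have Dh : pd k (hff F i j) u = F3 k i j u
  - (pd k s1 u *: (F u).1 + s1 u *: (F1 k u).1,
     pd k s2 u *: (F u).2 + s2 u *: (F1 k u).2)
  - (pd k (Gam F 0 i j) u *: F1 0 u + Gam F 0 i j u *: F2 k 0 u
   + (pd k (Gam F 1 i j) u *: F1 1 u + Gam F 1 i j u *: F2 k 1 u)).
  have hE u' (Uu' : U u') := hffE immF i j Uu'.
  apply: (etrans (pd_eq_on immF k Uu hE)).
  apply: (etrans (pd_sub k (differentiable_sub (dF2 immF i j Uu) dp)
    (differentiable_add (dg 0) (dg 1)))).
  apply: (f_equal2 (fun x y => x - y)).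
    apply: (etrans (pd_sub k (dF2 immF i j Uu) dp)); congr (_ - _).
    apply: (etrans (pd_pair k dp1 dp2)); apply: (f_equal2 pair).
      rewrite -(pd_fst k d0).
      exact: (pd_scale k ds1 (differentiable_fst d0)).
    rewrite -(pd_snd k d0).
    exact: (pd_scale k ds2 (differentiable_snd d0)).
  apply: (etrans (pd_add k (dg 0) (dg 1))).
  exact: (f_equal2 +%R (pd_scale k (dG 0) (d1 0)) (pd_scale k (dG 1) (d1 1))).
have NF l : gE (F1 l u) N = 0 by rewrite gEC No.
have := normal_proj_normal (pd k (hff F i j) u) Nt No; rewrite /nabla_hff Dh.
move: (normal_proj F u _) => q qN.
rewrite !(gEDl, gENl, gEZl) qN !(gE_hff _ _ Uu Nt No) !(gEDl, gENl, gEZl) !NF.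
have -> : gE (pd k s1 u *: (F u).1 + s1 u *: (F1 k u).1,
     pd k s2 u *: (F u).2 + s2 u *: (F1 k u).2) N =
   s1 u * lorentz (F1 k u).1 N.1 + s2 u * lorentz (F1 k u).2 N.2.
  rewrite /gE /= !(lorentzDl, lorentzZl) (lorentzC (F u).1) (lorentzC (F u).2).
  by rewrite N1 N2 !mulr0 !add0r.
by rewrite /s1 /s2; ring.
Qed.

(** Exchanging [k] and [i] in [nabla_hff_pairing] changes only the terms that come
   from the curvature of the hyperbolic planes. *)
Lemma codazzi i k j u N : U u -> HH_tangent (F u) N ->
  (forall l, gE N (F1 l u) = 0) -> nabla_hff F k i j u = 0 ->
  nabla_hff F i k j u = 0 ->
  lorentz (F1 i u).1 (F1 j u).1 * lorentz (F1 k u).1 N.1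
  + lorentz (F1 i u).2 (F1 j u).2 * lorentz (F1 k u).2 N.2 =
  lorentz (F1 k u).1 (F1 j u).1 * lorentz (F1 i u).1 N.1
  + lorentz (F1 k u).2 (F1 j u).2 * lorentz (F1 i u).2 N.2.
Proof.
move=> Uu Nt No h1 h2.
have e1 := nabla_hff_pairing k i j Uu Nt No.
have e2 := nabla_hff_pairing i k j Uu Nt No.
rewrite h1 gE0l in e1; rewrite h2 gE0l in e2.
rewrite (F3C immF i k j Uu) (GamC F 0 i k) (GamC F 1 i k) in e2.
have alg (t a b x y z : R) : 0 = t - a - x - y - z -> 0 = t - b - z - y - x -> a = b.
  by clear; lra.
exact: (alg _ _ _ _ _ _ e1 e2).
Qed.

(** ** Lagrangian immersions *)

Definition is_lagrangian := forall u v w, U u ->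
  gE (J_HH (F u) ('D_v F u)) ('D_w F u) = 0.

(** The oriented areas of the projections of the coordinate parallelogram to the
   two tangent planes. *)
Definition area1 u := det3 (F u).1 (F1 0 u).1 (F1 1 u).1.
Definition area2 u := det3 (F u).2 (F1 0 u).2 (F1 1 u).2.

Hypothesis lagF : is_lagrangian.

Lemma lagrangian_det3 i j u : U u ->
  det3 (F u).1 (F1 i u).1 (F1 j u).1 = det3 (F u).2 (F1 i u).2 (F1 j u).2.
Proof.
move=> Uu; have := lagF (coord_vec i) (coord_vec j) Uu.
have pu l : 'D_(coord_vec l) F u = F1 l u by rewrite pdE.
rewrite !pu.
by rewrite /gE /J_HH /= !J_hypE lorentzNl => /eqP; rewrite subr_eq0 => /eqP.
Qed.

Lemma area_eq u : U u -> area1 u = area2 u.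
Proof. exact: lagrangian_det3. Qed.

(** The normal fields [J F1 l] are orthogonal to the surface; the Codazzi
   equation against them compares the metrics pulled back by the two factors. *)
Lemma lagrangian_codazzi j l u : U u ->
  (forall k i j, nabla_hff F k i j u = 0) ->
  area1 u * lorentz (F1 l u).1 (F1 j u).1 =
  area1 u * lorentz (F1 l u).2 (F1 j u).2.
Proof.
move=> Uu h.
pose N : E := (lcross (F u).1 (F1 l u).1, - lcross (F u).2 (F1 l u).2).
have Nt : HH_tangent (F u) N.
  by split; rewrite /= ?lorentzNl lcross_orthl ?oppr0.
have No m : gE N (F1 m u) = 0.
  rewrite /gE /= lorentzNl; apply/eqP; rewrite subr_eq0; apply/eqP.
  exact: lagrangian_det3.
have H := @codazzi 1 0 j u N Uu Nt No (h 0 1 j) (h 1 0 j); rewrite /= in H.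
have sw (a b c : R31) : lorentz a (lcross b c) = det3 b c a by rewrite lorentzC.
rewrite !lorentzNr !sw in H; have Ae := area_eq Uu.
have z (b c : R31) : det3 b c c = 0 by rewrite /det3 lcross_orthr.
have a1 : det3 (F u).1 (F1 0 u).1 (F1 1 u).1 = area1 u by [].
have a2 : det3 (F u).2 (F1 0 u).2 (F1 1 u).2 = area1 u by rewrite Ae.
clear N Nt No; case: (ord2P l) H => ->; rewrite !z.
  by rewrite a1 a2 oppr0 !mulr0 !add0r; lra.
rewrite (det3_swap (F u).1 (F1 0 u).1) (det3_swap (F u).2 (F1 0 u).2) a1 a2.
by lra.
Qed.

End Codazzi.

(** [fac true] and [fac false] are the two projections of the product, so that
   statements about either component can be made once. *)
Section Factor.
Context {R : realType}.
Local Notation R31 := 'rV[R]_3.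
Local Notation E := (R31 * R31)%type.
Local Notation plane := 'rV[R]_2.

Definition fac (b : bool) (p : E) : R31 := if b then p.1 else p.2.
Definition inj_fac (b : bool) (v : R31) : E := if b then (v, 0) else (0, v).

Lemma gE_inj_fac b p v : gE p (inj_fac b v) = lorentz (fac b p) v.
Proof. by case: b; rewrite /gE /= lorentz0r ?addr0 ?add0r. Qed.

Lemma facD b p q : fac b (p + q) = fac b p + fac b q.
Proof. by case: b. Qed.

Lemma facZ b k p : fac b (k *: p) = k *: fac b p.
Proof. by case: b. Qed.

Lemma differentiable_factor (V : normedModType R) b (F : V -> E) u : differentiable F u ->
  differentiable (fun u => fac b (F u)) u.
Proof. by case: b; [exact: differentiable_fst|exact: differentiable_snd]. Qed.

Lemma pd_factor b (F : plane -> E) i u : differentiable F u ->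
  pd i (fun u => fac b (F u)) u = fac b (pd i F u).
Proof. by case: b; [exact: pd_fst|exact: pd_snd]. Qed.

Variables (U : set plane) (F : plane -> E) (b : bool).
Variables (n : plane -> R31) (kappa : plane -> R).
Hypothesis immF : is_immersion U F.

Local Notation F1 i := (pd i F).
Local Notation F2 i j := (pd i (pd j F)).
Local Notation f1 i u := (fac b (pd i F u)).
Local Notation f2 i j u := (fac b (pd i (pd j F) u)).

Hypothesis dn : forall u, U u -> differentiable n u.
Hypothesis dk : forall u, U u -> differentiable kappa u.
Hypothesis n_position : forall u, U u -> lorentz (n u) (fac b (F u)) = 0.
Hypothesis n_orth : forall l u, U u -> lorentz (n u) (f1 l u) = 0.
Hypothesis pd_n : forall l u, U u -> pd l n u = - kappa u *: f1 l u.
Hypothesis splitF : forall k u, U u ->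
  exists v, 'D_v F u = inj_fac b (f1 k u).

(** When the tangent planes split and [n], with shape operator [kappa], is
   normal to the curve traced in one factor, the covariant derivative of the
   second fundamental form in the direction [n] is the derivative of [kappa]. *)
Lemma nabla_hff_factor k i j u : U u ->
  gE (nabla_hff F k i j u) (inj_fac b (n u)) =
  pd k kappa u * lorentz (f1 i u) (f1 j u).
Proof.
move=> Uu; have d1 u' l := fun Uu' : U u' => dF1 immF l Uu'.
have d2 i' j' := dF2 immF i' j' Uu.
have e2 i' j' u' : U u' -> lorentz (n u') (f2 i' j' u') =
    kappa u' * lorentz (f1 i' u') (f1 j' u').
  move=> Uu'.
  have : pd i' (fun u => lorentz (n u) (f1 j' u)) u' = 0.
    rewrite -(pd_cst (0 : R) i' u'); apply: (pd_eq_on immF _ Uu') => w Uw.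
    exact: n_orth.
  rewrite (pd_lorentz i' (dn Uu') (differentiable_factor b (d1 _ j' Uu'))).
  rewrite (pd_factor b i' (d1 _ j' Uu')) pd_n // lorentzZl.
  by move: (lorentz _ _) (lorentz _ _) => x y; lra.
have df1 l := differentiable_factor b (d1 _ l Uu).
have e3 : lorentz (n u) (fac b (pd k (pd i (pd j F)) u)) =
    pd k kappa u * lorentz (f1 i u) (f1 j u)
    + kappa u * (lorentz (f2 k i u) (f1 j u) + lorentz (f1 i u) (f2 k j u)
      + lorentz (f1 k u) (f2 i j u)).
  have := pd_eq_on immF k Uu (fun u' Uu' => e2 i j u' Uu').
  rewrite (pd_lorentz k (dn Uu) (differentiable_factor b (d2 i j))).
  rewrite (pd_factor b k (d2 i j)) pd_n // lorentzZl.
  rewrite (pd_mul k (dk Uu) (differentiable_lorentz (df1 i) (df1 j))).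
  rewrite (pd_lorentz k (df1 i) (df1 j)).
  rewrite (pd_factor b k (d1 _ i Uu)) (pd_factor b k (d1 _ j Uu)).
  move: (lorentz _ _) (lorentz _ _) (lorentz _ _) (lorentz _ _) (lorentz _ _).
  by move=> x1 x2 x3 x4 x5; lra.
have Nt : HH_tangent (F u) (inj_fac b (n u)).
  by have := n_position Uu; rewrite /HH_tangent; case: b => /= h; split;
    rewrite //= lorentz0l.
have No l : gE (inj_fac b (n u)) (F1 l u) = 0.
  by rewrite gEC gE_inj_fac lorentzC n_orth.
have G i' j' l : Gam F 0 i' j' u * lorentz (f1 0 u) (f1 l u)
    + Gam F 1 i' j' u * lorentz (f1 1 u) (f1 l u) = lorentz (f2 i' j' u) (f1 l u).
  have [v vE] := splitF l Uu.
  rewrite -!gE_inj_fac -vE (derive_pd _ (dF immF Uu)) !(gEDr, gEZr).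
  rewrite -!(Gam_gram immF) // !sum_ord2; ring.
rewrite (nabla_hff_pairing immF k i j Uu Nt No) !gE_inj_fac.
rewrite !(lorentzC _ (n u)) e3 !e2 //.
have -> : lorentz (F1 i u).1 (F1 j u).1 * lorentz (F1 k u).1 (inj_fac b (n u)).1
  + lorentz (F1 i u).2 (F1 j u).2 * lorentz (F1 k u).2 (inj_fac b (n u)).2 = 0.
  have := n_orth k Uu; case: b => /= h; rewrite lorentz0r (lorentzC _ (n u)) h.
    by rewrite !mulr0 addr0.
  by rewrite !mulr0 addr0.
have G' i' j' l : Gam F 0 i' j' u * lorentz (f1 l u) (f1 0 u)
    + Gam F 1 i' j' u * lorentz (f1 l u) (f1 1 u) = lorentz (f1 l u) (f2 i' j' u).
  by rewrite !(lorentzC (f1 l u)) G.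
rewrite -(G' i j k) -(G' k j i) -(G k i j).
by ring.
Qed.

End Factor.

(** * Components related by an isometry *)

Section ProperIsometry.
Context {R : realType}.
Local Notation R31 := 'rV[R]_3.
Implicit Types (x y z : R31) (B : 'M[R]_3).

(** Linear maps of [R^3_1] that restrict to orientation preserving isometries
   of the hyperbolic plane. *)
Record proper_isometry B : Prop := ProperIsometry {
  iso_lorentz : forall x y, lorentz (x *m B) (y *m B) = lorentz x y;
  iso_lcross : forall x y, lcross (x *m B) (y *m B) = lcross x y *m B;
  iso_hyp : forall x, hyp (-1) x -> hyp (-1) (x *m B) }.

Lemma proper_isometry1 : proper_isometry 1%:M.
Proof. by split=> [x y|x y|x]; rewrite !mulmx1. Qed.

Lemma isometry_unit B :
  (forall x y, lorentz (x *m B) (y *m B) = lorentz x y) -> B \in unitmx.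
Proof.
move=> iB; rewrite unitmxE unitfE; apply/negP => /det0P[v v0 vB].
have vy y : lorentz v y = 0 by rewrite -iB vB lorentz0l.
have h0 := vy (delta_mx 0 0); have h1 := vy (delta_mx 0 1).
have h2 := vy (delta_mx 0 2); rewrite /lorentz !mxE /= in h0 h1 h2.
move/eqP: v0; apply.
by apply: row3P; rewrite mxE; [move: h0|move: h1|move: h2]; clear; lra.
Qed.

Lemma sum_ord3 (W : nmodType) (f : 'I_3 -> W) : \sum_(i < 3) f i = f 0 + f 1 + f 2.
Proof.
rewrite !big_ord_recl big_ord0 addr0 addrA; congr (_ + f _ + f _); exact: val_inj.
Qed.

Lemma mulmx_row3 x B j : (x *m B) 0 j = x 0 0 * B 0 j + x 0 1 * B 1 j + x 0 2 * B 2 j.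
Proof. by rewrite mxE sum_ord3. Qed.

(** The coefficient on the right is, up to sign, the determinant of [B]. *)
Lemma det3_mulmx x y z B : det3 (x *m B) (y *m B) (z *m B) =
  det3 (row 0 B) (row 1 B) (row 2 B) * det3 x y z.
Proof.
rewrite /det3 /lorentz !lcrossE !mulmx_row3 !mxE; ring.
Qed.

(** On the other sheet of the hyperboloid the product with [y] is at least [1]. *)
Lemma hyp_opp x y : hyp (-1) y -> lorentz x x = -1 -> lorentz x y <= -1 -> hyp (-1) x.
Proof.
move=> yH xx xy; split; first by rewrite xx invrN invr1.
have [x0|x0|x0] := ltgtP 0 (x 0 0) => //.
- have xN : hyp (-1) (- x).
    split; first by rewrite lorentzNl lorentzNr opprK xx invrN invr1.
    by rewrite mxE oppr_gt0.
  by have := hyp_lorentz_le xN yH; rewrite lorentzNl; move: xy; lra.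
- have := xx; rewrite /lorentz -x0 mul0r oppr0 add0r.
  have := sqr_ge0 (x 0 1); have := sqr_ge0 (x 0 2); rewrite !expr2.
  by move: (x 0 1 * _) (x 0 2 * _) => p q; lra.
Qed.

(** A linear isometry that carries one point and one oriented frame of the
   hyperboloid to another preserves the sheet and the orientation everywhere. *)
Lemma proper_isometry_frame B x x0 x1 y : hyp (-1) x -> hyp (-1) y ->
  (forall x y, lorentz (x *m B) (y *m B) = lorentz x y) -> x *m B = y ->
  det3 x x0 x1 != 0 -> det3 y (x0 *m B) (x1 *m B) = det3 x x0 x1 ->
  proper_isometry B.
Proof.
move=> xH yH iB xB D0 DB.
have D1 : det3 (row 0 B) (row 1 B) (row 2 B) = 1.
  by move: DB; rewrite -xB det3_mulmx => /(canRL (mulfK D0)); rewrite divff.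
have dB a b c : det3 (a *m B) (b *m B) (c *m B) = det3 a b c.
  by rewrite det3_mulmx D1 mul1r.
split=> // [a b|a aH].
  have := iB; have z c : lorentz (lcross (a *m B) (b *m B) - lcross a b *m B) (c *m B) = 0.
    by rewrite lorentzDl lorentzNl iB -/(det3 _ _ _) dB subrr.
  move=> _; apply/eqP; rewrite -subr_eq0; apply/eqP.
  have D2 : det3 (x *m B) (x0 *m B) (x1 *m B) != 0 by rewrite dB.
  exact: (lorentz_nondegenerate D2 (z _) (z _) (z _)).
apply: (hyp_opp yH); first by rewrite iB; case: (hypm1P aH).
by rewrite -xB iB hyp_lorentz_le.
Qed.

Lemma proper_isometry_inv B x : proper_isometry B -> hyp (-1) x ->
  hyp (-1) (x *m invmx B).
Proof.
move=> iB xH; have uB := isometry_unit (iso_lorentz iB).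
have [xx x0] := hypm1P xH.
have yy : lorentz (x *m invmx B) (x *m invmx B) = -1.
  by rewrite -(iso_lorentz iB) mulmxKV.
have y0 : (x *m invmx B) 0 0 != 0.
  apply/eqP => y0; have := yy; rewrite /lorentz y0 mul0r oppr0 add0r.
  set p := _ 0 1; set q := _ 0 2; have := sqr_ge0 p; have := sqr_ge0 q.
  by rewrite !expr2; lra.
split; first by rewrite yy invrN invr1.
rewrite lt_def y0 /= leNgt; apply/negP => yn.
have yN : hyp (-1) (- (x *m invmx B)).
  split; first by rewrite lorentzNl lorentzNr opprK yy invrN invr1.
  by rewrite mxE oppr_gt0.
have [_] := hypm1P (iso_hyp iB yN).
by rewrite mulNmx mulmxKV // mxE oppr_gt0; move: x0; lra.
Qed.

End ProperIsometry.

Section ConstantOnBall.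
Context {R : realType}.
Local Notation plane := 'rV[R]_2.

Lemma pd0_ball_cst (f : plane -> R) x r :
  (forall y, ball x r y -> differentiable f y) ->
  (forall y k, ball x r y -> pd k f y = 0) ->
  forall y, ball x r y -> f y = f x.
Proof.
move=> df f0; apply: derive0_ball_cst => // y v xy.
by rewrite (derive_pd _ (df y xy)) !f0 // !scaler0 addr0.
Qed.

Lemma pd0_ball_cst_row n (f : plane -> 'rV[R]_n) x r :
  (forall y, ball x r y -> differentiable f y) ->
  (forall y k, ball x r y -> pd k f y = 0) ->
  forall y, ball x r y -> f y = f x.
Proof.
move=> df f0 y xy; apply/rowP => i.
apply: (@pd0_ball_cst (fun y => f y 0 i) x r) => // z => [|k] xz.
  by apply: differentiable_entry; exact: df.
have := congr1 (fun v : 'rV[R]_n => v 0 i) (f0 z k xz).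
by rewrite /= pdE derive_entry ?pdE ?mxE //; exact: df.
Qed.

End ConstantOnBall.

(** When both factors induce the same metric, the second factor is the image of
   the first under a fixed isometry: the linear map that carries the frame of
   one factor to the frame of the other has zero derivative, because the frames
   satisfy the same structure equations. *)
Section ConformalFactors.
Context {R : realType}.
Local Notation R31 := 'rV[R]_3.
Local Notation E := (R31 * R31)%type.
Local Notation plane := 'rV[R]_2.

Variables (u0 : plane) (r : R) (F : plane -> E).
Hypothesis r0 : 0 < r.
Local Notation U := (ball u0 r).
Hypothesis immF : is_immersion U F.

Local Notation F1 i := (pd i F).
Local Notation F2 i j := (pd i (pd j F)).

Hypothesis conf : forall i j u, U u ->
  lorentz (F1 i u).1 (F1 j u).1 = lorentz (F1 i u).2 (F1 j u).2.
Hypothesis area_neq0 : forall u, U u -> area1 F u != 0.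
Hypothesis areaE : forall u, U u -> area1 F u = area2 F u.

(** Both components have the same metric, hence the same tangential second
   derivatives, by the Koszul formula. *)
Lemma conformal_second i j l u : U u ->
  lorentz (F2 i j u).1 (F1 l u).1 = lorentz (F2 i j u).2 (F1 l u).2.
Proof.
move=> Uu; have d1 k := dF1 immF k Uu.
have S i' j' l' : lorentz (F2 i' j' u).1 (F1 l' u).1 + lorentz (F1 j' u).1 (F2 i' l' u).1
   = lorentz (F2 i' j' u).2 (F1 l' u).2 + lorentz (F1 j' u).2 (F2 i' l' u).2.
  have := pd_eq_on immF i' Uu (fun u' Uu' => @conf j' l' u' Uu').
  rewrite (pd_lorentz i' (differentiable_fst (d1 j')) (differentiable_fst (d1 l'))).
  rewrite (pd_lorentz i' (differentiable_snd (d1 j')) (differentiable_snd (d1 l'))).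
  by rewrite !(pd_fst i' (d1 _)) !(pd_snd i' (d1 _)).
have s1 := S i j l; have s2 := S j i l; have s3 := S l i j.
rewrite (F2C immF j i Uu) in s2; rewrite (F2C immF l i Uu) (F2C immF l j Uu) in s3.
rewrite (lorentzC (F1 j u).1) (lorentzC (F1 j u).2) in s1.
rewrite (lorentzC (F1 i u).1 (F2 j l u).1) (lorentzC (F1 i u).2 (F2 j l u).2) in s2 s3.
by move: s1 s2 s3; clear;
  move: (lorentz _ _) (lorentz _ _) (lorentz _ _) (lorentz _ _) (lorentz _ _)
    (lorentz _ _) => a b c d e f; lra.
Qed.

Lemma gE_conformal i j u : U u ->
  gE (F1 i u) (F1 j u) = 2 * lorentz (F1 i u).1 (F1 j u).1.
Proof. by move=> Uu; rewrite /gE -conf //; ring. Qed.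

(** The structure equations of the frame of a component; [area_neq0] makes it a
   frame.  Since the induced metric is twice that of either component, its
   Christoffel symbols are also those of the components. *)
Lemma conformal_frame b i j u : U u -> fac b (F2 i j u) =
  lorentz (F1 i u).1 (F1 j u).1 *: fac b (F u)
  + (Gam F 0 i j u *: fac b (F1 0 u) + Gam F 1 i j u *: fac b (F1 1 u)).
Proof.
move=> Uu.
have [/hypm1P[h1 _] /hypm1P[h2 _]] := imm_HH immF Uu.
have FF : lorentz (fac b (F u)) (fac b (F u)) = -1 by case: (b).
have T k : lorentz (fac b (F1 k u)) (fac b (F u)) = 0.
  by have [t1 t2] := F1_tangent immF k Uu; case: (b).
have P : lorentz (fac b (F2 i j u)) (fac b (F u)) = - lorentz (F1 i u).1 (F1 j u).1.
  have [t1 t2] := F2_position immF i j Uu; case: (b) => /=; first by [].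
  by rewrite t2 conf.
have gb k l : 2 * lorentz (fac b (F1 k u)) (fac b (F1 l u)) = gE (F1 k u) (F1 l u).
  by rewrite gE_conformal //; case: (b) => //=; rewrite conf.
have gb2 l : 2 * lorentz (fac b (F2 i j u)) (fac b (F1 l u)) =
    gE (F2 i j u) (F1 l u).
  by rewrite /gE; case: (b) => /=; rewrite (conformal_second i j l Uu); ring.
have D : det3 (fac b (F u)) (fac b (F1 0 u)) (fac b (F1 1 u)) != 0.
  by have := area_neq0 Uu; case: (b) => //=; rewrite areaE.
apply/eqP; rewrite -subr_eq0; apply/eqP.
have L l : lorentz (fac b (F2 i j u)
  - (lorentz (F1 i u).1 (F1 j u).1 *: fac b (F u)
  + (Gam F 0 i j u *: fac b (F1 0 u) + Gam F 1 i j u *: fac b (F1 1 u))))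
   (fac b (F1 l u)) = 0.
  rewrite !(lorentzDl, lorentzNl, lorentzZl) (lorentzC (fac b (F u))) T.
  have := Gam_gram immF i j l Uu; rewrite sum_ord2 -!gb -gb2.
  by move: (lorentz _ _) (lorentz _ _) (lorentz _ _) => a c d; lra.
apply: (lorentz_nondegenerate D _ (L _) (L _)).
by rewrite !(lorentzDl, lorentzNl, lorentzZl) !T FF P; ring.
Qed.

(** The linear map carrying the frame of the first factor at [u] to that of the
   second; [2 * ginv] is the inverse of the metric of either factor. *)
Definition frame_map (x : R31) (u : plane) : R31 :=
  - lorentz x (F u).1 *: (F u).2
  + (2 * (ginv F 0 0 u * lorentz x (F1 0 u).1 + ginv F 1 0 u * lorentz x (F1 1 u).1))
      *: (F1 0 u).2
  + (2 * (ginv F 0 1 u * lorentz x (F1 0 u).1 + ginv F 1 1 u * lorentz x (F1 1 u).1))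
      *: (F1 1 u).2.

Lemma tangent_facs l u : U u -> lorentz (F1 l u).1 (F u).1 = 0 /\
  lorentz (F1 l u).2 (F u).2 = 0.
Proof. by move=> Uu; exact: (F1_tangent immF l Uu). Qed.

Lemma det_neq0 u : U u -> det3 (F u).1 (F1 0 u).1 (F1 1 u).1 != 0 /\
  det3 (F u).2 (F1 0 u).2 (F1 1 u).2 != 0.
Proof.
move=> Uu; have D := area_neq0 Uu; split; first exact: D.
by move: D; rewrite areaE.
Qed.

Lemma ginv_conformal j l u : U u ->
  2 * (ginv F 0 j u * lorentz (F1 l u).2 (F1 0 u).2
     + ginv F 1 j u * lorentz (F1 l u).2 (F1 1 u).2) = (j == l)%:R.
Proof.
move=> Uu; rewrite -(ginv_gramC immF j l Uu) !gE_conformal // !conf //.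
by ring.
Qed.

Lemma frame_map_position x u : U u ->
  lorentz (frame_map x u) (F u).2 = lorentz x (F u).1.
Proof.
move=> Uu; have [_ /hypm1P[h2 _]] := imm_HH immF Uu.
have T l := proj2 (tangent_facs l Uu).
by rewrite /frame_map !(lorentzDl, lorentzZl) !T h2; ring.
Qed.

Lemma frame_map_tangent x l u : U u ->
  lorentz (frame_map x u) (F1 l u).2 = lorentz x (F1 l u).1.
Proof.
move=> Uu; have T m := proj2 (tangent_facs m Uu).
rewrite /frame_map !(lorentzDl, lorentzZl) (lorentzC (F u).2) T.
transitivity (lorentz x (F1 0 u).1 *
   (2 * (ginv F 0 0 u * lorentz (F1 l u).2 (F1 0 u).2
     + ginv F 1 0 u * lorentz (F1 l u).2 (F1 1 u).2))
  + lorentz x (F1 1 u).1 *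
   (2 * (ginv F 0 1 u * lorentz (F1 l u).2 (F1 0 u).2
     + ginv F 1 1 u * lorentz (F1 l u).2 (F1 1 u).2))).
  by rewrite !(lorentzC (F1 l u).2) (ginvC F 1 0); ring.
by rewrite !ginv_conformal //; case: (ord2P l) => -> /=; ring.
Qed.

Lemma differentiable_frame_map x u : U u -> differentiable (frame_map x) u.
Proof.
move=> Uu; have d0 := dF immF Uu; have d1 l := dF1 immF l Uu.
have dc (c : R31) := differentiable_cst c u.
have dx l : differentiable (fun u => lorentz x (F1 l u).1) u.
  by apply: differentiable_lorentz (dc x) _; exact: differentiable_fst.
have dg i j := differentiable_ginv immF i j Uu.
have d2 i : differentiable (fun u => 2 * (ginv F 0 i u * lorentz x (F1 0 u).1
    + ginv F 1 i u * lorentz x (F1 1 u).1)) u.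
  apply: differentiable_mul; first exact: differentiable_cst.
  by apply: differentiable_add; exact: differentiable_mul.
apply: differentiable_add; [apply: differentiable_add|];
  apply: differentiable_scale => //; try exact: differentiable_snd.
apply: differentiable_opp; apply: differentiable_lorentz (dc x) _.
exact: differentiable_fst.
Qed.

Lemma pd_frame_map x k u : U u -> pd k (frame_map x) u = 0.
Proof.
move=> Uu; have d0 := dF immF Uu; have d1 l := dF1 immF l Uu.
have dm := differentiable_frame_map x Uu.
have dc := differentiable_cst x u.
have [_ D] := det_neq0 Uu.
have P : lorentz (pd k (frame_map x) u) (F u).2 = 0.
  have := pd_eq_on immF k Uu (@frame_map_position x).
  rewrite (pd_lorentz k dm (differentiable_snd d0)).
  rewrite (pd_lorentz k dc (differentiable_fst d0)) pd_cst lorentz0l add0r.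
  rewrite (pd_fst k d0) (pd_snd k d0) frame_map_tangent //.
  by move: (lorentz _ _) (lorentz _ _) => p q; lra.
have T l : lorentz (pd k (frame_map x) u) (F1 l u).2 = 0.
  have := pd_eq_on immF k Uu (fun u' => @frame_map_tangent x l u').
  rewrite (pd_lorentz k dm (differentiable_snd (d1 l))).
  rewrite (pd_lorentz k dc (differentiable_fst (d1 l))) pd_cst lorentz0l add0r.
  rewrite (pd_fst k (d1 l)) (pd_snd k (d1 l)).
  have e1 := conformal_frame true k l Uu; have e2 := conformal_frame false k l Uu.
  rewrite /= in e1 e2; rewrite e1 e2 !(lorentzDr, lorentzZr).
  rewrite frame_map_position // !frame_map_tangent //.
  by move: (lorentz (pd _ _ _) _) => p; lra.
exact: (lorentz_nondegenerate D P (T 0) (T 1)).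
Qed.

Lemma frame_map_cst x u : U u -> frame_map x u = frame_map x u0.
Proof.
apply: pd0_ball_cst_row => [u'|u' k]; first exact: differentiable_frame_map.
exact: pd_frame_map.
Qed.

Lemma frame_mapP u (x y : R31) : U u -> lorentz y (F u).2 = lorentz x (F u).1 ->
  (forall l, lorentz y (F1 l u).2 = lorentz x (F1 l u).1) -> frame_map x u = y.
Proof.
move=> Uu h0 h1; have [_ D] := det_neq0 Uu.
apply/eqP; rewrite -subr_eq0; apply/eqP.
by apply: (lorentz_nondegenerate D); rewrite lorentzDl lorentzNl
  ?frame_map_position ?frame_map_tangent // ?h0 ?h1 subrr.
Qed.

Lemma frame_map_F u : U u -> frame_map (F u).1 u = (F u).2.
Proof.
move=> Uu; have [/hypm1P[h1 _] /hypm1P[h2 _]] := imm_HH immF Uu.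
apply: frame_mapP => // [|l]; first by rewrite h1 h2.
have [t1 t2] := tangent_facs l Uu.
by rewrite (lorentzC (F u).1) (lorentzC (F u).2) t1 t2.
Qed.

Lemma frame_map_F1 l u : U u -> frame_map (F1 l u).1 u = (F1 l u).2.
Proof.
move=> Uu; apply: frame_mapP => // [|m]; last by rewrite conf.
by have [-> ->] := tangent_facs l Uu.
Qed.

Lemma frame_map_lorentz x y u : U u ->
  lorentz (frame_map x u) (frame_map y u) = lorentz x y.
Proof.
move=> Uu; have [D _] := det_neq0 Uu.
have [/hypm1P[h1 _] _] := imm_HH immF Uu.
have T l := proj1 (tangent_facs l Uu).
pose c i := 2 * (ginv F 0 i u * lorentz y (F1 0 u).1
  + ginv F 1 i u * lorentz y (F1 1 u).1).
have yE : y = - lorentz y (F u).1 *: (F u).1 + c 0 *: (F1 0 u).1 + c 1 *: (F1 1 u).1.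
  apply/eqP; rewrite -subr_eq0; apply/eqP.
  have L l : lorentz (y - (- lorentz y (F u).1 *: (F u).1 + c 0 *: (F1 0 u).1
      + c 1 *: (F1 1 u).1)) (F1 l u).1 = 0.
    rewrite !(lorentzDl, lorentzNl, lorentzZl) (lorentzC (F u).1) T.
    have e : c 0 * lorentz (F1 0 u).1 (F1 l u).1 + c 1 * lorentz (F1 1 u).1 (F1 l u).1
      = lorentz y (F1 l u).1.
      rewrite !conf // /c.
      transitivity (lorentz y (F1 0 u).1 *
         (2 * (ginv F 0 0 u * lorentz (F1 l u).2 (F1 0 u).2
           + ginv F 1 0 u * lorentz (F1 l u).2 (F1 1 u).2))
        + lorentz y (F1 1 u).1 *
         (2 * (ginv F 0 1 u * lorentz (F1 l u).2 (F1 0 u).2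
           + ginv F 1 1 u * lorentz (F1 l u).2 (F1 1 u).2))).
        by rewrite !(lorentzC (F1 l u).2) (ginvC F 1 0); ring.
      by rewrite !ginv_conformal //; case: (ord2P l) => -> /=; ring.
    by move: e; move: (c 0 * _) (c 1 * _) => p q; lra.
  apply: (lorentz_nondegenerate D _ (L 0) (L 1)).
  by rewrite !(lorentzDl, lorentzNl, lorentzZl) !T h1; ring.
rewrite [in RHS]yE {2}/frame_map !(lorentzDr, lorentzZr).
by rewrite frame_map_position // !frame_map_tangent.
Qed.

Lemma frame_map_linear u k x y :
  frame_map (k *: x + y) u = k *: frame_map x u + frame_map y u.
Proof.
rewrite /frame_map !lorentzDl !lorentzZl.
by apply/rowP => i; rewrite !mxE; ring.
Qed.

Lemma conformal_isometry : exists2 B, proper_isometry B &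
  forall u, U u -> (F u).1 *m B = (F u).2.
Proof.
have U0 : U u0 by exact: ballxx.
pose L : {linear R31 -> R31} := HB.pack (fun x => frame_map x u0)
  (GRing.isLinear.Build _ _ _ _ _ (fun k x y => frame_map_linear u0 k x y)).
exists (lin1_mx L); last first.
  by move=> u Uu; rewrite mul_rV_lin1 /= -(frame_map_cst _ Uu) frame_map_F.
have [h1 h2] := imm_HH immF U0; have [D _] := det_neq0 U0.
apply: (proper_isometry_frame h1 h2 _ _ D).
- by move=> x y; rewrite !mul_rV_lin1 /= frame_map_lorentz.
- by rewrite mul_rV_lin1 /= frame_map_F.
- rewrite !mul_rV_lin1 /= !frame_map_F1 //.
  exact: esym (areaE U0).
Qed.

End ConformalFactors.

(** * Immersions with tangent planes that split *)

Section Restriction.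
Context {R : realType}.
Local Notation plane := 'rV[R]_2.
Local Notation E := ('rV[R]_3 * 'rV[R]_3)%type.

Lemma smooth_on_sub (V W : normedModType R) (A B : set V) (f : V -> W) :
  B `<=` A -> smooth_on A f -> smooth_on B f.
Proof.
move=> BA sf k; move: (sf k); elim: k f {sf} => [|k IH] f /=.
  by move=> cf x /BA; exact: cf.
by move=> [df dk]; split=> [x /BA|v]; [exact: df|apply: IH].
Qed.

Lemma immersion_sub (A B : set plane) (F : plane -> E) : open B -> B `<=` A ->
  is_immersion A F -> is_immersion B F.
Proof.
move=> oB BA [oA sF hF iF]; split=> //.
- exact: smooth_on_sub sF.
- by move=> u /BA; exact: hF.
- by move=> u v /BA; exact: iF.
Qed.

Lemma continuous_near_neq0 (f : plane -> R) u : differentiable f u -> f u != 0 ->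
  \forall u' \near u, f u' != 0.
Proof.
move=> df f0; have c := differentiable_continuous df.
apply: (c (fun z => z != 0)) => /=.
exact: (@open_nbhs_nbhs _ _ [set z | z != 0] (conj (@open_neq _ _) f0)).
Qed.

Lemma nbhs_small_ball (P : set plane) u : nbhs u P ->
  exists2 r, 0 < r & ball u r `<=` P.
Proof. by move=> /nbhs_ballP[r /= r0 H]; exists r. Qed.

End Restriction.

Section RankOne.
Context {R : realType}.
Local Notation R31 := 'rV[R]_3.
Local Notation E := (R31 * R31)%type.
Local Notation plane := 'rV[R]_2.

Variables (U : set plane) (F : plane -> E).
Hypothesis immF : is_immersion U F.
Local Notation F1 i := (pd i F).
Local Notation f1 b i u := (fac b (pd i F u)).
Local Notation pos b u := (fac b (F u)).
Local Notation len2 b a u := (lorentz (f1 b a u) (f1 b a u)).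

Definition areaf b u : R := det3 (pos b u) (f1 b 0 u) (f1 b 1 u).

Lemma pos_hyp b u : U u -> hyp (-1) (pos b u).
Proof. by move=> Uu; have [] := imm_HH immF Uu; case: b. Qed.

Lemma f1_tangent b l u : U u -> lorentz (f1 b l u) (pos b u) = 0.
Proof. by move=> Uu; have [] := F1_tangent immF l Uu; case: b. Qed.

Lemma areaf0 b a l u : areaf b u = 0 -> det3 (pos b u) (f1 b a u) (f1 b l u) = 0.
Proof.
have z (x y : R31) : det3 x y y = 0 by rewrite /det3 lcross_orthr.
move=> h; case: (ord2P a) => ->; case: (ord2P l) => ->; rewrite ?z //.
by rewrite det3_swap -/(areaf b u) h oppr0.
Qed.

Lemma len2_ge0 b a u : U u -> 0 <= len2 b a u.
Proof. by move=> Uu; exact: (tangent_ge0 (pos_hyp b Uu) (f1_tangent b a Uu)). Qed.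

Lemma len2_neq0 b a u : U u -> f1 b a u != 0 -> 0 < len2 b a u.
Proof.
move=> Uu h; rewrite lt_def len2_ge0 // andbT; apply: contra h => /eqP h.
by apply/eqP; exact: (tangent_eq0 (pos_hyp b Uu) (f1_tangent b a Uu) h).
Qed.

(** If the area vanishes, the determinant of the Gram matrix of the two partial
   derivatives of the component does, and the tangent plane is positive definite. *)
Lemma rank_one b a l u : U u -> 0 < len2 b a u -> areaf b u = 0 ->
  f1 b l u = (lorentz (f1 b l u) (f1 b a u) / len2 b a u) *: f1 b a u.
Proof.
move=> Uu S0 A0; set x := pos b u; set v := f1 b a u; set w := f1 b l u.
have [xx x0] := hypm1P (pos_hyp b Uu); rewrite -/x in xx.
have vx : lorentz v x = 0 := f1_tangent b a Uu.
have wx : lorentz w x = 0 := f1_tangent b l Uu.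
have Sn : lorentz v v != 0 by exact: lt0r_neq0.
have D : det3 x v (lcross x v) != 0.
  by rewrite /det3 lorentz_lcross xx vx mulr0 sub0r mulN1r opprK.
apply/eqP; rewrite -subr_eq0; apply/eqP; apply: (lorentz_nondegenerate D).
- by rewrite lorentzDl lorentzNl lorentzZl vx wx mulr0 subrr.
- by rewrite lorentzDl lorentzNl lorentzZl divfK // subrr.
- rewrite lorentzDl lorentzNl lorentzZl lorentzC -/(det3 _ _ _).
  by rewrite (areaf0 a l A0) (lorentzC v) lcross_orthr mulr0 subrr.
Qed.

Lemma derive_fac b v u : U u ->
  fac b ('D_v F u) = v 0 0 *: f1 b 0 u + v 0 1 *: f1 b 1 u.
Proof. by move=> Uu; rewrite (derive_pd _ (dF immF Uu)) facD !facZ. Qed.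

Lemma fac_eq0 b (p : E) : fac b p = 0 -> fac (~~ b) p = 0 -> p = 0.
Proof. by case: p b => p q [] /= -> ->. Qed.

(** Otherwise the differential of the immersion would be that of the other
   component, which has rank one. *)
Lemma exists_nonzero b u : U u -> areaf (~~ b) u = 0 -> exists a, f1 b a u != 0.
Proof.
move=> Uu A0; apply: contrapT => /forallNP H.
have z a : f1 b a u = 0 by apply/eqP/negPn/negP; exact: H.
have zb v : fac b ('D_v F u) = 0 by rewrite derive_fac // !z !scaler0 addr0.
have e0 : @coord_vec R 0 != 0.
  by apply/eqP => /rowP/(_ 0); rewrite !mxE /= => /eqP; rewrite oner_eq0.
have [h|h] := eqVneq (f1 (~~ b) 0 u) 0.
  move/eqP: e0; apply; apply: (imm_inj immF Uu); apply: (fac_eq0 (zb _)).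
  by rewrite -pd_at.
have S0 := len2_neq0 Uu h.
set c := lorentz (f1 (~~ b) 1 u) (f1 (~~ b) 0 u) / len2 (~~ b) 0 u.
pose v : plane := - c *: coord_vec 0 + coord_vec 1.
have v0 : v 0 0 = - c by rewrite !mxE /= mulr1 addr0.
have v1 : v 0 1 = 1 by rewrite !mxE /= mulr0 add0r.
have : v = 0.
  apply: (imm_inj immF Uu); apply: (fac_eq0 (zb _)).
  by rewrite derive_fac // v0 v1 scale1r (rank_one 1 Uu S0 A0) scaleNr addNr.
by move/rowP/(_ 1); rewrite v1 mxE => /eqP; rewrite oner_eq0.
Qed.

(** The two lines to which the tangent plane projects span it, for dimension
   reasons. *)
Lemma tangent_split b a a' k u : U u -> areaf b u = 0 -> areaf (~~ b) u = 0 ->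
  0 < len2 b a u -> 0 < len2 (~~ b) a' u ->
  exists v, 'D_v F u = inj_fac b (f1 b k u).
Proof.
move=> Uu A A' S S'.
pose al b a (v : plane) := (v 0 0 * lorentz (f1 b 0 u) (f1 b a u)
  + v 0 1 * lorentz (f1 b 1 u) (f1 b a u)) / len2 b a u.
have lin b1 a1 v : al b1 a1 v = v 0 0 * al b1 a1 (coord_vec 0)
    + v 0 1 * al b1 a1 (coord_vec 1).
  by rewrite /al !mxE /= !mul1r !mul0r addr0 add0r mulrDl !mulrA.
have exp b1 a1 v : areaf b1 u = 0 -> 0 < len2 b1 a1 u ->
    fac b1 ('D_v F u) = al b1 a1 v *: f1 b1 a1 u.
  move=> A1 S1; rewrite derive_fac // {1}(rank_one 0 Uu S1 A1).
  rewrite {1}(rank_one 1 Uu S1 A1) !scalerA -scalerDl; congr (_ *: _).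
  by rewrite /al [RHS]mulrDl -!mulrA.
have ker v : al b a v = 0 -> al (~~ b) a' v = 0 -> v = 0.
  move=> h h'; apply: (imm_inj immF Uu); apply: (@fac_eq0 b).
    by rewrite (exp b a) // h scale0r.
  by rewrite (exp (~~ b) a') // h' scale0r.
have D := plane_kernel_det (lin b a) (lin (~~ b) a') ker.
have [v [v1 v2]] := plane_solve (al b a (coord_vec k)) 0 (lin b a) (lin (~~ b) a') D.
exists v.
have e1 : fac b ('D_v F u) = f1 b k u.
  by rewrite (exp b a) // v1 -(exp b a) // -pd_at.
have e2 : fac (~~ b) ('D_v F u) = 0 by rewrite (exp (~~ b) a') // v2 scale0r.
by move: e1 e2; move: ('D_v F u) => [p q]; case: (b) => /= -> ->.
Qed.

End RankOne.

(** When the tangent planes split, [n] is the unit normal of the curve traced in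
   one factor and [kappa] its curvature; parallelism makes [kappa] constant,
   and then [n + kappa x] is a constant vector, a normal of the affine plane that
   contains the curve. *)
Section CurveFactor.
Context {R : realType}.
Local Notation R31 := 'rV[R]_3.
Local Notation E := (R31 * R31)%type.
Local Notation plane := 'rV[R]_2.

Variables (u0 : plane) (r : R) (F : plane -> E) (b : bool) (a : 'I_2).
Hypothesis r0 : 0 < r.
Local Notation U := (ball u0 r).
Hypothesis immF : is_immersion U F.
Local Notation f1 i u := (fac b (pd i F u)).
Local Notation f2 i j u := (fac b (pd i (pd j F) u)).
Local Notation x u := (fac b (F u)).
Local Notation S u := (lorentz (f1 a u) (f1 a u)).

Hypothesis S_gt0 : forall u, U u -> 0 < S u.
Hypothesis area0 : forall u, U u -> areaf F b u = 0.
Hypothesis splitF : forall k u, U u -> exists v, 'D_v F u = inj_fac b (f1 k u).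
Hypothesis parallelF : forall k i j u, U u -> nabla_hff F k i j u = 0.

Definition curve_normal u : R31 := (Num.sqrt (S u))^-1 *: lcross (x u) (f1 a u).
Local Notation n := curve_normal.
Definition curve_kappa u : R := lorentz (n u) (f2 a a u) / S u.
Local Notation kappa := curve_kappa.

Let dx u (Uu : U u) := differentiable_factor b (dF immF Uu).
Let df1 l u (Uu : U u) := differentiable_factor b (dF1 immF l Uu).
Let df2 i j u (Uu : U u) := differentiable_factor b (dF2 immF i j Uu).

Lemma differentiable_S u : U u -> differentiable (fun u => S u) u.
Proof. by move=> Uu; apply: differentiable_lorentz; exact: df1. Qed.

Lemma differentiable_curve_normal u : U u -> differentiable n u.
Proof.
move=> Uu; apply: differentiable_scale.
  apply: differentiable_inv; first by rewrite gt_eqF // sqrtr_gt0 S_gt0.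
  by apply: differentiable_sqrt; [exact: S_gt0|exact: differentiable_S].
by apply: differentiable_lcross; [exact: dx|exact: df1].
Qed.

Lemma differentiable_curve_kappa u : U u -> differentiable kappa u.
Proof.
move=> Uu; apply: differentiable_mul.
  by apply: differentiable_lorentz; [exact: differentiable_curve_normal|exact: df2].
by apply: differentiable_inv; [rewrite gt_eqF // S_gt0|exact: differentiable_S].
Qed.

Lemma curve_normal_x u : U u -> lorentz (n u) (x u) = 0.
Proof. by move=> Uu; rewrite lorentzZl lcross_orthl mulr0. Qed.

Lemma curve_normal_f1 l u : U u -> lorentz (n u) (f1 l u) = 0.
Proof.
by move=> Uu; rewrite lorentzZl -/(det3 _ _ _) areaf0 ?mulr0 //; exact: area0.
Qed.

Lemma curve_normal_unit u : U u -> lorentz (n u) (n u) = 1.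
Proof.
move=> Uu; have [xx _] := hypm1P (pos_hyp immF b Uu).
rewrite lorentzZl lorentzZr lorentz_lcross xx (f1_tangent immF b a Uu).
rewrite mulr0 sub0r mulN1r opprK mulrA -invfM -expr2 sqr_sqrtr; last first.
  by apply: ltW; exact: S_gt0.
by rewrite mulVf // gt_eqF // S_gt0.
Qed.

Lemma curve_normal_f2 l u : U u -> lorentz (n u) (f2 l a u) =
  kappa u * lorentz (f1 l u) (f1 a u) /\ pd l n u = - kappa u *: f1 l u.
Proof.
move=> Uu; have Sn : S u != 0 by rewrite gt_eqF // S_gt0.
have dn := differentiable_curve_normal Uu.
have [xx _] := hypm1P (pos_hyp immF b Uu).
have Dx m : lorentz (pd m n u) (x u) = 0.
  have : pd m (fun u => lorentz (n u) (x u)) u = 0.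
    rewrite -(pd_cst (0 : R) m u); apply: (pd_eq_on immF _ Uu).
    exact: curve_normal_x.
  rewrite (pd_lorentz m dn (dx Uu)) (pd_factor b m (dF immF Uu)).
  by rewrite curve_normal_f1 // addr0.
have Dn m : lorentz (pd m n u) (n u) = 0.
  have : pd m (fun u => lorentz (n u) (n u)) u = 0.
    rewrite -(pd_cst (1 : R) m u); apply: (pd_eq_on immF _ Uu).
    exact: curve_normal_unit.
  rewrite (pd_lorentz m dn dn) (lorentzC (n u)).
  by move: (lorentz _ _) => p; lra.
have Df m l' : lorentz (pd m n u) (f1 l' u) = - lorentz (n u) (f2 m l' u).
  have : pd m (fun u => lorentz (n u) (f1 l' u)) u = 0.
    rewrite -(pd_cst (0 : R) m u); apply: (pd_eq_on immF _ Uu) => u'.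
    exact: curve_normal_f1.
  rewrite (pd_lorentz m dn (df1 l' Uu)) (pd_factor b m (dF1 immF l' Uu)).
  by move: (lorentz _ _) (lorentz _ _) => p q; lra.
have tx := f1_tangent immF b a Uu.
have D : det3 (x u) (f1 a u) (n u) != 0.
  rewrite /det3 /curve_normal lorentzZr lorentz_lcross xx tx mulr0 sub0r mulN1r opprK.
  by rewrite mulf_neq0 // invr_eq0 gt_eqF // sqrtr_gt0 S_gt0.
have nx := curve_normal_x Uu; have nf := curve_normal_f1 a Uu.
have Dm m : pd m n u = - (lorentz (n u) (f2 m a u) / S u) *: f1 a u.
  apply/eqP; rewrite -subr_eq0; apply/eqP.
  apply: (lorentz_nondegenerate D); rewrite lorentzDl lorentzNl lorentzZl.
  - by rewrite Dx tx mulr0 subrr.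
  - by rewrite Df mulNr divfK // subrr.
  - by rewrite Dn (lorentzC (f1 a u)) nf mulr0 subrr.
have e : lorentz (n u) (f2 l a u) = kappa u * lorentz (f1 l u) (f1 a u).
  have := Df a l; rewrite Dm lorentzZl -/(kappa u) (F2C immF l a Uu).
  rewrite (lorentzC (f1 l u)).
  by move: (lorentz _ _) (lorentz _ _) => p q; lra.
split=> //; rewrite Dm e [in RHS](rank_one immF l Uu (S_gt0 Uu) (area0 Uu)) scalerA.
by congr (_ *: _); rewrite mulNr mulrA.
Qed.

Lemma pd_curve_kappa k u : U u -> pd k kappa u = 0.
Proof.
move=> Uu.
have := nabla_hff_factor immF differentiable_curve_normal differentiable_curve_kappa
  curve_normal_x curve_normal_f1 (fun l u Uu => proj2 (curve_normal_f2 l Uu))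
  splitF k a a Uu.
rewrite parallelF // gE0l => /esym/eqP; rewrite mulf_eq0 (gt_eqF (S_gt0 Uu)) orbF.
by move/eqP.
Qed.

Lemma factor_in_plane : exists p : R31 * R, lorentz p.1 p.1 = 1 - p.2 ^+ 2 /\
  forall u, U u -> lorentz (x u) p.1 = - p.2.
Proof.
have U0 : U u0 by exact: ballxx.
pose v u := n u + kappa u *: x u.
have kc u : U u -> kappa u = kappa u0.
  apply: pd0_ball_cst => [y|y k]; first exact: differentiable_curve_kappa.
  exact: pd_curve_kappa.
have vc u : U u -> v u = v u0.
  apply: pd0_ball_cst_row => [y Uy|y k Uy].
    apply: differentiable_add; first exact: differentiable_curve_normal.
    by apply: differentiable_scale; [exact: differentiable_curve_kappa|exact: dx].
  have dn := differentiable_curve_normal Uy; have dk := differentiable_curve_kappa Uy.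
  rewrite (pd_add k dn (differentiable_scale dk (dx Uy))) (pd_scale k dk (dx Uy)).
  rewrite pd_curve_kappa // scale0r add0r (pd_factor b k (dF immF Uy)).
  by rewrite (proj2 (curve_normal_f2 k Uy)) scaleNr addNr.
exists (v u0, kappa u0); split=> [|u Uu] /=.
  have [xx _] := hypm1P (pos_hyp immF b U0).
  have := curve_normal_unit U0; have := curve_normal_x U0; rewrite /v.
  move: (n u0) => m mx mm; rewrite !(lorentzDl, lorentzDr, lorentzZl, lorentzZr).
  by rewrite xx mm (lorentzC (x u0)) mx; ring.
have [xx _] := hypm1P (pos_hyp immF b Uu).
rewrite -(vc u Uu) /v lorentzDr lorentzZr xx (lorentzC (x u)) curve_normal_x //.
by rewrite kc //; ring.
Qed.

End CurveFactor.

(** Apply [factor_in_plane] to each component on a ball where both have a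
   nonvanishing partial derivative. *)
Lemma product_local (R : realType) (U : set 'rV[R]_2)
    (F : 'rV[R]_2 -> 'rV[R]_3 * 'rV[R]_3) u0 :
  is_immersion U F -> U u0 ->
  (forall u, U u -> area1 F u = 0 /\ area2 F u = 0) ->
  (forall k i j u, U u -> nabla_hff F k i j u = 0) ->
  exists2 r, 0 < r & exists p : bool -> 'rV[R]_3 * R, forall b,
    lorentz (p b).1 (p b).1 = 1 - (p b).2 ^+ 2 /\
    forall u, ball u0 r u -> lorentz (fac b (F u)) (p b).1 = - (p b).2.
Proof.
move=> immF U0 A0 par.
have area0 b u : U u -> areaf F b u = 0 by move=> /A0[]; case: b.
have [a aP] : exists a : bool -> 'I_2, forall b, fac b (pd (a b) F u0) != 0.
  have [a1 h1] := exists_nonzero immF U0 (area0 (~~ true) _ U0).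
  have [a2 h2] := exists_nonzero immF U0 (area0 (~~ false) _ U0).
  by exists (fun b : bool => if b then a1 else a2); case.
have nearS b : \forall u \near u0, lorentz (fac b (pd (a b) F u)) (fac b (pd (a b) F u)) != 0.
  apply: continuous_near_neq0; last by rewrite gt_eqF // (len2_neq0 immF U0 (aP b)).
  apply: differentiable_lorentz; apply: differentiable_factor; exact: dF1 immF _ _ U0.
have [r r0 Hr] := nbhs_small_ball (filterI (near_U immF U0)
  (filterI (nearS true) (nearS false))).
have rU : ball u0 r `<=` U by move=> u /Hr[].
have immr := immersion_sub (ball_open u0 r) rU immF.
have S0 b u : ball u0 r u -> 0 < lorentz (fac b (pd (a b) F u)) (fac b (pd (a b) F u)).
  move=> ru; rewrite lt_def (len2_ge0 immF _ _ (rU _ ru)) andbT.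
  by have [_ [h1 h2]] := Hr u ru; case: b.
have H b : exists p : 'rV[R]_3 * R, lorentz p.1 p.1 = 1 - p.2 ^+ 2 /\
    forall u, ball u0 r u -> lorentz (fac b (F u)) p.1 = - p.2.
  apply: (@factor_in_plane _ u0 r F b (a b) r0 immr).
  - exact: S0.
  - by move=> u /rU; exact: area0.
  - move=> k u ru; apply: (tangent_split immr k ru _ _ (S0 b u ru) (S0 (~~ b) u ru)).
      exact: area0 (rU _ ru).
    exact: area0 (rU _ ru).
  - by move=> k i j u /rU; exact: par.
exists r => //; have [p1 h1] := H true; have [p2 h2] := H false.
by exists (fun b : bool => if b then p1 else p2); case.
Qed.

(** * Curves of constant curvature and plane sections *)

Section ZeroDerivativeInterval.
Context {R : realType}.

Lemma derive1_0_interval_cst n (I : set R) (f : R -> 'rV[R]_n) : is_interval I ->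
  (forall s, I s -> differentiable f s) -> (forall s, I s -> 'D_1 f s = 0) ->
  forall s t, I s -> I t -> f s = f t.
Proof.
move=> iI df f0.
suff H s t : s < t -> I s -> I t -> f s = f t.
  move=> s t Is It; have [st|st|->//] := ltgtP s t; first exact: H.
  by apply: esym; exact: H.
move=> st Is It; apply/rowP => i.
have inI z : s <= z <= t -> I z by move=> sz; exact: iI Is It z sz.
have dz (z : R) : s <= z <= t -> is_derive z (1 : R) (fun s => f s 0 i) 0.
  move=> /inI Iz; have d := diff_is_derive (1 : R) (differentiable_entry i (df z Iz)).
  by rewrite -derive_entry ?f0 ?mxE // in d; exact: df.
have gd (z : R) : z \in `]s, t[ -> is_derive z (1 : R) (fun s => f s 0 i) 0.
  by rewrite in_itv /= => /andP[? ?]; apply: dz; rewrite !ltW.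
have gc : {within `[s, t], continuous (fun s => f s 0 i)}.
  apply: derivable_within_continuous => z; rewrite in_itv /= => sz.
  by have [] := dz _ sz.
have [z _] := @MVT _ (fun s => f s 0 i) (fun=> 0) s t st gd gc.
by rewrite mul0r => /eqP; rewrite subr_eq0 => /eqP.
Qed.

End ZeroDerivativeInterval.

Section CurvesInPlanes.
Context {R : realType}.
Local Notation R31 := 'rV[R]_3.

(** Along a curve of constant curvature [k] the vector [J beta' + k beta] is
   constant, so the curve lies in an affine plane. *)
Lemma constant_curvature_plane (I : set R) (beta : R -> R31) :
  open_interval I -> arclength_curve I beta -> constant_curvature I beta ->
  exists a k, lorentz a a = 1 - k ^+ 2 /\
    forall s, I s -> lorentz (beta s) a = - k.
Proof.
move=> [oI iI [s0 Is0]] [sb hb ub] [k kb].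
rewrite /geodesic_curvature in kb.
have [b1 b1E] : {b1 | derive1 beta = b1} by exists (derive1 beta).
rewrite b1E in ub kb.
have [b2 b2E] : {b2 | derive1 b1 = b2} by exists (derive1 b1).
rewrite b2E in kb.
have p1 s : 'D_(1 : R) beta s = b1 s by rewrite -derive1E b1E.
have p2 s : 'D_(1 : R) b1 s = b2 s by rewrite -derive1E b2E.
have d0 s : I s -> differentiable beta s by exact: smooth_differentiable.
have sb1 : smooth_on I b1.
  by rewrite (_ : b1 = 'D_(1 : R) beta); [exact: smooth_derive|apply/funext => s; rewrite p1].
have d1 s : I s -> differentiable b1 s by exact: smooth_differentiable.
have near s (P : R -> Prop) : I s -> (forall t, I t -> P t) -> \forall t \near s, P t.
  by move=> Is H; apply: filterS (open_nbhs_nbhs (conj oI Is)).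
have bb s : I s -> lorentz (beta s) (beta s) = -1 by move=> /hb/hypm1P[].
have b1b s : I s -> lorentz (b1 s) (beta s) = 0.
  move=> Is; have : 'D_1 (fun s => lorentz (beta s) (beta s)) s = 0.
    by rewrite -(derive_cst (-1 : R) s 1); apply: near_eq_derive; exact: near.
  rewrite (derive_lorentz _ (d0 s Is) (d0 s Is)) p1 (lorentzC (beta s)).
  by move: (lorentz _ _) => p; lra.
have b2b s : I s -> lorentz (b2 s) (beta s) = -1.
  move=> Is; have : 'D_1 (fun s => lorentz (b1 s) (beta s)) s = 0.
    by rewrite -(derive_cst (0 : R) s 1); apply: near_eq_derive; exact: near.
  rewrite (derive_lorentz _ (d1 s Is) (d0 s Is)) p1 p2 ub //.
  by move: (lorentz _ _) => p; lra.
have b2b1 s : I s -> lorentz (b2 s) (b1 s) = 0.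
  move=> Is; have : 'D_1 (fun s => lorentz (b1 s) (b1 s)) s = 0.
    by rewrite -(derive_cst (1 : R) s 1); apply: near_eq_derive; exact: near.
  rewrite (derive_lorentz _ (d1 s Is) (d1 s Is)) p2 (lorentzC (b1 s)).
  by move: (lorentz _ _) => p; lra.
have kE s : I s -> lorentz (b2 s) (lcross (beta s) (b1 s)) = k.
  move=> Is; rewrite -(kb s Is) J_hypE /hyp_proj lorentzDl lorentzZl.
  by rewrite (lorentzC (beta s)) lcross_orthl mulr0 addr0.
pose a s := lcross (beta s) (b1 s) + k *: beta s.
have ac s t : I s -> I t -> a s = a t.
  have da u : I u -> differentiable (fun u => lcross (beta u) (b1 u)) u.
    by move=> Iu; apply: differentiable_lcross; [exact: d0|exact: d1].
  have dk u : I u -> differentiable (fun u => k *: beta u) u.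
    move=> Iu; apply: differentiable_scale; last exact: d0.
    exact: differentiable_cst.
  apply: derive1_0_interval_cst => // u Iu.
    by apply: differentiable_add; [exact: da|exact: dk].
  have dc := differentiable_cst k u.
  rewrite (derive_add _ (da u Iu) (dk u Iu)) (derive_lcross _ (d0 u Iu) (d1 u Iu)).
  rewrite (derive_scale dc (d0 u Iu)) derive_cst scale0r add0r p1 p2.
  have nb : lorentz (lcross (beta u) (b1 u)) (beta u) = 0 by rewrite lcross_orthl.
  have nb1 : lorentz (b1 u) (lcross (beta u) (b1 u)) = 0.
    by rewrite lorentzC lcross_orthr.
  have nn : lorentz (lcross (beta u) (b1 u)) (lcross (beta u) (b1 u)) = 1.
    by rewrite lorentz_lcross (lorentzC _ (b1 u)) b1b // bb // ub //; ring.
  have := frame_decomposition (b2 u) (hb u Iu) (b1b u Iu) nb nb1 (ub u Iu) nn.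
  rewrite b2b // b2b1 // kE // => ->.
  rewrite !lcrossDr !lcrossZr lcross_lcross bb // (lorentzC _ (b1 u)) b1b //.
  have lz (v : R31) : lcross v v = 0 by apply: row3P; rewrite lcrossE mxE; ring.
  rewrite !lz !scale0r subr0 !scaler0 !add0r scaleN1r scalerN.
  by rewrite addNr.
exists (a s0), k; split=> [|s Is].
  rewrite /a !(lorentzDl, lorentzDr, lorentzZl, lorentzZr) lorentz_lcross bb //.
  rewrite (lorentzC _ (b1 s0)) b1b // ub // (lorentzC (beta s0)) lcross_orthl.
  by ring.
rewrite (ac s0 s) // /a lorentzDr lorentzZr bb // lorentzC lcross_orthl; ring.
Qed.

(** [S] and [V] stand for [sinh s] and [cosh s - 1], rescaled by the parameter
   [m]: hyperbolic functions for [m > 0], trigonometric functions for [m < 0],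
   and [s], [s^2 / 2] for [m = 0].  They parametrize a branch of a conic, the
   shape of a plane section of the hyperboloid. *)
Record model_functions (m : R) (S V : R -> R) : Prop := ModelFunctions {
  model_dS : forall s : R, is_derive s (1 : R) S (1 + m * V s);
  model_dV : forall s : R, is_derive s (1 : R) V (S s);
  model_conic : forall s, S s ^+ 2 = 2 * V s + m * V s ^+ 2;
  model_ge0 : forall s, 0 <= V s;
  model_surj : forall P Q, P ^+ 2 = 2 * Q + m * Q ^+ 2 -> 0 <= Q ->
    exists s, S s = P /\ V s = Q }.

Lemma exists_angle (c s : R) : c ^+ 2 + s ^+ 2 = 1 ->
  exists t, cos t = c /\ sin t = s.
Proof.
move=> cs; have s2 : s ^+ 2 = 1 - c ^+ 2 by rewrite -cs addrAC subrr add0r.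
have cI : -1 <= c <= 1.
  by have := sqr_ge0 s => s0; apply/andP; split; nra.
have sa : sin (acos c) = `|s| by rewrite sin_acos // -s2 sqrtr_sqr.
have ca : cos (acos c) = c by rewrite acosK // in_itv.
have [s0|s0] := leP 0 s.
  by exists (acos c); split=> //; rewrite sa ger0_norm.
by exists (- acos c); rewrite cosN sinN sa ltr0_norm // opprK.
Qed.

Lemma is_derive_scaled_arg (f : R -> R) (q s df : R) :
  is_derive (q * s) (1 : R) f df -> is_derive s (1 : R) (fun s => f (q * s)) (q * df).
Proof.
move=> fd; have lin : is_derive s (1 : R) (fun s => q * s) q.
  have d := @is_deriveZ _ _ _ id q s (1 : R) (1 : R) (is_derive_id _ _).
  by apply: is_derive_eq d _; rewrite [_%:A]mulr1.
have d := @is_derive1_comp _ f (fun s => q * s) s _ _ fd lin.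
by apply: is_derive_eq d _; rewrite /GRing.scale /= mulrC.
Qed.

Lemma is_derive_affine (f : R -> R) (p q s df : R) :
  is_derive s (1 : R) f df -> is_derive s (1 : R) (fun s => p * (f s + q)) (p * df).
Proof.
move=> fd; have d1 := @is_deriveD _ _ _ f (cst q) s (1 : R) df 0 fd (is_derive_cst _ _ _).
have d := @is_deriveZ _ _ _ _ p s (1 : R) _ d1.
by apply: is_derive_eq d _; rewrite addr0.
Qed.

Lemma exists_model_functions m : exists S V, model_functions m S V.
Proof.
have [m0|m0|->] := ltgtP m 0.
- pose q := Num.sqrt (- m).
  have q0 : 0 < q by rewrite sqrtr_gt0 oppr_gt0.
  have qm : m = - q ^+ 2 by rewrite sqr_sqrtr ?opprK // oppr_ge0 ltW.
  have qn : q != 0 by rewrite gt_eqF.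
  have ds s := is_derive_affine q^-1 0 (is_derive_scaled_arg (is_derive_sin (q * s))).
  have dc s := is_derive_affine (- q ^- 2) (-1)
    (is_derive_scaled_arg (is_derive_cos (q * s))).
  exists (fun s => q^-1 * (sin (q * s) + 0)), (fun s => - q ^- 2 * (cos (q * s) - 1)).
  split.
  + by move=> s; apply: is_derive_eq (ds s) _; rewrite qm; field.
  + by move=> s; apply: is_derive_eq (dc s) _; field.
  + move=> s; have := cos2Dsin2 (q * s); move: (cos _) (sin _) => c t ct.
    have -> : (q^-1 * (t + 0)) ^+ 2 = q ^- 2 * t ^+ 2 by field.
    have -> : t ^+ 2 = 1 - c ^+ 2 by rewrite -ct addrAC subrr add0r.
    by rewrite qm; field.
  + move=> s; rewrite mulNr -mulrN opprB mulr_ge0 ?subr_ge0 ?cos_le1 //.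
    by rewrite invr_ge0 sqr_ge0.
  + move=> P Q PQ Q0.
    have [|t [tc ts]] := @exists_angle (1 + m * Q) (q * P).
      by rewrite exprMn PQ qm; ring.
    exists (t / q); rewrite mulrCA divff // mulr1 tc ts; split; first by field.
    by rewrite qm; field.
- pose q := Num.sqrt m.
  have q0 : 0 < q by rewrite sqrtr_gt0.
  have qm : m = q ^+ 2 by rewrite sqr_sqrtr // ltW.
  have qn : q != 0 by rewrite gt_eqF.
  have de s := is_derive_scaled_arg (is_derive_expR (q * s)).
  have de' s := is_derive_scaled_arg (is_derive_expR (- q * s)).
  have ee s : expR (q * s) * expR (- q * s) = 1 by rewrite mulNr expRxMexpNx_1.
  pose S s := (2 * q)^-1 * (expR (q * s) + 0) + (- (2 * q)^-1) * (expR (- q * s) + 0).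
  pose V s := (2 * q ^+ 2)^-1 * (expR (q * s) - 1)
    + (2 * q ^+ 2)^-1 * (expR (- q * s) - 1).
  exists S, V; split.
  + move=> s; have d := is_deriveD (is_derive_affine (2 * q)^-1 0 (de s))
      (is_derive_affine (- (2 * q)^-1) 0 (de' s)).
    by apply: is_derive_eq d _; rewrite /V qm; field.
  + move=> s; have d := is_deriveD (is_derive_affine (2 * q ^+ 2)^-1 (-1) (de s))
      (is_derive_affine (2 * q ^+ 2)^-1 (-1) (de' s)).
    by apply: is_derive_eq d _; rewrite /S; field.
  + move=> s; rewrite /S /V qm; have := ee s; move: (expR _) (expR _) => x y xy.
    apply/eqP; rewrite -subr_eq0; apply/eqP.
    transitivity (- q ^- 2 * (y * x - 1)); last by rewrite xy subrr mulr0.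
    by field.
  + move=> s; rewrite /V -mulrDr; apply: mulr_ge0.
      by rewrite invr_ge0 mulr_ge0 ?sqr_ge0.
    have := ee s; have := expR_gt0 (- q * s).
    move: (expR (q * s)) (expR _) => x y y0 xy.
    have -> : x - 1 + (y - 1) = y * (x - 1) ^+ 2.
      transitivity (x * (x * y) - 2 * (x * y) + y); last by ring.
      by rewrite xy; ring.
    by rewrite mulr_ge0 ?sqr_ge0 // ltW.
  + move=> P Q PQ Q0; pose e := 1 + q ^+ 2 * Q + q * P; pose e' := 1 + q ^+ 2 * Q - q * P.
    have ee1 : e * e' = 1.
      transitivity ((1 + q ^+ 2 * Q) ^+ 2 - q ^+ 2 * P ^+ 2); first by rewrite /e /e'; ring.
      by rewrite PQ qm; ring.
    have es : 2 <= e + e'.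
      have := mulr_ge0 (sqr_ge0 q) Q0; rewrite /e /e'; move: (q ^+ 2 * Q) => z; lra.
    have e0 : 0 < e by nra.
    have eN : e != 0 by rewrite gt_eqF.
    have e'E : e' = e^-1 by rewrite -[LHS](mulKf eN) ee1 mulr1.
    have E1 : expR (q * (ln e / q)) = e by rewrite mulrCA divff // mulr1 lnK ?posrE.
    have E2 : expR (- q * (ln e / q)) = e'.
      by rewrite mulNr mulrCA divff // mulr1 expRN lnK ?posrE.
    by exists (ln e / q); rewrite /S /V E1 E2 /e /e'; split; field.
- exists id, (fun s => 2^-1 * s ^+ 2); split.
  + by move=> s; rewrite mul0r addr0; exact: is_derive_id.
  + move=> s; have d := @is_deriveX _ _ id 2 s (1 : R) _ (is_derive_id _ _).
    have d2 := @is_deriveZ _ _ _ _ 2^-1 s (1 : R) _ d.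
    apply: is_derive_eq d2 _; rewrite /GRing.scale /= expr1 mulr1.
    by rewrite mulrA mulVf ?mul1r // pnatr_eq0.
  + by move=> s; rewrite mul0r addr0 mulrA divff ?mul1r // pnatr_eq0.
  + by move=> s; rewrite mulr_ge0 // ?invr_ge0 // sqr_ge0.
  + move=> P Q PQ Q0; exists P; split=> //.
    by rewrite PQ mul0r addr0 mulrA mulVf ?mul1r // pnatr_eq0.
Qed.

(** In the coordinates given by a frame at [x0], the equations of the hyperboloid
   and of the plane combine to that of a conic through the origin. *)
Lemma section_conic (x0 t n x : R31) (k : R) : hyp (-1) x0 -> hyp (-1) x ->
  lorentz t x0 = 0 -> lorentz n x0 = 0 -> lorentz t n = 0 ->
  lorentz t t = 1 -> lorentz n n = 1 ->
  let Q := - 1 - lorentz x x0 in lorentz x n = k * Q ->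
  lorentz x t ^+ 2 = 2 * Q + (1 - k ^+ 2) * Q ^+ 2.
Proof.
move=> x0H xH tx nx tn tt nn Q xn; have [xx _] := hypm1P x0H.
have xE := frame_decomposition x x0H tx nx tn tt nn.
have [x1 _] := hypm1P xH; move: x1; rewrite {1 2}xE.
rewrite !(lorentzDl, lorentzDr, lorentzZl, lorentzZr) xx tt nn tx nx tn.
rewrite (lorentzC x0 t) (lorentzC x0 n) (lorentzC n t) tx nx tn xn.
have -> : lorentz x x0 = - 1 - Q by rewrite /Q; ring.
by move: (lorentz x t) => P; lra.
Qed.

(** The nonempty section of the hyperbolic plane by the plane [<x, a> = - k] is
   the trajectory of the solution of [beta'' = (1 - k^2) beta + k a] that starts
   at a point [x0] of the section in the direction tangent to it. *)
Lemma plane_section_curve (x0 a : R31) (k : R) : hyp (-1) x0 ->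
  lorentz a a = 1 - k ^+ 2 -> lorentz x0 a = - k ->
  exists beta : R -> R31, [/\ arclength_curve setT beta,
    constant_curvature setT beta, forall s, lorentz (beta s) a = - k &
    forall x, hyp (-1) x -> lorentz x a = - k -> exists s, beta s = x].
Proof.
move=> x0H aa x0a; have [xx _] := hypm1P x0H.
pose m := 1 - k ^+ 2; pose n0 := a - k *: x0; pose t0 := lcross x0 n0.
have n0x : lorentz n0 x0 = 0.
  by rewrite lorentzDl lorentzNl lorentzZl xx (lorentzC a) x0a; ring.
have n0n : lorentz n0 n0 = 1.
  rewrite !(lorentzDl, lorentzDr, lorentzNl, lorentzNr, lorentzZl, lorentzZr).
  by rewrite (lorentzC a) x0a aa xx; ring.
have t0x : lorentz t0 x0 = 0 by exact: lcross_orthl.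
have t0n : lorentz t0 n0 = 0 by exact: lcross_orthr.
have t0t : lorentz t0 t0 = 1.
  by rewrite lorentz_lcross (lorentzC x0 n0) n0x xx n0n; ring.
have aE : a = n0 + k *: x0 by rewrite subrK.
clearbody t0; clearbody n0.
have [S [V [dS dV SV V0 sj]]] := exists_model_functions m.
(* [c0] is the acceleration of the curve at [x0]. *)
have [c0 c0E] : {c0 | c0 = x0 + k *: n0} by exists (x0 + k *: n0).
pose curve (p q w : R31) s := p + S s *: q + V s *: w.
have diffS s : differentiable S s by apply/derivable1_diffP; case: (dS s).
have diffV s : differentiable V s by apply/derivable1_diffP; case: (dV s).
have dcst (p : R31) s : differentiable (fun _ : R => p) s by exact: differentiable_cst.
have dcurve p q w s : differentiable (curve p q w) s.
  apply: differentiable_add; last exact: differentiable_scale (diffV s) (dcst w s).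
  apply: differentiable_add (dcst p s) _.
  exact: differentiable_scale (diffS s) (dcst q s).
have Dv (f : R -> R) s v : differentiable f s -> 'D_v f s = v * 'D_(1 : R) f s.
  move=> df; have := derive_linr df v (1 : R) 0; rewrite derive0 !addr0.
  by rewrite [_%:A]mulr1.
have Dcurve p q w (v s : R) :
    'D_v (curve p q w) s = curve (v *: q) (v *: w) ((v * m) *: q) s.
  have e1 := differentiable_scale (diffS s) (dcst q s).
  have e2 := differentiable_scale (diffV s) (dcst w s).
  rewrite (derive_add _ (differentiable_add (dcst p s) e1) e2).
  rewrite (derive_add _ (dcst p s) e1) (derive_scale (diffS s) (dcst q s)).
  rewrite (derive_scale (diffV s) (dcst w s)) !derive_cst.
  rewrite (Dv S) // (Dv V) //.
  have [_ ->] := dS s; have [_ ->] := dV s.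
  by apply/rowP => i; rewrite !mxE; ring.
have scurve p q w : smooth_on setT (curve p q w).
  move=> j; elim: j p q w => [|j IH] p q w /=.
    by move=> s _; exact: differentiable_continuous.
  split=> [s _|v]; first exact: dcurve.
  rewrite (_ : 'D_v _ = curve (v *: q) (v *: w) ((v * m) *: q)) //.
  by apply/funext => s; exact: Dcurve.
pose beta := curve x0 t0 c0.
have b1E : derive1 beta = curve t0 c0 (m *: t0).
  by apply/funext => s; rewrite derive1E Dcurve !scale1r mul1r.
have b2E : derive1 (derive1 beta) = curve c0 (m *: t0) (m *: c0).
  by rewrite b1E; apply/funext => s; rewrite derive1E Dcurve !scale1r mul1r.
have c0x : lorentz c0 x0 = -1 by rewrite c0E lorentzDl lorentzZl n0x xx; ring.
have c0c : lorentz c0 c0 = - m.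
  rewrite c0E !(lorentzDl, lorentzDr, lorentzZl, lorentzZr) (lorentzC x0 n0) n0x xx n0n.
  by rewrite /m; ring.
have c0t : lorentz c0 t0 = 0.
  by rewrite lorentzC c0E !(lorentzDr, lorentzZr) t0x t0n; ring.
have bb s : lorentz (beta s) (beta s) = -1.
  rewrite !(lorentzDl, lorentzDr, lorentzZl, lorentzZr) xx t0t c0c c0t c0x.
  rewrite (lorentzC x0 t0) (lorentzC x0 c0) (lorentzC t0 c0) c0t c0x t0x.
  transitivity (-1 - 2 * V s - m * V s ^+ 2 + S s ^+ 2); first by ring.
  by rewrite SV; ring.
have bH s : hyp (-1) (beta s).
  apply: (hyp_opp x0H (bb s)); rewrite !(lorentzDl, lorentzZl) xx t0x c0x.
  by have := V0 s; lra.
exists beta; split.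
- split=> [|s _|s _]; [exact: scurve|exact: bH|].
  rewrite b1E !(lorentzDl, lorentzDr, lorentzZl, lorentzZr) t0t c0c c0t.
  rewrite (lorentzC t0 c0) c0t.
  transitivity (1 + m * (2 * V s + m * V s ^+ 2) - m * S s ^+ 2); first by ring.
  by rewrite SV; ring.
- exists (k * det3 x0 t0 n0) => s _.
  rewrite /geodesic_curvature b2E b1E J_hypE /hyp_proj lorentzDl lorentzZl.
  rewrite (lorentzC (beta s) (lcross _ _)) lcross_orthl mulr0 addr0 lorentzC.
  rewrite -/(det3 _ _ _).
  have -> : curve c0 (m *: t0) (m *: c0) s = m *: beta s + k *: a.
    rewrite aE /beta /curve c0E.
    by apply/rowP => i; rewrite !mxE /m; ring.
  have z (x y : R31) : det3 x y x = 0 by rewrite /det3 lcross_orthl.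
  rewrite {1}/det3 lorentzDr !lorentzZr -!/(det3 _ _ _) z mulr0 add0r.
  congr (_ * _).
  transitivity (((1 + m * V s) * (1 + V s) - S s ^+ 2 * m
     - k ^+ 2 * V s * (1 + m * V s)) * det3 x0 t0 n0).
    rewrite /beta /curve aE c0E /m; move: (S s) (V s) => p q; clear.
    by rewrite /det3 /lorentz !lcrossE !mxE; ring.
  rewrite SV -[RHS]mul1r; congr (_ * _); rewrite /m; ring.
- move=> s; have t0a : lorentz t0 a = 0.
    by rewrite aE lorentzDr lorentzZr t0n t0x; ring.
  have c0a : lorentz c0 a = 0.
    rewrite c0E aE !(lorentzDl, lorentzDr, lorentzZl, lorentzZr) n0n xx n0x.
    by rewrite (lorentzC x0 n0) n0x; ring.
  by rewrite !(lorentzDl, lorentzZl) x0a t0a c0a; ring.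
- move=> x xH xa.
  pose Q := - 1 - lorentz x x0.
  have Q0 : 0 <= Q by have := hyp_lorentz_le xH x0H; rewrite /Q; lra.
  have xn : lorentz x n0 = k * Q.
    by move: xa; rewrite aE lorentzDr lorentzZr /Q; lra.
  have xE := frame_decomposition x x0H t0x n0x t0n t0t n0n.
  have [||s [sP sQ]] := sj (lorentz x t0) Q.
  + exact: (section_conic x0H xH t0x n0x t0n t0t n0n xn).
  + exact: Q0.
  exists s; rewrite /beta /curve sP sQ [RHS]xE xn c0E.
  have -> : lorentz x x0 = - 1 - Q by rewrite /Q; ring.
  by apply/rowP => i; rewrite !mxE; ring.
Qed.

End CurvesInPlanes.

(** * Local structure of parallel Lagrangian immersions *)

Section Connectedness.
Context {T : topologicalType} {Th : Type}.

(** A family of sets covers a connected space by a single member as soon as it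
   does so locally and members that agree on an open set coincide. *)
Lemma connected_single_member (Q : Th -> set T) (p0 : T) :
  connected [set: T] -> (forall p : T, exists t, nbhs p (Q t)) ->
  (forall t t' (p : T), nbhs p (Q t) -> nbhs p (Q t') -> Q t = Q t') ->
  exists t, forall p, Q t p.
Proof.
move=> cT loc rig; have [t0 nt0] := loc p0; exists t0.
(* The interior of [Q t0] is open and closed. *)
suff BT : (Q t0)° = setT.
  by move=> p; have : (Q t0)° p by [rewrite BT]; exact: interior_subset.
apply: cT; first by exists p0.
- exists (Q t0)°; first exact: open_interior.
  by rewrite setTI.
- exists (Q t0)°; last by rewrite setTI.
  move=> p cp; have [t nt] := loc p.
  have [q [q0 qt]] := cp _ (open_nbhs_nbhs (conj (open_interior (Q t)) nt)).
  by rewrite /interior /= (rig t0 t q q0 qt).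
Qed.

End Connectedness.

Section SurfaceLocal.
Context {R : realType}.
Local Notation R31 := 'rV[R]_3.
Local Notation E := (R31 * R31)%type.
Local Notation plane := 'rV[R]_2.

Lemma differentiable_area1 (U : set plane) (F : plane -> E) u :
  is_immersion U F -> U u -> differentiable (area1 F) u.
Proof.
move=> immF Uu; have d0 := dF immF Uu; have d1 i := dF1 immF i Uu.
apply: differentiable_lorentz; last exact: differentiable_fst.
by apply: differentiable_lcross; exact: differentiable_fst.
Qed.

(** The induced metric is twice that of the first component. *)
Lemma conformal_det (U : set plane) (F : plane -> E) u : is_immersion U F -> U u ->
  (forall i j, lorentz (pd i F u).1 (pd j F u).1 = lorentz (pd i F u).2 (pd j F u).2) ->
  \det (gram F u) = 4 * area1 F u ^+ 2.
Proof.
move=> immF Uu conf; have [h1 _] := imm_HH immF Uu.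
have [t0 _] := F1_tangent immF 0 Uu; have [t1 _] := F1_tangent immF 1 Uu.
rewrite /area1 (det3_tangent h1 t0 t1) det2 !gramE /gE -!conf.
by rewrite (lorentzC (pd 1 F u).1 (pd 0 F u).1); ring.
Qed.

(** The Codazzi equation makes the components conformal where the area is nonzero;
   where it is zero, it is so in a neighbourhood, by continuity of the
   determinant of the metric. *)
Lemma parallel_local (U : set plane) (F : plane -> E) u : is_immersion U F ->
  is_lagrangian U F -> U u -> (forall k i j u, U u -> nabla_hff F k i j u = 0) ->
  exists2 r, 0 < r & ball u r `<=` U /\
   ((exists2 B, proper_isometry B &
      forall u', ball u r u' -> (F u').1 *m B = (F u').2) \/
    (exists p : bool -> R31 * R, forall b,
      lorentz (p b).1 (p b).1 = 1 - (p b).2 ^+ 2 /\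
      forall u', ball u r u' -> lorentz (fac b (F u')) (p b).1 = - (p b).2)).
Proof.
move=> immF lagF Uu par.
have cod u' i j : U u' -> area1 F u' != 0 ->
    lorentz (pd i F u').1 (pd j F u').1 = lorentz (pd i F u').2 (pd j F u').2.
  move=> Uu' A; have := lagrangian_codazzi immF lagF j i Uu' (fun k i j => par k i j u' Uu').
  by move/(mulfI A).
have [A0|A0] := eqVneq (area1 F u) 0; last first.
  have [r r0 Hr] := nbhs_small_ball (filterI (near_U immF Uu)
    (continuous_near_neq0 (differentiable_area1 immF Uu) A0)).
  have rU : ball u r `<=` U by move=> z /Hr[].
  have rA z : ball u r z -> area1 F z != 0 by move=> /Hr[].
  exists r => //; split=> //; left.
  have immr := immersion_sub (ball_open u r) rU immF.
  apply: (conformal_isometry r0 immr).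
  - by move=> i j z rz; apply: cod; [exact: rU|exact: rA].
  - exact: rA.
  - by move=> z /rU Uz; exact: (area_eq lagF (u := z) Uz).
(* [h] is nonzero at [u], and vanishes where the area does not. *)
pose h z := 4 * (area1 F z * area1 F z) - (gE (pd 0 F z) (pd 0 F z) * gE (pd 1 F z) (pd 1 F z)
  - gE (pd 0 F z) (pd 1 F z) * gE (pd 1 F z) (pd 0 F z)).
have hE z : h z = 4 * area1 F z ^+ 2 - \det (gram F z).
  by rewrite /h det2 !gramE expr2.
have dh : differentiable h u.
  have dg i j := differentiable_gram immF i j Uu.
  have da := differentiable_area1 immF Uu.
  apply: differentiable_sub.
    apply: differentiable_mul; first exact: differentiable_cst.
    exact: differentiable_mul.
  by apply: differentiable_sub; exact: differentiable_mul.
have h0 : h u != 0.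
  by rewrite hE A0 expr0n /= mulr0 sub0r oppr_eq0 (det_gram immF).
have [r r0 Hr] := nbhs_small_ball (filterI (near_U immF Uu)
    (continuous_near_neq0 dh h0)).
have rU : ball u r `<=` U by move=> z /Hr[].
have rA z : ball u r z -> area1 F z = 0 /\ area2 F z = 0.
  move=> rz; have [Uz hz] := Hr z rz; rewrite -(area_eq lagF Uz).
  suff : area1 F z = 0 by [].
  apply/eqP; apply: contraNT hz => Az.
  by rewrite hE (conformal_det immF Uz) ?subrr // => i j; exact: cod.
have immr := immersion_sub (ball_open u r) rU immF.
have [r' r'0 [p pP]] := product_local immr (ballxx u r0) rA
  (fun k i j z rz => par k i j z (rU z rz)).
exists (Num.min r r'); first by rewrite lt_min r0 r'0.
split; first by move=> z zr; apply: rU; apply: le_ball zr; rewrite ge_min lexx.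
right; exists p => b; have [h1 h2] := pP b; split=> // z zr.
by apply: h2; apply: le_ball zr; rewrite ge_min lexx orbT.
Qed.

End SurfaceLocal.

Section Rigidity.
Context {R : realType}.
Local Notation R31 := 'rV[R]_3.
Local Notation E := (R31 * R31)%type.
Local Notation plane := 'rV[R]_2.

Variables (U : set plane) (F : plane -> E).
Hypothesis immF : is_immersion U F.

Lemma iso_det3 (B : 'M[R]_3) x y z : proper_isometry B ->
  det3 (x *m B) (y *m B) (z *m B) = det3 x y z.
Proof. by move=> iB; rewrite /det3 (iso_lcross iB) (iso_lorentz iB). Qed.

Lemma mulmxr3_linear (B : 'M[R]_3) : linear (fun x : R31 => x *m B).
Proof. by move=> k x y; rewrite mulmxDl scalemxAl. Qed.

Lemma differentiable_mulmxr (V : normedModType R) (B : 'M[R]_3) (f : V -> R31) u :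
  differentiable f u -> differentiable (fun u => f u *m B) u.
Proof.
move=> df; apply: differentiable_row => j.
rewrite (_ : (fun u => _) = fun u => f u 0 0 * B 0 j + f u 0 1 * B 1 j + f u 0 2 * B 2 j).
  by apply: differentiable_add; [apply: differentiable_add|]; apply: differentiable_mul;
    [exact: differentiable_entry|exact: differentiable_cst|exact: differentiable_entry
    |exact: differentiable_cst|exact: differentiable_entry|exact: differentiable_cst].
by apply/funext => z; rewrite mulmx_row3.
Qed.

Lemma derive_mulmxr (V : normedModType R) (B : 'M[R]_3) (f : V -> R31) u v :
  differentiable f u -> 'D_v (fun u => f u *m B) u = 'D_v f u *m B.
Proof.
move=> df; pose L : {linear R31 -> R31} := HB.pack (fun x : R31 => x *m B)
  (GRing.isLinear.Build _ _ _ _ _ (mulmxr3_linear B)).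
have cL : continuous L.
  move=> x; apply: differentiable_continuous; apply: (@differentiable_mulmxr _ B id).
  by [].
exact: (derive_linear (L := L) v cL df).
Qed.

Lemma isometric_pd B l u : U u -> (forall u', U u' -> (F u').1 *m B = (F u').2) ->
  (pd l F u).1 *m B = (pd l F u).2.
Proof.
move=> Uu FB; have d0 := dF immF Uu.
rewrite -(pd_fst l d0) -(pd_snd l d0) !pd_at -derive_mulmxr; last exact: differentiable_fst.
by apply: (derive_eq_on immF).
Qed.

Lemma isometric_area B u : U u -> proper_isometry B ->
  (forall u', U u' -> (F u').1 *m B = (F u').2) -> area1 F u != 0.
Proof.
move=> Uu iB FB; have := det_gram immF Uu.
rewrite (conformal_det immF Uu); last first.
  by move=> i j; rewrite -!(isometric_pd _ Uu FB) (iso_lorentz iB).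
by apply: contra => /eqP ->; rewrite expr0n /= mulr0.
Qed.

(** [B] is determined by its values on the frame of the first component. *)
Lemma isometry_unique B B' u : U u -> proper_isometry B -> proper_isometry B' ->
  (forall u', U u' -> (F u').1 *m B = (F u').2) ->
  (forall u', U u' -> (F u').1 *m B' = (F u').2) -> B = B'.
Proof.
move=> Uu iB iB' FB FB'; have D := isometric_area Uu iB FB.
have xB (x : R31) : x *m B = x *m B'.
  have D' : det3 ((F u).1 *m B) ((pd 0 F u).1 *m B) ((pd 1 F u).1 *m B) != 0.
    by rewrite iso_det3.
  apply/eqP; rewrite -subr_eq0; apply/eqP; apply: (lorentz_nondegenerate D');
    rewrite lorentzDl lorentzNl (iso_lorentz iB).
  - by rewrite FB // -FB' // (iso_lorentz iB') subrr.
  - by rewrite (isometric_pd _ Uu FB) -(isometric_pd _ Uu FB') (iso_lorentz iB') subrr.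
  - by rewrite (isometric_pd _ Uu FB) -(isometric_pd _ Uu FB') (iso_lorentz iB') subrr.
by apply/row_matrixP => i; rewrite !rowE xB.
Qed.

Definition in_plane_section (b : bool) (a : R31) (k : R) :=
  lorentz a a = 1 - k ^+ 2 /\ forall u, U u -> lorentz (fac b (F u)) a = - k.

Lemma section_f1 b a k l u : in_plane_section b a k -> U u ->
  lorentz (fac b (pd l F u)) a = 0.
Proof.
move=> [_ h] Uu; have d0 := dF immF Uu.
have : pd l (fun u => lorentz (fac b (F u)) a) u = 0.
  by rewrite -(pd_cst (- k) l u); apply: (pd_eq_on immF).
rewrite (pd_lorentz l (differentiable_factor b d0) (differentiable_cst a u)).
by rewrite pd_cst lorentz0r addr0 (pd_factor b l d0).
Qed.

Lemma section_f2 b a k i j u : in_plane_section b a k -> U u ->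
  lorentz (fac b (pd i (pd j F) u)) a = 0.
Proof.
move=> h Uu; have d1 := dF1 immF j Uu.
have : pd i (fun u => lorentz (fac b (pd j F u)) a) u = 0.
  rewrite -(pd_cst (0 : R) i u); apply: (pd_eq_on immF) => // u' Uu'.
  exact: section_f1 h Uu'.
rewrite (pd_lorentz i (differentiable_factor b d1) (differentiable_cst a u)).
by rewrite pd_cst lorentz0r addr0 (pd_factor b i d1).
Qed.

(** The unit normal of a plane section. *)
Lemma section_normal b a k u : in_plane_section b a k -> U u ->
  [/\ lorentz (a - k *: fac b (F u)) (fac b (F u)) = 0,
      lorentz (a - k *: fac b (F u)) (a - k *: fac b (F u)) = 1 &
      forall l, lorentz (a - k *: fac b (F u)) (fac b (pd l F u)) = 0].
Proof.
move=> h Uu; have [aa ax] := h; have [xx _] := hypm1P (pos_hyp immF b Uu).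
have xa := ax u Uu; have ta l := section_f1 l h Uu.
have tx l := f1_tangent immF b l Uu.
split=> [||l]; rewrite !(lorentzDl, lorentzDr, lorentzNl, lorentzNr, lorentzZl, lorentzZr).
- by rewrite (lorentzC a) xa xx; ring.
- by rewrite (lorentzC a (fac b (F u))) xa xx aa; ring.
- by rewrite (lorentzC a) ta (lorentzC (fac b (F u))) tx; ring.
Qed.

(** The position and the two partial derivatives are orthogonal to the unit normal
   of the section, hence dependent. *)
Lemma section_area b a k u : in_plane_section b a k -> U u -> areaf F b u = 0.
Proof.
move=> h Uu; have [nx nn nt] := section_normal h Uu.
apply/eqP; apply: contraT => D; have := nn.
rewrite (lorentz_nondegenerate D nx (nt 0) (nt 1)) lorentz0l => /esym/eqP.
by rewrite oner_eq0.
Qed.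

(** The plane that contains a piece of a factor curve is determined by its first
   two derivatives, up to the sign of the equation. *)
Lemma section_unique b a k a' k' u : U u -> in_plane_section b a k ->
  in_plane_section b a' k' -> (exists i, fac b (pd i F u) != 0) ->
  exists e : R, [/\ e != 0, a' = e *: a & k' = e * k].
Proof.
move=> Uu h h' [i vi]; set x := fac b (F u); set v := fac b (pd i F u).
have [nx nn nt] := section_normal h Uu; have [nx' nn' nt'] := section_normal h' Uu.
have nv := nt i; have nv' := nt' i.
have vx : lorentz v x = 0 := f1_tangent immF b i Uu.
have xH := pos_hyp immF b Uu; have [xx _] := hypm1P xH.
have S0 : 0 < lorentz v v := len2_neq0 immF Uu vi.
have fa := section_f2 i i h Uu; have fa' := section_f2 i i h' Uu.
have fx : lorentz (fac b (pd i (pd i F) u)) x = - lorentz v v.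
  by have [] := F2_position immF i i Uu; rewrite /x /v; case: (b).
rewrite -/x in nx nn nx' nn' xx; rewrite -/v -/x in nv nv'.
set w := fac b (pd i (pd i F) u) in fa fa' fx.
have [n nE] : {n | n = a - k *: x} by exists (a - k *: x).
have [n' n'E] : {n' | n' = a' - k' *: x} by exists (a' - k' *: x).
have aE : a = n + k *: x by rewrite nE subrK.
have aE' : a' = n' + k' *: x by rewrite n'E subrK.
rewrite -nE in nx nn nv; rewrite -n'E in nx' nn' nv'.
have D : det3 x v n != 0.
  have := det3_tangent xH vx nx; rewrite nn (lorentzC v n) nv mulr1 => D2.
  by apply/eqP => D0; move: D2 S0; rewrite D0 expr0n /= subr0 => <-; rewrite ltxx.
pose e := lorentz n' n.
have n'e : n' = e *: n.
  apply/eqP; rewrite -subr_eq0; apply/eqP; apply: (lorentz_nondegenerate D);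
    rewrite lorentzDl lorentzNl lorentzZl.
  - by rewrite nx' nx mulr0 subrr.
  - by rewrite nv' nv mulr0 subrr.
  - by rewrite nn mulr1 subrr.
have e0 : e != 0.
  by apply/eqP => e0; move: nn'; rewrite n'e e0 scale0r lorentz0l => /esym/eqP;
    rewrite oner_eq0.
have ke : k' = e * k.
  move: fa fa'; rewrite aE aE' n'e !(lorentzDr, lorentzZr) fx => w1 w2.
  apply: (mulIf (lt0r_neq0 S0)); move: w1 w2.
  move: (lorentz w n) (lorentz v v) => p q w1 w2.
  have -> : k' * q = e * p by lra.
  by rewrite -mulrA; congr (_ * _); lra.
by exists e; split=> //; rewrite aE' n'e ke aE scalerDr scalerA.
Qed.

End Rigidity.

(** * From charts to the surface *)

Section Models.
Context {R : realType}.
Local Notation R31 := 'rV[R]_3.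
Local Notation E := (R31 * R31)%type.
Local Notation plane := 'rV[R]_2.

(** The candidates for the image of a parallel surface, indexed by their
   parameters: products of plane sections, and graphs of isometries.  The
   conditions on the parameters are part of the set, so that an invalid
   parameter gives the empty set. *)
Definition model (t : (bool -> R31 * R) + 'M[R]_3) : set E :=
  match t with
  | inl p => [set x | forall b, lorentz (p b).1 (p b).1 = 1 - (p b).2 ^+ 2 /\
                                lorentz (fac b x) (p b).1 = - (p b).2]
  | inr B => [set x | proper_isometry B /\ x.1 *m B = x.2]
  end.

Lemma model_section (U : set plane) (F : plane -> E) p u b : U u ->
  (forall u, U u -> model (inl p) (F u)) -> in_plane_section U F b (p b).1 (p b).2.
Proof.
by move=> Uu H; split=> [|z Uz]; [case: (H u Uu b)|case: (H z Uz b)].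
Qed.

(** On a graph the area of a component vanishes nowhere, on a product of sections
   everywhere. *)
Lemma model_mixed (U : set plane) (F : plane -> E) p B u : is_immersion U F -> U u ->
  (forall u, U u -> model (inl p) (F u)) -> (forall u, U u -> model (inr B) (F u)) ->
  False.
Proof.
move=> immF Uu Hp HB; have iB : proper_isometry B by case: (HB u Uu).
have A := isometric_area immF Uu iB (fun z Uz => proj2 (HB z Uz)).
have A0 := section_area immF (model_section true Uu Hp) Uu.
by move: A; rewrite [area1 F u]A0 eqxx.
Qed.

(** A piece of surface determines the planes of the sections up to a common factor
   of the two parameters, and the isometry by its frames. *)
Lemma model_unique (U : set plane) (F : plane -> E) u t t' : is_immersion U F -> U u ->
  (forall u, U u -> model t (F u)) -> (forall u, U u -> model t' (F u)) ->
  model t = model t'.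
Proof.
move=> immF Uu; case: t t' => [p|B] [p'|B'] H H'.
- have e b : exists e : R, [/\ e != 0, (p' b).1 = e *: (p b).1 & (p' b).2 = e * (p b).2].
    apply: (section_unique immF Uu (model_section b Uu H) (model_section b Uu H')).
    apply: (exists_nonzero immF Uu).
    exact: (section_area immF (model_section (~~ b) Uu H) Uu).
  apply/funext => x; apply/propext; split=> Hx b; have [e0 [en ea ek]] := e b;
    have [aa xa] := Hx b; [have [aa' _] := H' u Uu b|have [aa' _] := H u Uu b]; split=> //.
    by rewrite ea ek lorentzZr xa mulrN.
  by apply: (mulfI en); rewrite mulrN -ek -lorentzZr -ea.
- by case: (model_mixed immF Uu H H').
- by case: (model_mixed immF Uu H' H).
- have iB : proper_isometry B by case: (H u Uu).
  have iB' : proper_isometry B' by case: (H' u Uu).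
  by rewrite (isometry_unique immF Uu iB iB' (fun z Uz => proj2 (H z Uz))
    (fun z Uz => proj2 (H' z Uz))).
Qed.

End Models.

Section Charts.
Context {R : realType} (S : smooth_surface R).
Local Notation R31 := 'rV[R]_3.
Local Notation E := (R31 * R31)%type.
Local Notation plane := 'rV[R]_2.
Variable Phi : S -> E.

Lemma rep_chart (c : chart R S) p : surf_atlas c -> chart_dom c p ->
  chart_im c (chart_map c p) /\ local_rep Phi c (chart_map c p) = Phi p.
Proof.
move=> ac cp; have [_ _ _ _ K] := surf_chart ac.
by split; [exists p|rewrite /local_rep /= K].
Qed.

Lemma chart_rep (c : chart R S) u : surf_atlas c -> chart_im c u ->
  exists2 p, chart_dom c p & chart_map c p = u /\ local_rep Phi c u = Phi p.
Proof.
move=> ac [p cp <-]; have [_ E] := rep_chart ac cp.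
by exists p.
Qed.

Lemma nbhs_chart (c : chart R S) p N : surf_atlas c -> chart_dom c p ->
  nbhs (chart_map c p) N -> nbhs p (chart_dom c `&` chart_map c @^-1` N).
Proof.
move=> ac cp nN; have [od _ cm _ _] := surf_chart ac.
have nd : nbhs p (chart_dom c) by exact: open_nbhs_nbhs.
apply: filterI => //.
have := cm; rewrite continuous_open_subspace // => /(_ p).
by rewrite inE => /(_ cp); apply.
Qed.

Lemma nbhs_chart_inv (c : chart R S) p N : surf_atlas c -> chart_dom c p ->
  nbhs p N -> nbhs (chart_map c p) (chart_im c `&` chart_inv c @^-1` N).
Proof.
move=> ac cp nN; have [_ oi _ ci K] := surf_chart ac.
have im : chart_im c (chart_map c p) by exists p.
apply: filterI; first exact: open_nbhs_nbhs.
have := ci; rewrite continuous_open_subspace // => /(_ (chart_map c p)).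
by rewrite inE => /(_ im); apply; rewrite K.
Qed.

Lemma chart_immersion c : immersion_into_HH Phi -> surf_atlas c ->
  is_immersion (chart_im c) (local_rep Phi c).
Proof.
move=> [hP iP] ac; have [_ oi _ _ _] := surf_chart ac; have [sF jF] := iP c ac.
by split=> // u _; exact: hP.
Qed.

Lemma chart_lagrangian c : lagrangian_surface Phi -> surf_atlas c ->
  is_lagrangian (chart_im c) (local_rep Phi c).
Proof. by move=> [_ lP] ac u v w; exact: lP. Qed.

(** [parallel_local] provides a model around each point, and [model_unique] makes
   it locally constant. *)
Lemma parallel_model (p0 : S) : connected [set: S] -> lagrangian_surface Phi ->
  parallel_second_ff Phi -> exists t, forall p, model t (Phi p).
Proof.
move=> cS lP pP.
apply: (@connected_single_member _ _ (fun t => Phi @^-1` model t) p0 cS) => [p|t t' p nt nt'].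
  have [c ac cp] := surf_cover p; have [im Fp] := rep_chart ac cp.
  have immF := chart_immersion (proj1 lP) ac.
  have /(parallel_nabla_hff immF) par := pP c ac.
  have [r r0 [rU H]] := parallel_local immF (chart_lagrangian lP ac) im par.
  have nr := nbhs_chart ac cp (nbhsx_ballx (chart_map c p) r r0).
  case: H => [[B iB BF]|[q qP]].
    exists (inr B); apply: filterS nr => z [cz /BF].
    by rewrite (proj2 (rep_chart ac cz)).
  exists (inl q); apply: filterS nr => z [cz bz] b; have [h1 h2] := qP b.
  by split=> //; rewrite -(proj2 (rep_chart ac cz)); exact: h2.
have [c ac cp] := surf_cover p; have immF := chart_immersion (proj1 lP) ac.
have [r r0 Hr] := nbhs_small_ball (nbhs_chart_inv ac cp (filterI nt nt')).
have immr := immersion_sub (ball_open _ r) (fun z rz => proj1 (Hr z rz)) immF.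
suff -> : model t = model t' by [].
by apply: (model_unique immr (ballxx _ r0)) => z /Hr[_ []].
Qed.

End Charts.

Lemma open_part_local (R : realType) (A B : set ('rV[R]_3 * 'rV[R]_3)) :
  (forall z, A z -> B z /\ nbhs z [set y | B y -> A y]) -> open_part A B.
Proof.
move=> H; exists ([set y | B y -> A y]°); first exact: open_interior.
apply/seteqP; split=> z; first by move=> /H.
by move=> [Bz /interior_subset]; apply.
Qed.

(** * Images of surfaces that lie in a model *)

Section OpenParts.
Context {R : realType}.
Local Notation R31 := 'rV[R]_3.
Local Notation E := (R31 * R31)%type.
Local Notation plane := 'rV[R]_2.

Lemma near_dist (V : normedModType R) (h : V -> R) z e : differentiable h z -> 0 < e ->
  \forall z' \near z, `|h z' - h z| < e.
Proof.
move=> /differentiable_continuous dh e0.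
exact: (@cvgr_distC_lt _ _ _ (nbhs z) _ h (h z) dh e e0).
Qed.

Lemma differentiable_fac b (z : E) : differentiable (fun z => fac b z) z.
Proof. exact: (differentiable_factor b (F := id)). Qed.

Section Isometry.
Variable B : 'M[R]_3.
Hypothesis iB : proper_isometry B.

Definition left_mulmx (C : 'M[R]_3) (z : E) : E := (z.1 *m C, z.2).

Lemma left_mulmx_linear C : linear (left_mulmx C).
Proof.
move=> k x y; rewrite /left_mulmx /=; congr pair.
exact: (mulmxr3_linear C k x.1 y.1).
Qed.

Lemma derive_left_mulmx C (z v : E) : 'D_v (left_mulmx C) z = left_mulmx C v.
Proof.
have d1 := differentiable_fac true z; have d2 := differentiable_fac false z.
rewrite /left_mulmx (derive_pair v (differentiable_mulmxr C d1) d2).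
rewrite (derive_mulmxr C v d1).
rewrite (derive_fst v (f := id)) // (derive_snd v (f := id)) //.
by rewrite derive_id.
Qed.

Lemma smooth_left_mulmx C U : smooth_on U (left_mulmx C).
Proof.
pose L : {linear E -> E} := HB.pack (left_mulmx C)
  (GRing.isLinear.Build _ _ _ _ _ (left_mulmx_linear C)).
apply: (@smooth_linear _ _ _ U L) => z; apply: differentiable_continuous.
have d1 := differentiable_fac true z; have d2 := differentiable_fac false z.
exact: (differentiable_pair (differentiable_mulmxr C d1) d2).
Qed.

Lemma left_mulmx_smooth_map C : (forall x, hyp (-1) x -> hyp (-1) (x *m C)) ->
  smooth_HH_map (left_mulmx C).
Proof.
move=> hC; split; last by move=> z [h1 h2]; split=> //=; exact: hC.
by exists setT; split=> //; [exact: openT|exact: smooth_left_mulmx].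
Qed.

Lemma left_mulmx_holomorphic : holomorphic_isometry (left_mulmx B).
Proof.
have uB := isometry_unit (iso_lorentz iB); split; last first.
  move=> z v _ _; rewrite !derive_left_mulmx /left_mulmx /J_HH /= !J_hypE.
  by rewrite (iso_lcross iB).
split; first exact: left_mulmx_smooth_map (iso_hyp iB).
- exists (left_mulmx (invmx B)); split.
  + by apply: left_mulmx_smooth_map => x; exact: proper_isometry_inv.
  + by move=> z _; rewrite /left_mulmx /= mulmxK //; case: z.
  + by move=> z _; rewrite /left_mulmx /= mulmxKV //; case: z.
by move=> z v w _ _ _; rewrite !derive_left_mulmx /gE /= (iso_lorentz iB).
Qed.

End Isometry.

Lemma hyp_coord (x y : R31) : hyp (-1) x -> hyp (-1) y ->
  x 0 1 = y 0 1 -> x 0 2 = y 0 2 -> x = y.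
Proof.
move=> /hypm1P[xx x0] /hypm1P[yy y0] e1 e2; apply: row3P => //.
apply/eqP; rewrite -(eqrXn2 (n := 2)) ?ltW //; apply/eqP.
by move: xx yy; rewrite /lorentz e1 e2; lra.
Qed.

(** The rescaling by [sqrt 2] in the definition of the diagonal surface changes
   the curvature from [-1/2] to [-1]. *)
Lemma diagonalP (z : E) : diagonal_surface z <-> hyp (-1) z.1 /\ z.1 = z.2.
Proof.
have s2 : (Num.sqrt 2 : R) != 0 by rewrite gt_eqF // sqrtr_gt0.
have s22 : (Num.sqrt 2 : R) ^+ 2 = 2 by rewrite sqr_sqrtr.
have p2 : 0 < (Num.sqrt 2 : R) by rewrite sqrtr_gt0.
split=> [[x [xx x0] <-]|].
  split=> //=; split; last by rewrite mxE mulr_gt0 // invr_gt0.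
  rewrite lorentzZl lorentzZr xx !invrN invrK invr1 mulrA -invfM -expr2 s22.
  by rewrite mulrN mulVf // pnatr_eq0.
case: z => y y' /= [/hypm1P[yy y0] <-]; exists (Num.sqrt 2 *: y).
  split; last by rewrite mxE mulr_gt0.
  by rewrite lorentzZl lorentzZr yy mulrA -expr2 s22 invrN invrK mulrN1.
by rewrite !scalerA mulVf // !scale1r.
Qed.

(** A plane section is parametrized near [x0] by the coordinate along a vector [v]
   tangent to it there: by [section_conic], the square of that coordinate is an
   injective function of [Q = - 1 - <x, x0>] while [|(1 - k^2) Q| < 1], and [Q]
   gives the remaining coordinate. *)
Lemma section_injective (x0 a v x y : R31) (k : R) : hyp (-1) x0 ->
  hyp (-1) x -> hyp (-1) y -> lorentz a a = 1 - k ^+ 2 ->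
  lorentz x0 a = - k -> lorentz x a = - k -> lorentz y a = - k ->
  lorentz v x0 = 0 -> lorentz v a = 0 -> 0 < lorentz v v ->
  `|(1 - k ^+ 2) * (1 + lorentz x x0)| < 1 ->
  `|(1 - k ^+ 2) * (1 + lorentz y x0)| < 1 ->
  lorentz x v = lorentz y v -> x = y.
Proof.
move=> x0H xH yH aa x0a xa ya vx va vv bx bY xy; have [xx _] := hypm1P x0H.
have [n nE] : {n | n = a - k *: x0} by exists (a - k *: x0).
have [t tE] : {t | t = (Num.sqrt (lorentz v v))^-1 *: v}.
  by exists ((Num.sqrt (lorentz v v))^-1 *: v).
have nx : lorentz n x0 = 0.
  by rewrite nE lorentzDl lorentzNl lorentzZl (lorentzC a) x0a xx; ring.
have nn : lorentz n n = 1.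
  rewrite {2}nE lorentzDr lorentzNr lorentzZr nx mulr0 subr0.
  by rewrite nE lorentzDl lorentzNl lorentzZl aa x0a; ring.
have tx : lorentz t x0 = 0 by rewrite tE lorentzZl vx mulr0.
have tn : lorentz t n = 0.
  by rewrite tE lorentzZl nE lorentzDr lorentzNr lorentzZr va vx; ring.
have tt : lorentz t t = 1.
  rewrite tE lorentzZl lorentzZr mulrA -invfM -expr2 sqr_sqrtr ?ltW //.
  by rewrite mulVf // gt_eqF.
have txy : lorentz x t = lorentz y t by rewrite tE !lorentzZr xy.
have xn : lorentz x n = k * (- 1 - lorentz x x0).
  by rewrite nE lorentzDr lorentzNr lorentzZr xa; ring.
have yn : lorentz y n = k * (- 1 - lorentz y x0).
  by rewrite nE lorentzDr lorentzNr lorentzZr ya; ring.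
have cx := section_conic x0H xH tx nx tn tt nn xn.
have cy := section_conic x0H yH tx nx tn tt nn yn.
have e : lorentz x x0 = lorentz y x0.
  move: cx cy bx bY; rewrite txy /=.
  move: (1 - k ^+ 2) (lorentz x x0) (lorentz y x0) (lorentz y t) => m p q s c1 c2.
  rewrite !ltr_norml => /andP[_ b1] /andP[_ b2].
  have z : (p - q) * (2 - m * (1 + p) - m * (1 + q)) = 0 by lra.
  move/eqP: z; rewrite mulf_eq0 => /orP[/eqP z|/eqP z]; first by lra.
  by exfalso; lra.
rewrite (frame_decomposition x x0H tx nx tn tt nn).
rewrite [RHS](frame_decomposition y x0H tx nx tn tt nn).
by rewrite xn yn txy e.
Qed.

End OpenParts.

Section Conclusions.
Context {R : realType} (S : smooth_surface R).
Local Notation R31 := 'rV[R]_3.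
Local Notation E := (R31 * R31)%type.
Local Notation plane := 'rV[R]_2.
Variable Phi : S -> E.
Hypothesis immP : immersion_into_HH Phi.

(** The image is open in the diagonal because a point of the hyperbolic plane is
   determined by its last two coordinates, and these have independent
   differentials on the surface. *)
Lemma graph_is_diagonal B : proper_isometry B ->
  (forall p, (Phi p).1 *m B = (Phi p).2) -> is_congruent_to_diagonal_part Phi.
Proof.
move=> iB PB; exists (left_mulmx B); first by left; exact: left_mulmx_holomorphic.
apply: open_part_local => _ [_ [p _ <-] <-].
have [HP1 HP2] := proj1 immP p; rewrite /left_mulmx PB; split.
  by apply/diagonalP.
have [c ac cp] := surf_cover p; have [im Fp] := rep_chart Phi ac cp.
have immF := chart_immersion immP ac.
set F := local_rep Phi c in Fp immF; set u0 := chart_map c p in im Fp.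
have FB u : chart_im c u -> (F u).1 *m B = (F u).2.
  by move=> /(chart_rep Phi ac)[q _ [_ Fq]]; rewrite /F Fq.
have de u i : chart_im c u -> differentiable (fun u => (F u).2 0 i) u.
  by move=> Uu; apply: differentiable_entry; exact: differentiable_snd (dF immF Uu).
have [u v Uu|e e0 He] := local_surjectivity (near_U immF im)
  (fun u Uu => conj (de u 1 Uu) (de u 2 Uu)).
  have d2 := differentiable_snd (dF immF Uu).
  rewrite -!(derive_entry _ _ d2) (derive_snd v (dF immF Uu)) => w1 w2.
  have [_ t2] := F_tangent immF v Uu.
  have w : ('D_v F u).2 = 0.
    have [_ /hypm1P[_ x0]] := imm_HH immF Uu.
    apply: row3P; rewrite ?w1 ?w2 !mxE //.
    move: t2; rewrite /lorentz w1 w2 !mul0r !addr0 => /eqP.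
    by rewrite oppr_eq0 mulf_eq0 (gt_eqF x0) orbF => /eqP.
  apply: (imm_inj immF Uu).
  have w' : ('D_v F u).1 *m B = 0.
    rewrite -w -(derive_fst v (dF immF Uu)) -(derive_snd v (dF immF Uu)).
    rewrite -(derive_mulmxr B v (differentiable_fst (dF immF Uu))).
    exact: (derive_eq_on immF).
  have w1' : ('D_v F u).1 = 0.
    by rewrite -(mulmxK (isometry_unit (iso_lorentz iB)) ('D_v F u).1) w' mul0mx.
  by case: ('D_v F u) w w1' => ? ? /= -> ->.
have n1 := near_dist (differentiable_entry 1 (differentiable_fac false ((Phi p).2, (Phi p).2))) e0.
have n2 := near_dist (differentiable_entry 2 (differentiable_fac false ((Phi p).2, (Phi p).2))) e0.
apply: filterS (filterI n1 n2) => -[y' y] /= [y1 y2] /diagonalP[/= yH yE].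
have := He (y 0 1) (y 0 2); rewrite Fp => /(_ y1 y2)[u Uu [u1 u2]].
have [q _ [_ Fq]] := chart_rep Phi ac Uu.
exists (Phi q); first by exists q.
have [_ hq] := proj1 immP q.
rewrite PB yE; rewrite yE in yH; rewrite -Fq -/F.
by have -> : (F u).2 = y by apply: hyp_coord => //; rewrite /F Fq.
Qed.

(** The image is open in the product because the coordinates of the two components
   along their velocities at a point have independent differentials. *)
Lemma sections_are_product (a : bool -> R31) (k : bool -> R) (p0 : S) :
  (forall b, lorentz (a b) (a b) = 1 - k b ^+ 2) ->
  (forall b p, lorentz (fac b (Phi p)) (a b) = - k b) ->
  is_product_of_constant_curvature_curves Phi.
Proof.
move=> aa Pa; have hP b p : hyp (-1) (fac b (Phi p)).
  by have [h1 h2] := proj1 immP p; case: b.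
have [b1 [s1 c1 p1 j1]] := plane_section_curve (hP true p0) (aa true) (Pa true p0).
have [b2 [s2 c2 p2 j2]] := plane_section_curve (hP false p0) (aa false) (Pa false p0).
have oT : open_interval [set: R] by split; [exact: openT|by []|exists 0].
exists setT, setT, b1, b2; split=> //; apply: open_part_local => _ [p _ <-]; split.
  have [s1' e1] := j1 _ (hP true p) (Pa true p).
  have [s2' e2] := j2 _ (hP false p) (Pa false p).
  by exists (s1', s2') => //=; rewrite e1 e2; case: (Phi p).
have [c ac cp] := surf_cover p; have [im Fp] := rep_chart Phi ac cp.
have immF := chart_immersion immP ac.
set F := local_rep Phi c in Fp immF; set u0 := chart_map c p in im Fp.
have inF b : in_plane_section (chart_im c) F b (a b) (k b).
  by split=> // u /(chart_rep Phi ac)[q _ [_ Fq]]; rewrite /F Fq.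
have A b u : chart_im c u -> areaf F b u = 0 by exact: (section_area immF (inF b)).
have [l fl] : exists l : bool -> 'I_2, forall b, fac b (pd (l b) F u0) != 0.
  have [l1 h1] := exists_nonzero immF (b := true) im (A false u0 im).
  have [l2 h2] := exists_nonzero immF (b := false) im (A true u0 im).
  by exists (fun b => if b then l1 else l2) => -[].
pose v b := fac b (pd (l b) F u0); pose x0 b := fac b (F u0).
pose close b z := `|(1 - k b ^+ 2) * (1 + lorentz (fac b z) (x0 b))| < 1.
pose N b := [set u | lorentz (fac b (pd (l b) F u)) (v b) != 0 /\ close b (F u)].
have close0 b : (1 - k b ^+ 2) * (1 + lorentz (x0 b) (x0 b)) = 0.
  by have [-> _] := hypm1P (pos_hyp immF b im); rewrite subrr mulr0.
have dclose (V : normedModType R) b (G : V -> E) z : differentiable (fun z => fac b (G z)) z ->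
    fac b (G z) = x0 b -> \forall z' \near z, close b (G z').
  move=> dG Gz; have dc (t : R) := differentiable_cst t z.
  have := near_dist (h := fun z => (1 - k b ^+ 2) * (1 + lorentz (fac b (G z)) (x0 b)))
    (differentiable_mul (dc _) (differentiable_add (dc _)
      (differentiable_lorentz dG (differentiable_cst (x0 b) z)))) ltr01.
  by rewrite Gz close0; apply: filterS => z'; rewrite subr0.
have closeP b : \forall z \near Phi p, close b z.
  apply: (dclose _ b id); first exact: differentiable_fac.
  by rewrite /x0 Fp.
have nN b : nbhs u0 (N b).
  have n1 := dclose _ b F u0 (differentiable_factor b (dF immF im)) erefl.
  apply: filterI n1.
  apply: (continuous_near_neq0 (f := fun u => lorentz (fac b (pd (l b) F u)) (v b))).
    apply: differentiable_lorentz; last exact: differentiable_cst.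
    exact: differentiable_factor (dF1 immF (l b) im).
  by rewrite gt_eqF // (len2_neq0 immF im (fl b)).
have nNN : nbhs u0 (chart_im c `&` (N true `&` N false)).
  by apply: filterI (near_U immF im) _; exact: filterI.
have dg b u : chart_im c u -> differentiable (fun u => lorentz (fac b (F u)) (v b)) u.
  move=> Uu; apply: differentiable_lorentz; last exact: differentiable_cst.
  exact: differentiable_factor (dF immF Uu).
have ker b u w : chart_im c u -> N b u ->
    'D_w (fun u => lorentz (fac b (F u)) (v b)) u = 0 -> fac b ('D_w F u) = 0.
  move=> Uu [/= nz _].
  rewrite (derive_lorentz w (differentiable_factor b (dF immF Uu)) (differentiable_cst (v b) u)).
  rewrite derive_cst lorentz0r addr0.
  have -> : 'D_w (fun u => fac b (F u)) u = fac b ('D_w F u).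
    by case: b {nz}; [exact: (derive_fst w (dF immF Uu))|exact: (derive_snd w (dF immF Uu))].
  have f0 : fac b (pd (l b) F u) != 0.
    by apply: contra nz => /eqP ->; rewrite lorentz0l.
  have S0 := len2_neq0 immF Uu f0.
  rewrite (derive_fac immF) // (rank_one immF 0 Uu S0 (A b u Uu)).
  rewrite (rank_one immF 1 Uu S0 (A b u Uu)) !scalerA -scalerDl lorentzZl => /eqP.
  by rewrite mulf_eq0 (negPf nz) orbF => /eqP ->; rewrite scale0r.
have [u w [Uu [N1 N2]] w1 w2|e e0 He] := local_surjectivity nNN
  (fun u Nu => conj (dg true u (proj1 Nu)) (dg false u (proj1 Nu))).
  apply: (imm_inj immF Uu); apply: (fac_eq0 (b := true)); [exact: ker w1|exact: ker w2].
have nz b : \forall z \near Phi p, `|lorentz (fac b z) (v b) - lorentz (fac b (Phi p)) (v b)| < e.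
  apply: (near_dist (h := fun z => lorentz (fac b z) (v b))) => //.
  apply: differentiable_lorentz; [exact: differentiable_fac|exact: differentiable_cst].
apply: filterS (filterI (filterI (closeP true) (closeP false)) (filterI (nz true) (nz false))).
move=> z [[C1 C2] [z1 z2]] [[t1 t2] _ /= zE].
have := He _ _; rewrite Fp => /(_ _ _ z1 z2) [u [Uu [[_ N1] [_ N2]]] [u1 u2]].
have [q _ [_ Fq]] := chart_rep Phi ac Uu.
have zP b : hyp (-1) (fac b z) /\ lorentz (fac b z) (a b) = - k b.
  by rewrite -zE; case: b => /=; split=> //; [case: s1 => _ + _|case: s2 => _ + _]; apply.
have vx b : lorentz (v b) (x0 b) = 0 := f1_tangent immF b (l b) im.
have va b : lorentz (v b) (a b) = 0 := section_f1 immF (l b) (inF b) im.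
have vv b : 0 < lorentz (v b) (v b) := len2_neq0 immF im (fl b).
have Fz b : close b (F u) -> close b z ->
    lorentz (fac b (F u)) (v b) = lorentz (fac b z) (v b) -> fac b (F u) = fac b z.
  move=> Cu Cz e'; have [zh za] := zP b.
  exact: (section_injective (pos_hyp immF b im) (pos_hyp immF b Uu) zh (aa b)
    (proj2 (inF b) u0 im) (proj2 (inF b) u Uu) za (vx b) (va b) (vv b) Cu Cz e').
exists q => //; rewrite -Fq -/F; have := Fz true N1 C1 u1; have := Fz false N2 C2 u2.
by rewrite /fac; case: (F u) => f1 f2; case: (z) => z3 z4 /= -> ->.
Qed.

End Conclusions.

(** * Products of curves are parallel *)

Section SectionsAreParallel.
Context {R : realType}.
Local Notation R31 := 'rV[R]_3.
Local Notation E := (R31 * R31)%type.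
Local Notation plane := 'rV[R]_2.

Variables (U : set plane) (F : plane -> E).
Hypothesis immF : is_immersion U F.

Lemma nabla_hff_normal k i j u : U u ->
  HH_tangent (F u) (nabla_hff F k i j u) /\
  forall l, gE (nabla_hff F k i j u) (pd l F u) = 0.
Proof.
move=> Uu; have [w ->] : exists w, nabla_hff F k i j u = normal_proj F u w.
  exists (pd k (hff F i j) u
    - (Gam F 0 k i u *: hff F 0 j u + Gam F 1 k i u *: hff F 1 j u)
    - (Gam F 0 k j u *: hff F i 0 u + Gam F 1 k j u *: hff F i 1 u)).
  have B (v w : E) : normal_proj F u (v - w) = normal_proj F u v - normal_proj F u w.
    by rewrite normal_projD -scaleN1r normal_projZ scaleN1r.
  have C (s t : R) (p q p' q' : 'I_2) :
      normal_proj F u (s *: hff F p q u + t *: hff F p' q' u)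
      = s *: hff F p q u + t *: hff F p' q' u.
    by rewrite normal_projD !normal_projZ !(normal_proj_hff immF).
  rewrite [RHS]B.
  rewrite [in RHS](B (pd k (hff F i j) u)).
  by rewrite !C.
split=> [|l]; first exact: (normal_proj_tangent immF).
exact: (normal_proj_orth immF).
Qed.

(** The surface is flat with split tangent planes, and the normal of each factor
   curve satisfies [n' = - k x'] with [k] constant. *)
Lemma sections_parallel (a : bool -> R31) (c : bool -> R) :
  (forall b, in_plane_section U F b (a b) (c b)) ->
  forall k i j u, U u -> nabla_hff F k i j u = 0.
Proof.
move=> inF k i j u Uu.
have A b u' (Uu' : U u') : areaf F b u' = 0 := section_area immF (inF b) Uu'.
have nz b u' : U u' -> exists l, 0 < lorentz (fac b (pd l F u')) (fac b (pd l F u')).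
  move=> Uu'; have [l fl] := exists_nonzero immF Uu' (A (~~ b) u' Uu').
  by exists l; exact: (len2_neq0 immF Uu' fl).
have spl b l u' : U u' -> exists v, 'D_v F u' = inj_fac b (fac b (pd l F u')).
  move=> Uu'; have [l1 s1] := nz b u' Uu'; have [l2 s2] := nz (~~ b) u' Uu'.
  exact: (tangent_split immF l Uu' (A b u' Uu') (A (~~ b) u' Uu') s1 s2).
have [[T1 T2] O] := nabla_hff_normal k i j Uu.
suff z b : fac b (nabla_hff F k i j u) = 0 by exact: (fac_eq0 (z true) (z false)).
pose n u := a b - c b *: fac b (F u).
have dx u' (Uu' : U u') := differentiable_factor b (dF immF Uu').
have dn u' : U u' -> differentiable n u'.
  move=> Uu'; apply: differentiable_sub; first exact: differentiable_cst.
  by apply: differentiable_scale; [exact: differentiable_cst|exact: dx].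
have pn l u' : U u' -> pd l n u' = - c b *: fac b (pd l F u').
  move=> Uu'; have ds := differentiable_scale (differentiable_cst (c b) u') (dx u' Uu').
  rewrite /n (pd_sub l (differentiable_cst (a b) u') ds).
  rewrite (pd_scale l (differentiable_cst (c b) u') (dx u' Uu')).
  by rewrite !pd_cst scale0r !add0r scaleNr (pd_factor b l (dF immF Uu')).
have SN u' (Uu' : U u') := section_normal immF (inF b) Uu'.
have := nabla_hff_factor immF dn (fun u' _ => differentiable_cst (c b) u')
  (fun u' Uu' => let: And3 h _ _ := SN u' Uu' in h)
  (fun l u' Uu' => let: And3 _ _ h := SN u' Uu' in h l) pn (spl b) k i j Uu.
rewrite pd_cst mul0r gE_inj_fac => Nn.
have [l sl] := nz b u Uu; have [v Dv] := spl b l u Uu.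
have Nf : lorentz (fac b (nabla_hff F k i j u)) (fac b (pd l F u)) = 0.
  rewrite -gE_inj_fac -Dv (derive_pd _ (dF immF Uu)) gEDr !gEZr !O.
  by rewrite !mulr0 addr0.
have Nx : lorentz (fac b (nabla_hff F k i j u)) (fac b (F u)) = 0.
  by case: (b); [exact: T1|exact: T2].
have [nx nn nf] := SN u Uu.
apply: (lorentz_nondegenerate _ Nx Nf Nn).
have := det3_tangent (pos_hyp immF b Uu) (f1_tangent immF b l Uu) nx.
rewrite nn (lorentzC _ (n u)) nf mulr1 expr0n /= subr0 => D2.
by rewrite -sqrf_eq0 D2 gt_eqF.
Qed.

End SectionsAreParallel.

Section ProductsAreParallel.
Context {R : realType} (S : smooth_surface R).
Variable Phi : S -> ('rV[R]_3 * 'rV[R]_3)%type.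
Hypothesis immP : immersion_into_HH Phi.

Lemma product_parallel :
  is_product_of_constant_curvature_curves Phi -> parallel_second_ff Phi.
Proof.
move=> [I1 [I2 [b1 [b2 [[I1o I2o] [a1 a2] [c1 c2] [W _ rO]]]]]].
have [p1 [k1 [h1 H1]]] := constant_curvature_plane I1o a1 c1.
have [p2 [k2 [h2 H2]]] := constant_curvature_plane I2o a2 c2.
move=> c ac; have immF := chart_immersion immP ac.
apply/(parallel_nabla_hff immF).
apply: (sections_parallel immF (a := fun b => if b then p1 else p2)
  (c := fun b : bool => if b then k1 else k2)) => b.
split=> [|u Uu]; first by case: b.
have [q _ [_ ->]] := chart_rep Phi ac Uu.
have : range Phi (Phi q) by exists q.
by rewrite rO => -[[[s1 s2] [/= I1s I2s] <-] _]; case: b; [exact: H1|exact: H2].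
Qed.

End ProductsAreParallel.

(** * The diagonal is totally geodesic *)

Section TwiceDifferentiable.
Context {R : realType}.
Local Notation R31 := 'rV[R]_3.
Local Notation E := (R31 * R31)%type.

Definition twice_differentiable (V W : normedModType R) (f : V -> W) (x : V) :=
  (\near x, differentiable f x) /\ forall v, differentiable ('D_v f) x.

Lemma twice_differentiableT (V W : normedModType R) (f : V -> W) x :
  (forall y, differentiable f y) -> (forall v, differentiable ('D_v f) x) ->
  twice_differentiable f x.
Proof. by move=> df d2; split=> //; exact: nearW. Qed.

Lemma smooth_twice_differentiable (V W : normedModType R) (U : set V) (f : V -> W) x :
  open U -> smooth_on U f -> U x -> twice_differentiable f x.
Proof.
move=> oU sf Ux; split=> [|v].
  by apply: filterS (open_nbhs_nbhs (conj oU Ux)) => y; exact: smooth_differentiable.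
exact: (smooth_differentiable (smooth_derive v sf) Ux).
Qed.

Lemma pair_sum_delta (v : E) : v = \sum_i v.1 0 i *: ((delta_mx 0 i, 0) : E)
  + \sum_i v.2 0 i *: ((0, delta_mx 0 i) : E).
Proof.
rewrite !sum_ord3; case: v => a b /=; congr pair; apply: row3P; rewrite !mxE /=; ring.
Qed.

Lemma derive_coordinates (W : normedModType R) (f : E -> W) x (v : E) : differentiable f x ->
  'D_v f x = \sum_i v.1 0 i *: 'D_((delta_mx 0 i, 0) : E) f x
    + \sum_i v.2 0 i *: 'D_((0, delta_mx 0 i) : E) f x.
Proof.
move=> df; rewrite {1}(pair_sum_delta v) deriveE // linearD !linear_sum.
by congr (_ + _); apply: eq_bigr => i _; rewrite linearZ deriveE.
Qed.

(** The directional derivative is linear in the direction, so it is enough to vary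
   the point, with the direction in a fixed basis. *)
Lemma differentiable_derive_along (V W : normedModType R) (p q : V -> E) (f : E -> W) x :
  differentiable p x -> differentiable q x -> twice_differentiable f (q x) ->
  differentiable (fun y => 'D_(p y) f (q y)) x.
Proof.
move=> dp dq [df d2f].
have nf : \near x, differentiable f (q x).
  have cq := differentiable_continuous dq; have H := cq _ df; exact H.
apply: (@differentiable_eq_near _ _ _ (fun y =>
  \sum_i (p y).1 0 i *: 'D_((delta_mx 0 i, 0) : E) f (q y)
  + \sum_i (p y).2 0 i *: 'D_((0, delta_mx 0 i) : E) f (q y))).
  by apply: filterS nf => y dfy; rewrite -derive_coordinates.
have d (v : E) : differentiable (fun y => 'D_v f (q y)) x.
  by apply: (differentiable_comp (g := 'D_v f)) => //; exact: d2f.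
have d1 i : differentiable (fun y => (p y).1 0 i) x.
  exact: differentiable_entry (differentiable_fst dp).
have d2 i : differentiable (fun y => (p y).2 0 i) x.
  exact: differentiable_entry (differentiable_snd dp).
under eq_fun do rewrite !sum_ord3.
by apply: differentiable_add; apply: differentiable_add; try apply: differentiable_add;
  apply: differentiable_scale.
Qed.

Lemma twice_differentiable_comp (V W : normedModType R) (q : V -> E) (f : E -> W) x :
  twice_differentiable q x -> twice_differentiable f (q x) ->
  twice_differentiable (fun y => f (q y)) x.
Proof.
move=> [dq d2q] [df d2f]; have dqx := nbhs_singleton dq.
have nf : \near x, differentiable f (q x).
  have cq := differentiable_continuous dqx; have H := cq _ df; exact H.
split=> [|v].
  apply: filterS (filterI dq nf) => y [dqy dfy].
  exact: (differentiable_comp (f := q)).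
apply: (@differentiable_eq_near _ _ _ (fun y => 'D_('D_v q y) f (q y))).
  by apply: filterS (filterI dq nf) => y [dqy dfy]; rewrite (derive_comp v dqy dfy).
exact: differentiable_derive_along.
Qed.

(** Koszul's argument: the tangential second derivatives of a map are determined
   by the metric that it induces. *)
Lemma second_derivative_of_metric (V : normedModType R) (k h : V -> E) w a b c :
  twice_differentiable k w -> twice_differentiable h w ->
  (forall a b, \forall w' \near w,
     gE ('D_a k w') ('D_b k w') = gE ('D_a h w') ('D_b h w')) ->
  gE ('D_a ('D_b k) w) ('D_c k w) = gE ('D_a ('D_b h) w) ('D_c h w).
Proof.
move=> Ck Ch kh.
have D (m : V -> E) p q r : twice_differentiable m w ->
    'D_p (fun w => gE ('D_q m w) ('D_r m w)) w
    = gE ('D_p ('D_q m) w) ('D_r m w) + gE ('D_p ('D_r m) w) ('D_q m w).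
  move=> [_ d2]; apply: (etrans (derive_gE p (d2 q) (d2 r))).
  exact: (f_equal2 +%R erefl (gEC ('D_q m w) ('D_p ('D_r m) w))).
have Y (m : V -> E) p q : twice_differentiable m w -> 'D_p ('D_q m) w = 'D_q ('D_p m) w.
  by move=> [d d2]; exact: derive_comm_pair d (d2 q) (d2 p).
have e p q r : gE ('D_p ('D_q k) w) ('D_r k w) + gE ('D_p ('D_r k) w) ('D_q k w)
    = gE ('D_p ('D_q h) w) ('D_r h w) + gE ('D_p ('D_r h) w) ('D_q h w).
  exact: (etrans (esym (D k p q r Ck)) (etrans (near_eq_derive p (kh q r)) (D h p q r Ch))).
have koszul (s s' : V -> V -> V -> R) : (forall p q r, s p q r = s q p r) ->
    (forall p q r, s' p q r = s' q p r) ->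
    (forall p q r, s p q r + s p r q = s' p q r + s' p r q) -> s a b c = s' a b c.
  move=> Sy Sy' H; have e1 := H a b c; have e2 := H b c a; have e3 := H c a b.
  rewrite (Sy b c a) (Sy' b c a) (Sy b a c) (Sy' b a c) in e2.
  by rewrite (Sy c a b) (Sy' c a b) in e3; lra.
have y m (Cm : twice_differentiable m w) p q r :
    gE ('D_p ('D_q m) w) ('D_r m w) = gE ('D_q ('D_p m) w) ('D_r m w).
  exact: (f_equal (fun z => gE z ('D_r m w)) (Y m p q Cm)).
exact (koszul (fun p q r => gE ('D_p ('D_q k) w) ('D_r k w))
  (fun p q r => gE ('D_p ('D_q h) w) ('D_r h w)) (y k Ck) (y h Ch) e).
Qed.

End TwiceDifferentiable.

(** The hyperboloid is a graph over the last two coordinates, which gives a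
   retraction defined on all of [R31]. *)
Section Retraction.
Context {R : realType}.
Local Notation R31 := 'rV[R]_3.
Local Notation E := (R31 * R31)%type.

Definition height (x : R31) : R := Num.sqrt (1 + x 0 1 ^+ 2 + x 0 2 ^+ 2).

Definition hyp_retract (x : R31) : R31 :=
  \row_(i < 3) nth 0 [:: height x; x 0 1; x 0 2] i.

Lemma height_gt0 x : 0 < height x.
Proof.
by rewrite sqrtr_gt0 -addrA ltr_wpDr // addr_ge0 // sqr_ge0.
Qed.

Lemma height_sqr x : height x ^+ 2 = 1 + x 0 1 ^+ 2 + x 0 2 ^+ 2.
Proof. by rewrite sqr_sqrtr // -addrA addr_ge0 // addr_ge0 // sqr_ge0. Qed.

Lemma hyp_retract_hyp x : hyp (-1) (hyp_retract x).
Proof.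
split; last by rewrite mxE /= height_gt0.
rewrite /lorentz !mxE /= invrN invr1 -!expr2 height_sqr; ring.
Qed.

Lemma hyp_retract_id x : hyp (-1) x -> hyp_retract x = x.
Proof. by move=> xH; apply: (hyp_coord (hyp_retract_hyp x) xH); rewrite mxE. Qed.

Lemma differentiable_height x : differentiable height x.
Proof.
have dx i : differentiable (fun x : R31 => x 0 i) x.
  by apply: (differentiable_entry (f := id)).
apply: differentiable_sqrt; first by rewrite -addrA ltr_wpDr // addr_ge0 // sqr_ge0.
apply: differentiable_add; last exact: (differentiable_mul (dx _) (dx _)).
by apply: differentiable_add (differentiable_cst _ _) _; exact: (differentiable_mul (dx _) (dx _)).
Qed.

Lemma derive_height v x :
  'D_v height x = (x 0 1 * v 0 1 + x 0 2 * v 0 2) / height x.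
Proof.
have dh := differentiable_height x.
have dx i : differentiable (fun x : R31 => x 0 i) x.
  by apply: (differentiable_entry (f := id)).
have Dx i : 'D_v (fun x : R31 => x 0 i) x = v 0 i.
  by rewrite -(derive_entry v i (f := id)) // derive_id.
have d2 i := differentiable_mul (dx i) (dx i).
have dc := differentiable_cst (1 : R) x.
have e : 'D_v (fun x => height x * height x) x
    = 'D_v (fun x : R31 => 1 + x 0 1 * x 0 1 + x 0 2 * x 0 2) x.
  congr ('D_v _ x); apply/funext => y; rewrite -expr2 height_sqr !expr2.
  by [].
move: e; rewrite (derive_mul v dh dh).
rewrite (derive_add v (differentiable_add dc (d2 1)) (d2 2)).
rewrite (derive_add v dc (d2 1)) derive_cst !(derive_mul v (dx _) (dx _)) !Dx => e.
apply: (mulIf (lt0r_neq0 (height_gt0 x))).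
rewrite divfK ?gt_eqF ?height_gt0 //.
by move: e; move: ('D_v height x) (height x) => p q; lra.
Qed.

Lemma differentiable_hyp_retract x : differentiable hyp_retract x.
Proof.
apply: differentiable_row => -[[|[|[|//]]] H].
- under eq_fun do rewrite mxE /=; exact: differentiable_height.
- under eq_fun do rewrite mxE /=; exact: (differentiable_entry (f := id)).
- under eq_fun do rewrite mxE /=; exact: (differentiable_entry (f := id)).
Qed.

Lemma derive_hyp_retract v x : 'D_v hyp_retract x
  = \row_(i < 3) nth 0 [:: (x 0 1 * v 0 1 + x 0 2 * v 0 2) / height x; v 0 1; v 0 2] i.
Proof.
have dr := differentiable_hyp_retract x.
have Dx i : 'D_v (fun x : R31 => x 0 i) x = v 0 i.
  by rewrite -(derive_entry v i (f := id)) // derive_id.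
apply: row3P; rewrite (derive_entry v _ dr); under eq_fun do rewrite mxE /=; rewrite mxE /=.
- exact: derive_height.
- exact: Dx.
- exact: Dx.
Qed.

Lemma derive_hyp_retract_tangent v x : hyp (-1) x -> lorentz v x = 0 ->
  'D_v hyp_retract x = v.
Proof.
move=> xH vx; have [_ x0] := hypm1P xH.
have hx : height x = x 0 0 by rewrite -[in RHS](hyp_retract_id xH) mxE.
rewrite derive_hyp_retract; apply: row3P; rewrite mxE //= hx.
apply: (mulIf (lt0r_neq0 x0)); rewrite divfK ?gt_eqF //.
by move: vx; rewrite /lorentz; lra.
Qed.

Lemma twice_differentiable_hyp_retract x : twice_differentiable hyp_retract x.
Proof.
apply: twice_differentiableT => [y|v]; first exact: differentiable_hyp_retract.
have dx i : differentiable (fun x : R31 => x 0 i) x.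
  by apply: (differentiable_entry (f := id)).
have dc (c : R) := differentiable_cst c x.
rewrite (_ : 'D_v hyp_retract = fun x => \row_(i < 3)
    nth 0 [:: (x 0 1 * v 0 1 + x 0 2 * v 0 2) / height x; v 0 1; v 0 2] i); last first.
  by apply/funext => y; exact: derive_hyp_retract.
apply: differentiable_row => -[[|[|[|//]]] H]; under eq_fun do rewrite mxE /=.
- apply: differentiable_mul.
    by apply: differentiable_add; apply: differentiable_mul.
  apply: differentiable_inv; first by rewrite gt_eqF ?height_gt0.
  exact: differentiable_height.
- exact: dc.
- exact: dc.
Qed.

Definition HH_retract (z : E) : E := (hyp_retract z.1, hyp_retract z.2).

Lemma HH_retract_HH z : HH (HH_retract z).
Proof. by split; exact: hyp_retract_hyp. Qed.

Lemma HH_retract_id z : HH z -> HH_retract z = z.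
Proof.
by case: z => x y [/= hx hy]; rewrite /HH_retract /= !hyp_retract_id.
Qed.

Lemma differentiable_HH_retract z : differentiable HH_retract z.
Proof.
apply: differentiable_pair.
  exact: (differentiable_comp (differentiable_fac true z) (differentiable_hyp_retract _)).
exact: (differentiable_comp (differentiable_fac false z) (differentiable_hyp_retract _)).
Qed.

Lemma derive_HH_retract (v z : E) :
  'D_v HH_retract z = ('D_(v.1) hyp_retract z.1, 'D_(v.2) hyp_retract z.2).
Proof.
have d1 := differentiable_fac true z; have d2 := differentiable_fac false z.
have r1 := differentiable_hyp_retract z.1; have r2 := differentiable_hyp_retract z.2.
rewrite (derive_pair v (differentiable_comp d1 r1) (differentiable_comp d2 r2)).
rewrite (derive_comp v d1 r1) (derive_comp v d2 r2).
have e1 : 'D_v (fun z : E => z.1) z = v.1.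
  apply: (etrans (derive_fst v (f := id) _)); last by rewrite derive_id.
  by [].
have e2 : 'D_v (fun z : E => z.2) z = v.2.
  apply: (etrans (derive_snd v (f := id) _)); last by rewrite derive_id.
  by [].
exact: (f_equal2 pair (f_equal (fun w => 'D_w _ _) e1) (f_equal (fun w => 'D_w _ _) e2)).
Qed.

Lemma derive_HH_retract_tangent z v : HH z -> HH_tangent z v -> 'D_v HH_retract z = v.
Proof.
move=> [h1 h2] [t1 t2]; rewrite derive_HH_retract !derive_hyp_retract_tangent //.
by case: v {t1 t2}.
Qed.

Lemma twice_differentiable_HH_retract z : twice_differentiable HH_retract z.
Proof.
apply: twice_differentiableT => [y|v]; first exact: differentiable_HH_retract.
rewrite (_ : 'D_v HH_retract =
    fun z => ('D_(v.1) hyp_retract z.1, 'D_(v.2) hyp_retract z.2)); last first.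
  by apply/funext => y; exact: derive_HH_retract.
have [_ r1] := twice_differentiable_hyp_retract z.1.
have [_ r2] := twice_differentiable_hyp_retract z.2.
apply: differentiable_pair.
  exact: (differentiable_comp (differentiable_fac true z) (r1 v.1)).
exact: (differentiable_comp (differentiable_fac false z) (r2 v.2)).
Qed.

End Retraction.

Section DiagonalIsTotallyGeodesic.
Context {R : realType}.
Local Notation R31 := 'rV[R]_3.
Local Notation E := (R31 * R31)%type.
Local Notation plane := 'rV[R]_2.

Lemma derive_slice (V W : normedModType R) (m : V * R -> W) u v (s : R) :
  'D_((v, 0) : V * R) m (u, s) = 'D_v (fun u => m (u, s)) u.
Proof.
have e : (fun h : R => h^-1 *: ((m \o shift (u, s)) (h *: ((v, 0) : V * R)) - m (u, s)))
  = fun h => h^-1 *: (((fun u => m (u, s)) \o shift u) (h *: v) - m (u, s)).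
  apply/funext => h; have -> : h *: ((v, 0) : V * R) = (h *: v, 0).
    exact: (f_equal (fun z : R => (h *: v, z)) (mulr0 h)).
  rewrite /=; congr (_ *: (m _ - _)); apply: (f_equal2 pair) => //.
  exact: add0r.
exact: (f_equal (fun g : R -> W => lim (g h @[h --> 0^'])) e).
Qed.

Section Variation.
Variables (U : set plane) (F : plane -> E).
Hypothesis immF : is_immersion U F.
Variable N : E.

(** A deformation of [F] with initial velocity [N]. *)
Definition variation (w : plane * R) : E := HH_retract (F w.1 + w.2 *: N).
Local Notation P := (fun w : plane * R => F w.1 + w.2 *: N).

Lemma variation_HH w : HH (variation w).
Proof. exact: HH_retract_HH. Qed.

Lemma variation_base u : U u -> variation (u, 0) = F u.
Proof.
by move=> Uu; rewrite /variation scale0r addr0 HH_retract_id //; exact: (imm_HH immF).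
Qed.

Lemma differentiable_line (w : plane * R) : U w.1 -> differentiable P w.
Proof.
move=> Uw; apply: differentiable_add.
  have d1 : differentiable (fun w : plane * R => w.1) w by exact: (differentiable_fst (f := id)).
  exact: (differentiable_comp d1 (dF immF Uw)).
apply: differentiable_scale; last exact: differentiable_cst.
exact: (differentiable_snd (f := id)).
Qed.

Lemma derive_line (a w : plane * R) : U w.1 -> 'D_a P w = 'D_(a.1) F w.1 + a.2 *: N.
Proof.
move=> Uw; have d1 : differentiable (fun w : plane * R => w.1) w.
  exact: (differentiable_fst (f := id)).
have d2 : differentiable (fun w : plane * R => w.2) w.
  exact: (differentiable_snd (f := id)).
have e1 : 'D_a (fun w : plane * R => w.1) w = a.1.
  by apply: (etrans (derive_fst a (f := id) _)); last by rewrite derive_id.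
have e2 : 'D_a (fun w : plane * R => w.2) w = a.2.
  by apply: (etrans (derive_snd a (f := id) _)); last by rewrite derive_id.
have dN := differentiable_cst N w.
apply: (etrans (derive_add a (differentiable_comp d1 (dF immF Uw)) (differentiable_scale d2 dN))).
apply: f_equal2.
  by apply: (etrans (derive_comp a d1 (dF immF Uw))); rewrite e1.
by rewrite (derive_scale d2 dN) e2 derive_cst scaler0 addr0.
Qed.

Lemma twice_differentiable_line u : U u -> twice_differentiable P (u, 0).
Proof.
move=> Uu; have d1 (w : plane * R) : differentiable (fun w : plane * R => w.1) w.
  exact: (differentiable_fst (f := id)).
have nU : \forall w \near ((u, 0) : plane * R), U w.1.
  have c := differentiable_continuous (d1 (u, 0)).
  by have H := c _ (near_U immF Uu); exact: H.
split=> [|a]; first by apply: filterS nU => w; exact: differentiable_line.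
apply: (@differentiable_eq_near _ _ _ (fun w => 'D_(a.1) F w.1 + a.2 *: N)).
  by apply: filterS nU => w Uw; rewrite derive_line.
apply: differentiable_add; last exact: differentiable_cst.
apply: (differentiable_comp (g := 'D_(a.1) F) (d1 (u, 0))).
exact: (smooth_differentiable (smooth_derive _ (imm_smooth immF)) Uu).
Qed.

Lemma twice_differentiable_variation u : U u -> twice_differentiable variation (u, 0).
Proof.
move=> Uu; apply: (twice_differentiable_comp (twice_differentiable_line Uu)).
exact: twice_differentiable_HH_retract.
Qed.

Lemma derive_variation u : U u -> HH_tangent (F u) N ->
  'D_((0, 1) : plane * R) variation (u, 0) = N.
Proof.
move=> Uu tN; have dP := @differentiable_line (u, 0) Uu.
apply: (etrans (derive_comp _ dP (differentiable_HH_retract _))).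
rewrite derive_line //=.
have -> : 'D_0 F u = 0 by rewrite (deriveE _ (dF immF Uu)) linear0.
rewrite add0r scale1r scale0r addr0.
exact: derive_HH_retract_tangent (imm_HH immF Uu) tN.
Qed.

Lemma second_slice (m : plane * R -> E) (h : plane -> E) i j u : U u ->
  (forall u, U u -> m (u, 0) = h u) ->
  'D_((coord_vec i, 0) : plane * R) ('D_((coord_vec j, 0) : plane * R) m) (u, 0)
  = pd i (pd j h) u.
Proof.
move=> Uu mh; apply: (etrans (derive_slice _ _ _ _)); rewrite pd_at.
apply: (derive_eq_on immF _ Uu) => u' Uu'.
apply: (etrans (derive_slice _ _ _ _)); rewrite pd_at.
exact: (derive_eq_on immF).
Qed.

Lemma derive_isometry_variation f u : HH_isometry f -> U u -> HH_tangent (F u) N ->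
  twice_differentiable (fun w => f (variation w)) (u, 0) /\
  'D_((0, 1) : plane * R) (fun w => f (variation w)) (u, 0) = 'D_N f (F u).
Proof.
move=> [[[W [oW HW sf]] fH] _ _] Uu tN.
have Kt := twice_differentiable_variation Uu.
have fK : twice_differentiable f (variation (u, 0)).
  exact: (smooth_twice_differentiable oW sf (HW _ (variation_HH _))).
split; first exact: (twice_differentiable_comp Kt fK).
have dK := nbhs_singleton (proj1 Kt).
apply: (etrans (derive_comp _ dK (nbhs_singleton (proj1 fK)))).
by rewrite (derive_variation Uu tN) (variation_base Uu).
Qed.

Lemma isometry_tangent f u : HH_isometry f -> U u -> HH_tangent (F u) N ->
  HH_tangent (f (F u)) ('D_N f (F u)).
Proof.
move=> isof Uu tN; have [Gt <-] := derive_isometry_variation isof Uu tN.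
rewrite -[X in HH_tangent (f X)](variation_base Uu).
apply: (derive_HH_tangent (m := fun w => f (variation w)) _ (nbhs_singleton (proj1 Gt))).
apply: filterS (proj1 Gt) => w _.
by have [[_ fH] _ _] := isof; apply: fH; exact: variation_HH.
Qed.

(** An isometry preserves the second derivatives of [F] against a tangent
   vector: apply Koszul's argument to a variation of [F] in that direction. *)
Lemma isometry_second_derivative f i j u : HH_isometry f -> U u -> HH_tangent (F u) N ->
  gE (pd i (pd j (fun u => f (F u))) u) ('D_N f (F u)) = gE (pd i (pd j F) u) N.
Proof.
move=> isof Uu tN; have [Gt Nf] := derive_isometry_variation isof Uu tN.
have Kt := twice_differentiable_variation Uu.
have [[[W [oW HW sf]] fH] _ gf] := isof.
have df w := smooth_differentiable sf (HW _ (variation_HH w)).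
have e1 := second_slice (m := variation) i j Uu variation_base.
have e2 := second_slice (m := fun w => f (variation w)) (h := fun u => f (F u)) i j Uu
  (fun u Uu => f_equal f (variation_base Uu)).
rewrite -e1 -e2 -Nf -[X in _ = gE _ X](derive_variation Uu tN).
have met a b : \forall w \near ((u, 0) : plane * R),
    gE ('D_a (fun w => f (variation w)) w) ('D_b (fun w => f (variation w)) w)
    = gE ('D_a variation w) ('D_b variation w); last first.
  exact: (second_derivative_of_metric _ _ _ Gt Kt met).
apply: filterS (proj1 Kt) => w dw.
have nHH : \forall w' \near w, HH (variation w').
  by apply: filterS (open_nbhs_nbhs (conj openT (I : setT w))) => w' _; exact: variation_HH.
apply: (etrans (f_equal2 gE (derive_comp a dw (df w)) (derive_comp b dw (df w)))).
by apply: gf; [exact: variation_HH|exact: (derive_HH_tangent _ dw nHH)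
  |exact: (derive_HH_tangent _ dw nHH)].
Qed.

End Variation.

Variables (U : set plane) (F : plane -> E) (f : E -> E).
Hypothesis immF : is_immersion U F.
Hypothesis isof : HH_isometry f.
Hypothesis diagF : forall u, U u -> (f (F u)).1 = (f (F u)).2.
Local Notation H := (fun u => f (F u)).

(** A normal vector of the diagonal is antidiagonal, while the second
   derivatives of a map into the diagonal are diagonal. *)
Lemma diagonal_hff i j u : U u -> hff F i j u = 0.
Proof.
move=> Uu.
have [[[W [oW HW sf]] fH] _ gf] := isof.
have ft u' : U u' -> twice_differentiable f (F u').
  by move=> Uu'; exact: (smooth_twice_differentiable oW sf (HW _ (imm_HH immF Uu'))).
have Ht u' : U u' -> twice_differentiable H u'.
  move=> Uu'; apply: (twice_differentiable_comp _ (ft u' Uu')).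
  exact: smooth_twice_differentiable (imm_open immF) (imm_smooth immF) Uu'.
have df u' (Uu' : U u') := nbhs_singleton (proj1 (ft u' Uu')).
have dH u' (Uu' : U u') := nbhs_singleton (proj1 (Ht u' Uu')).
have H1 l u' : U u' -> (pd l H u').1 = (pd l H u').2.
  move=> Uu'; rewrite -(pd_fst l (dH u' Uu')) -(pd_snd l (dH u' Uu')).
  exact: (pd_eq_on immF).
have dH1 : differentiable (pd j H) u by rewrite pdE; exact: (proj2 (Ht u Uu)).
have H2 : (pd i (pd j H) u).1 = (pd i (pd j H) u).2.
  rewrite -(pd_fst i dH1) -(pd_snd i dH1).
  by apply: (pd_eq_on immF) => // u' Uu'; exact: H1.
have DH l : pd l H u = 'D_(pd l F u) f (F u).
  by rewrite !pd_at; exact: derive_comp (dF immF Uu) (df u Uu).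
set N := hff F i j u.
have tN : HH_tangent (F u) N by rewrite /N hff_def; exact: (normal_proj_tangent immF).
have oN l : gE N (pd l F u) = 0 by rewrite /N hff_def; exact: (normal_proj_orth immF).
have FN : gE (pd i (pd j F) u) N = gE N N.
  by rewrite {2}/N hff_def normal_proj_normal.
apply: (gE_eq0 (imm_HH immF Uu) tN); rewrite -FN.
rewrite -(isometry_second_derivative immF i j isof Uu tN).
set M := 'D_N f (F u).
have MH l : gE M (pd l H u) = 0.
  by rewrite DH gf ?oN //; [exact: (imm_HH immF)|exact: (F1_tangent immF)].
have tM : HH_tangent (f (F u)) M by exact: (isometry_tangent immF isof Uu tN).
set y := (f (F u)).2; set h := fun l => (pd l H u).2.
have HE l : gE M (pd l H u) = lorentz (M.1 + M.2) (h l).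
  by rewrite /gE H1 // lorentzDl.
have y1 : (f (F u)).1 = y by exact: diagF.
have [_ yH] : HH (f (F u)) by apply: fH; exact: (imm_HH immF).
have th l : lorentz (h l) y = 0.
  by have [_] := isometry_tangent immF isof Uu (F1_tangent immF l Uu); rewrite -DH.
have gh k l : gE (pd k F u) (pd l F u) = 2 * lorentz (h k) (h l).
  rewrite -(gf (F u) _ _ (imm_HH immF Uu) (F1_tangent immF k Uu) (F1_tangent immF l Uu)).
  by rewrite -!DH /gE !H1 // /h; ring.
have D : det3 y (h 0) (h 1) != 0.
  have := det_gram immF Uu; rewrite det2 !gramE !gh (lorentzC (h 1) (h 0)).
  apply: contra => /eqP D0; have := det3_tangent yH (th 0) (th 1).
  rewrite D0 expr0n /= => e; apply/eqP; move: e.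
  by move: (lorentz (h 0) (h 0)) (lorentz (h 0) (h 1)) (lorentz (h 1) (h 1)) => p q r; lra.
have M0 : M.1 + M.2 = 0.
  apply: (lorentz_nondegenerate D); rewrite -?HE ?MH //.
  by have [m1 m2] := tM; rewrite lorentzDl -{1}y1 m1 m2 addr0.
by rewrite /gE H2 -lorentzDr M0 lorentz0r.
Qed.

End DiagonalIsTotallyGeodesic.

Section DiagonalsAreParallel.
Context {R : realType} (S : smooth_surface R).
Variable Phi : S -> ('rV[R]_3 * 'rV[R]_3)%type.
Hypothesis immP : immersion_into_HH Phi.

Lemma diagonal_parallel :
  is_congruent_to_diagonal_part Phi -> parallel_second_ff Phi.
Proof.
move=> [f hf [W _ fW]] c ac; have immF := chart_immersion immP ac.
have isof : HH_isometry f by case: hf => -[].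
have h0 i j u : chart_im c u -> hff (local_rep Phi c) i j u = 0.
  apply: (diagonal_hff immF isof) => z /(chart_rep Phi ac)[q _ [_ ->]].
  have : (f @` range Phi) (f (Phi q)) by exists (Phi q) => //; exists q.
  by rewrite fW => -[/diagonalP[]].
apply/(parallel_nabla_hff immF) => k i j u Uu.
have p0 : pd k (hff (local_rep Phi c) i j) u = 0.
  rewrite -(pd_cst (0 : 'rV[R]_3 * 'rV[R]_3) k u).
  by apply: (pd_eq_on immF) => // u' Uu'; exact: h0.
have n0 : normal_proj (local_rep Phi c) u 0 = 0.
  by rewrite -(scale0r 0) normal_projZ !scale0r.
by rewrite /nabla_hff p0 n0 !h0 // !scaler0 !addr0 !subr0.
Qed.

End DiagonalsAreParallel.

(** * The classification *)

Theorem theorem4p1 (R : realType) (S : smooth_surface R)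
    (Phi : S -> ('rV[R]_3 * 'rV[R]_3)%type)
    (S_connected : connected [set: S])
    (Phi_lagrangian : lagrangian_surface Phi) :
  parallel_second_ff Phi <->
  (is_product_of_constant_curvature_curves Phi \/
   is_congruent_to_diagonal_part Phi).
Proof.
have immP := proj1 Phi_lagrangian.
split=> [par|[prod|diag]]; [|exact: product_parallel|exact: diagonal_parallel].
have [[p0 _]|/forallNP noS] := pselect (exists p : S, True); last first.
  (* The empty surface is an open part of the diagonal. *)
  by right; apply: (graph_is_diagonal immP (proper_isometry1 (R := R))) => p; case: (noS p).
have [[p|B] tP] := parallel_model p0 S_connected Phi_lagrangian par; [left|right].
  apply: (sections_are_product immP (a := fun b => (p b).1) (k := fun b => (p b).2) p0).
    by move=> b; case: (tP p0 b).
  by move=> b q; case: (tP q b).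
by apply: (graph_is_diagonal immP (B := B)) => [|q]; [case: (tP p0)|case: (tP q)].
Qed.
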